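(* Let $\mathcal{S}_1\subseteq\mathcal{S}_2\subseteq\cdots$ be an increasing sequence of operator systems such that, for each $n$, $\mathcal{S}_n\subseteq C^*_e(\mathcal{S}_n)$ contains enough unitaries in $C^*_e(\mathcal{S}_n)$. Moreover, assume that each pair $\mathcal{S}_n\subseteq\mathcal{S}_{n+1}$ is $C^*_e$-increasing. If each $\mathcal{S}_n$ is $(\min,\mathrm{ess})$-nuclear, then $\varinjlim\mathcal{S}_n$ is $(\min,\mathrm{ess})$-nuclear.
   Context: An operator system is a unital self-adjoint subspace of $B(H)$. An inclusion of operator systems means a unital complete order embedding. The $C^*$-envelope $C^*_e(\mathcal{S})$ is the minimal $C^*$-cover of $\mathcal{S}$ (a $C^*$-cover is a unital $C^*$-algebra generated by a unital complete order embedded copy of $\mathcal{S}$): every $C^*$-cover of $\mathcal{S}$ surjects onto $C^*_e(\mathcal{S})$ by a unital $*$-homomorphism fixing $\mathcal{S}$. A pair $\mathcal{S}\subset\mathcal{T}$ is $C^*_e$-increasing if $C^*_e(\mathcal{S})\subset C^*_e(\mathcal{T})$ canonically, i.e. the inclusion extends to an injective unital $*$-homomorphism $C^*_e(\mathcal{S})\to C^*_e(\mathcal{T})$. $\mathcal{S}\subset A$ contains enough unitaries of the unital $C^*$-algebra $A$ if the unitaries of $A$ lying in $\mathcal{S}$ generate $A$ as a $C^*$-algebra. The inductive limit $\varinjlim\mathcal{S}_n$ along unital complete order embeddings $u_n:\mathcal{S}_n\to\mathcal{S}_{n+1}$ is the operator system $\mathcal{S}$ with unital complete order embeddings $\lambda_n:\mathcal{S}_n\to\mathcal{S}$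 satisfying $\lambda_n=\lambda_{n+1}\circ u_n$ and $\mathcal{S}=\overline{\bigcup_n\lambda_n(\mathcal{S}_n)}$, universal for compatible families of unital completely positive maps. Tensor products are operator system structures on the algebraic tensor product. $\min$: $u\in M_n(\mathcal{S}\otimes_{\min}\mathcal{T})^+$ iff $(\varphi\otimes\psi)^{(n)}(u)\ge 0$ for all unital completely positive maps $\varphi:\mathcal{S}\to M_k$, $\psi:\mathcal{T}\to M_m$, $k,m\in\mathbb{N}$. $\mathrm{ess}$: the structure inherited from the inclusion $\mathcal{S}\otimes_{\mathrm{ess}}\mathcal{T}\subseteq C^*_e(\mathcal{S})\otimes_{\max}C^*_e(\mathcal{T})$, where on $C^*$-algebras $\otimes_{\max}$ is the operator system structure inherited from the maximal $C^*$-tensor product. For operator system tensor products $\alpha,\beta$, $\mathcal{S}$ is $(\alpha,\beta)$-nuclear if the identity map $\mathcal{S}\otimes_\alpha\mathcal{T}\to\mathcal{S}\otimes_\beta\mathcal{T}$ is a complete order isomorphism for every operator system $\mathcal{T}$. *)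

(* Defs.v *)
From HB Require Import structures.
From mathcomp Require Import all_boot all_order all_algebra.
From mathcomp Require Import generic_quotient.
From mathcomp Require Import all_classical reals.
From mathcomp Require Import complex mxtens.

Set Implicit Arguments.
Unset Strict Implicit.
Unset Printing Implicit Defensive.

Import Order.TTheory GRing.Theory Num.Theory.

Local Open Scope classical_set_scope.
Local Open Scope quotient_scope.
Local Open Scope ring_scope.

Definition is_bilinear (K : comNzRingType) (V W X : lmodType K)
    (b : V -> W -> X) : Prop :=
  (forall w, linear (b^~ w)) /\ (forall v, linear (b v)).

Section AlgebraicTensor.
Variables (K : comNzRingType) (V W : lmodType K).

(* A list of pairs stands for the formal sum of the [p.1 (x) p.2]. *)
Definition tens_eval (X : nmodType) (b : V -> W -> X) (l : seq (V * W)) : X :=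
  \sum_(p <- l) b p.1 p.2.

(* Two formal sums are the same tensor when no bilinear map separates them. *)
Definition tens_equiv (l1 l2 : seq (V * W)) : bool :=
  `[< forall (X : lmodType K) (b : V -> W -> X),
        is_bilinear b -> tens_eval b l1 = tens_eval b l2 >].

Lemma tens_equiv_refl : reflexive tens_equiv.
Proof. by move=> l; apply/asboolP. Qed.

Lemma tens_equiv_sym : symmetric tens_equiv.
Proof.
by move=> l1 l2; apply/asboolP/asboolP => h X b hb; rewrite h.
Qed.

Lemma tens_equiv_trans : transitive tens_equiv.
Proof.
move=> l2 l1 l3 /asboolP h12 /asboolP h23; apply/asboolP => X b hb.
by rewrite h12 ?h23.
Qed.

Canonical tens_equiv_rel :=
  EquivRel tens_equiv tens_equiv_refl tens_equiv_sym tens_equiv_trans.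

Definition tens : Type := {eq_quot tens_equiv}.
HB.instance Definition _ : EqQuotient _ tens_equiv tens := EqQuotient.on tens.
HB.instance Definition _ := Choice.on tens.

Definition tens_lift (X : nmodType) (b : V -> W -> X) (u : tens) : X :=
  tens_eval b (repr u).

Definition tens_pure (v : V) (w : W) : tens := \pi_tens [:: (v, w)].

Lemma tens_lift_pi (X : lmodType K) (b : V -> W -> X) l :
  is_bilinear b -> tens_lift b (\pi_tens l) = tens_eval b l.
Proof.
move=> hb; have /eqmodP/asboolP h : repr (\pi_tens l) = l %[mod tens].
  by rewrite reprK.
exact: h.
Qed.

Lemma tens_eqP (u v : tens) :
  (forall (X : lmodType K) (b : V -> W -> X),
     is_bilinear b -> tens_lift b u = tens_lift b v) -> u = v.
Proof.
move=> h; rewrite -[u]reprK -[v]reprK; apply/eqmodP/asboolP => X b hb.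
exact: h.
Qed.

Let scale_seq (a : K) (l : seq (V * W)) := [seq (a *: p.1, p.2) | p <- l].

Definition tens_zero : tens := \pi_tens [::].
Definition tens_add (u v : tens) : tens := \pi_tens (repr u ++ repr v).
Definition tens_scale (a : K) (u : tens) : tens :=
  \pi_tens (scale_seq a (repr u)).
Definition tens_opp (u : tens) : tens := tens_scale (-1) u.

Let lift0 (X : lmodType K) (b : V -> W -> X) :
  is_bilinear b -> tens_lift b tens_zero = 0.
Proof. by move=> hb; rewrite tens_lift_pi // /tens_eval big_nil. Qed.

Let liftD (X : lmodType K) (b : V -> W -> X) u v :
  is_bilinear b ->
  tens_lift b (tens_add u v) = tens_lift b u + tens_lift b v.
Proof. by move=> hb; rewrite tens_lift_pi // /tens_eval big_cat. Qed.

Let liftZ (X : lmodType K) (b : V -> W -> X) a u :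
  is_bilinear b -> tens_lift b (tens_scale a u) = a *: tens_lift b u.
Proof.
move=> hb; rewrite tens_lift_pi // /tens_eval big_map scaler_sumr.
apply: eq_bigr => -[v w] _ /=; have := hb.1 w a v 0.
have b0 : b 0 w = 0 by have := hb.1 w (-1) 0 0; rewrite scaler0 addr0 scaleN1r addNr.
by rewrite addr0 b0 addr0.
Qed.

Let addA : associative tens_add.
Proof. by move=> u v w; apply: tens_eqP => X b hb; rewrite !liftD // addrA. Qed.
Let addC : commutative tens_add.
Proof. by move=> u v; apply: tens_eqP => X b hb; rewrite !liftD // addrC. Qed.
Let add0 : left_id tens_zero tens_add.
Proof. by move=> u; apply: tens_eqP => X b hb; rewrite liftD // lift0 // add0r. Qed.
Let addN : left_inverse tens_zero tens_opp tens_add.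
Proof.
move=> u; apply: tens_eqP => X b hb.
by rewrite liftD // liftZ // lift0 // scaleN1r addNr.
Qed.

HB.instance Definition _ := GRing.isZmodule.Build tens addA addC add0 addN.

Let scaleA a b u : tens_scale a (tens_scale b u) = tens_scale (a * b) u.
Proof. by apply: tens_eqP => X c hc; rewrite !liftZ // scalerA. Qed.
Let scale1 : left_id 1 tens_scale.
Proof. by move=> u; apply: tens_eqP => X b hb; rewrite liftZ // scale1r. Qed.
Let scaleDr : right_distributive tens_scale +%R.
Proof.
move=> a u v; apply: tens_eqP => X b hb.
by rewrite liftZ // !liftD // !liftZ // scalerDr.
Qed.
Let scaleDl u : {morph tens_scale^~ u : a b / a + b}.
Proof.
move=> a b; apply: tens_eqP => X c hc.
by rewrite liftD // !liftZ // scalerDl.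
Qed.

HB.instance Definition _ :=
  GRing.Zmodule_isLmodule.Build K tens scaleA scale1 scaleDr scaleDl.

End AlgebraicTensor.

Definition tens_map (K : comNzRingType) (V W V' W' : lmodType K)
    (f : V -> V') (g : W -> W') : tens V W -> tens V' W' :=
  tens_lift (fun v w => tens_pure (f v) (g w)).

Section OperatorSystems.
Variable R : realType.
Local Notation C := R[i].

(* The inner product is linear in the first and conjugate-linear in the second
   variable. *)
Definition dot_norm (U : lmodType C) (d : {dot U for Num.conj}) (x : U) : C :=
  sqrtC (d x x).

Record hilbert := Hilbert {
  hcar :> lmodType C;
  hdot : {dot hcar for Num.conj};
  hcomplete : forall x : nat -> hcar,
    (forall e : C, 0 < e -> exists N, forall m n,
       (N <= m)%N -> (N <= n)%N -> dot_norm hdot (x m - x n) < e) ->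
    exists l, forall e : C, 0 < e -> exists N, forall n,
       (N <= n)%N -> dot_norm hdot (x n - l) < e }.

Definition hnorm (H : hilbert) (x : H) : C := dot_norm (hdot H) x.

Definition opnorm_le (H : hilbert) (f : H -> H) (M : C) : Prop :=
  0 <= M /\ forall x, hnorm (f x) <= M * hnorm x.

Definition bounded_op (H : hilbert) (f : H -> H) : Prop :=
  linear f /\ exists M, opnorm_le f M.

Definition adjoint (H : hilbert) (f g : H -> H) : Prop :=
  forall x y, hdot H (f x) y = hdot H x (g y).

(* The operations on [H -> H] are the pointwise ones. *)
Record opsys := OpSys {
  os_hilb : hilbert;
  os_set : set (os_hilb -> os_hilb);
  os_bounded : forall f, os_set f -> bounded_op f;
  os_id : os_set id;
  os_lin : forall (a : C) f g, os_set f -> os_set g -> os_set (a *: f + g);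
  os_adj : forall f, os_set f -> exists2 g, os_set g & adjoint f g }.

Definition os_pred (S : opsys) : {pred os_hilb S -> os_hilb S} :=
  mem (@os_set S).
Arguments os_pred : clear implicits.

Lemma os_submod (S : opsys) : GRing.submod_closed (os_pred S).
Proof.
split=> [|a f g]; rewrite !in_setE; last exact: os_lin.
have := os_lin (-1) (os_id S) (os_id S).
by rewrite scaleN1r addNr.
Qed.
HB.instance Definition _ (S : opsys) :=
  GRing.isSubmodClosed.Build C (os_hilb S -> os_hilb S) (os_pred S)
    (os_submod S).

Record os_car (S : opsys) := OsCar {
  os_val :> os_hilb S -> os_hilb S;
  os_valP : os_val \in os_pred S }.
HB.instance Definition _ (S : opsys) := [isSub for @os_val S].
HB.instance Definition _ (S : opsys) := [Choice of os_car S by <:].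
HB.instance Definition _ (S : opsys) :=
  [SubChoice_isSubLmodule of os_car S by <:].


Local Coercion os_car : opsys >-> Sortclass.

Lemma os_setP (S : opsys) (x : S) : os_set (os_val x).
Proof. by have := os_valP x; rewrite in_setE. Qed.

Definition os_mk (S : opsys) f (hf : @os_set S f) : S :=
  @OsCar S f (mem_set hf).

Definition os_one (S : opsys) : S := os_mk (os_id S).

Lemma os_star_ex (S : opsys) (x : S) : exists y : S, adjoint x y.
Proof. by have [g hg xg] := os_adj (os_setP x); exists (os_mk hg). Qed.

Definition os_star (S : opsys) (x : S) : S := sval (cid (os_star_ex x)).

(* Norm-closed in B(H), that is, complete. *)
Definition norm_closed (S : opsys) : Prop :=
  forall f : os_hilb S -> os_hilb S, bounded_op f ->
    (forall e : C, 0 < e -> exists2 g, os_set g & opnorm_le (f - g) e) ->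
    os_set f.

Definition norm_dense (S : opsys) (P : set S) : Prop :=
  forall x : S, forall e : C, 0 < e -> exists2 y, P y & opnorm_le (x - y) e.

Definition matrix_cone (V : Type) := forall n : nat, set 'M[V]_n.

(* The order of M_n(B(H)) = B(H^n). *)
Definition os_pos (S : opsys) : matrix_cone S := fun n X =>
  forall xi : 'I_n -> os_hilb S,
    0 <= \sum_(i < n) \sum_(j < n) hdot (os_hilb S) (X i j (xi j)) (xi i).

(* The order of M_n(M_k) = B(C^k (+) ... (+) C^k). *)
Definition mx_pos (k : nat) : matrix_cone 'M[C]_k := fun n X =>
  forall xi : 'I_n -> 'cV[C]_k,
    0 <= (\sum_(i < n) \sum_(j < n)
            map_mx Num.conj (xi i)^T *m X i j *m xi j) 0 0.

Definition ucp_for (V W : lmodType C) (eV : V) (PV : matrix_cone V)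
    (eW : W) (PW : matrix_cone W) (f : V -> W) : Prop :=
  [/\ linear f, f eV = eW & forall n X, PV n X -> PW n (map_mx f X)].

Definition ucp (S T : opsys) (f : S -> T) : Prop :=
  ucp_for (os_one S) (@os_pos S) (os_one T) (@os_pos T) f.

Definition ucp_mx (S : opsys) (k : nat) (f : S -> 'M[C]_k) : Prop :=
  ucp_for (os_one S) (@os_pos S) 1%:M (@mx_pos k) f.

Definition unital_complete_order_embedding (S T : opsys) (f : S -> T) : Prop :=
  [/\ linear f, f (os_one S) = os_one T
    & forall n (X : 'M[S]_n), os_pos (map_mx f X) <-> os_pos X].

(* Unital C*-algebras, concretely represented. *)
Record cstar := CStar {
  cs_os :> opsys;
  cs_comp : forall f g,
    @os_set cs_os f -> @os_set cs_os g -> @os_set cs_os (f \o g);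
  cs_closed : norm_closed cs_os }.

Definition cs_mul (A : cstar) (x y : A) : A :=
  os_mk (cs_comp (os_setP x) (os_setP y)).

Definition star_hom (A B : cstar) (p : A -> B) : Prop :=
  [/\ linear p, p (os_one A) = os_one B,
      forall x y, p (cs_mul x y) = cs_mul (p x) (p y)
    & forall x, p (os_star x) = os_star (p x)].

Definition is_unitary (A : cstar) (x : A) : Prop :=
  cs_mul (os_star x) x = os_one A /\ cs_mul x (os_star x) = os_one A.

Definition is_cstar_subalgebra (A : cstar) (P : set A) : Prop :=
  [/\ P (os_one A),
      forall (a : C) x y, P x -> P y -> P (a *: x + y),
      forall x y, P x -> P y -> P (cs_mul x y),
      forall x, P x -> P (os_star x)
    & forall x, (forall e : C, 0 < e -> exists2 y, P y & opnorm_le (x - y) e) ->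
        P x].

Definition generates (A : cstar) (G : set A) : Prop :=
  forall P : set A, is_cstar_subalgebra P -> G `<=` P -> P = setT.

Definition is_cstar_cover (S : opsys) (A : cstar) (i : S -> A) : Prop :=
  unital_complete_order_embedding i /\ generates (range i).

Definition is_cstar_envelope (S : opsys) (A : cstar) (i : S -> A) : Prop :=
  is_cstar_cover i /\
  forall (B : cstar) (j : S -> B), is_cstar_cover j ->
    exists p : B -> A,
      [/\ star_hom p, forall a, exists b, p b = a & forall s, p (j s) = i s].

(* C*-envelopes exist and are unique up to an isomorphism fixing the operator
   system, so properties of C*_e(S) are stated for every C*-envelope of S. *)

Definition contains_enough_unitaries (S : opsys) (A : cstar) (i : S -> A) :
    Prop :=
  generates [set a | is_unitary a /\ range i a].

Definition enough_unitaries_in_envelope (S : opsys) : Prop :=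
  forall (A : cstar) (i : S -> A), is_cstar_envelope i ->
    contains_enough_unitaries i.

Definition cstar_e_increasing (S T : opsys) (u : S -> T) : Prop :=
  forall (A : cstar) (i : S -> A) (B : cstar) (j : T -> B),
    is_cstar_envelope i -> is_cstar_envelope j ->
    exists p : A -> B,
      [/\ star_hom p, injective p & forall s, p (i s) = j (u s)].

Definition is_inductive_limit (S : nat -> opsys)
    (u : forall n, S n -> S n.+1) (L : opsys) (l : forall n, S n -> L) : Prop :=
  [/\ forall n, unital_complete_order_embedding (l n),
      forall n s, l n s = l n.+1 (u n s),
      norm_dense (\bigcup_n range (l n))
      (* Only norm-closed targets: a limit strictly larger than the union does
         not factor the inclusions into the union itself. *)
    & forall (T : opsys) (f : forall n, S n -> T), norm_closed T ->
        (forall n, ucp (f n)) -> (forall n s, f n s = f n.+1 (u n s)) ->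
        exists! g : L -> T, ucp g /\ forall n s, g (l n s) = f n s].

Definition tensor_cone :=
  forall S T : opsys, matrix_cone (tens S T).

Definition min_pos : tensor_cone := fun S T n X =>
  forall (k m : nat) (f : S -> 'M[C]_k) (g : T -> 'M[C]_m),
    ucp_mx f -> ucp_mx g ->
    mx_pos (map_mx (tens_lift (fun s t => f s *t g t)) X).

(* Elementary tensors span, so by linearity these are the unital
   *-homomorphisms on the algebraic tensor product. *)
Definition tens_star_hom (A B D : cstar) (p : tens A B -> D) : Prop :=
  [/\ linear p, p (tens_pure (os_one A) (os_one B)) = os_one D,
      forall a a' b b', p (tens_pure (cs_mul a a') (cs_mul b b')) =
        cs_mul (p (tens_pure a b)) (p (tens_pure a' b'))
    & forall a b, p (tens_pure (os_star a) (os_star b)) =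
        os_star (p (tens_pure a b))].

(* [M] is the completion of the algebraic tensor product for the norm
   ||x||_max = sup ||p x|| over all *-representations [p]. *)
Definition is_max_tensor (A B M : cstar) (q : tens A B -> M) : Prop :=
  [/\ tens_star_hom q, norm_dense (range q)
    & forall x (c : C), opnorm_le (q x) c <->
        forall (D : cstar) (p : tens A B -> D), tens_star_hom p ->
          opnorm_le (p x) c].

Definition max_pos (A B : cstar) : matrix_cone (tens A B) := fun n X =>
  forall (M : cstar) (q : tens A B -> M), is_max_tensor q ->
    os_pos (map_mx q X).

Definition ess_pos : tensor_cone := fun S T n X =>
  forall (A : cstar) (i : S -> A) (B : cstar) (j : T -> B),
    is_cstar_envelope i -> is_cstar_envelope j ->
    max_pos (map_mx (tens_map i j) X).

(* Two cones on the same space: the identity map is a complete order isomorphism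
   exactly when they coincide. *)
Definition nuclear (alpha beta : tensor_cone) (S : opsys) : Prop :=
  forall (T : opsys) n (X : 'M[tens S T]_n), alpha S T n X <-> beta S T n X.

End OperatorSystems.

Coercion os_car : opsys >-> Sortclass.

(* Main.v *)
Require Import Defs.
From HB Require Import structures.
From mathcomp Require Import all_boot all_order all_algebra.
From mathcomp Require Import all_classical reals.
From mathcomp Require Import generic_quotient.
From mathcomp Require Import complex mxtens ring lra.
(** Write [A n] for the C*-envelope of [S n], and [E], [B] for those of [L] and
of a second operator system [T].  A matrix [X] over [L (x) T] involves finitely
many elements of [L], and these lie within [e] of elements of some [S N].  The
theorem follows because both cones can be compared over [S N], provided that
the error does not depend on the sizes of the matrix algebras in which
[min_pos] is tested.

From [min_pos] to [ess_pos] ([min_pos_ess_pos]).  Let [Y] be the matrix obtained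
from [X] by moving its left tensor factors to [S N], and let
[Z = Y + Y^* + 2 c] with [c] of order [e].  Compressing [X] and [Y] by a pair of
ucp maps gives numbers which differ by at most [c] ([approximantP]), so [Z] is
in [min_pos] over [L], hence over [S N] because the minimal tensor product is
injective ([min_pos_pullback]).  Nuclearity of [S N] makes it positive in the
maximal tensor product of [A N] and [B], and a *-homomorphism [A N -> E]
extending [S N -> L] carries it to the maximal tensor product of [E] and [B].
There it is within [O(e)] of [X + X^*], so [X] has nonnegative real part; [i X]
and [- i X] take care of the imaginary part.

The *-homomorphisms [A N -> E] ([canonical_map]).  As the pairs are increasing
there are *-homomorphisms [A n -> A n.+1], and through them every [A N] acts on
the ultraproduct of the Hilbert spaces of the [A m].  These representations agree
on the [S n], so the universal property extends them to a ucp map [g] on [L].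
It is a complete order embedding, because an element of [S N] that fails to be
positive fails by the same amount in every later [A m], and the witnessing
vectors give one vector of the ultraproduct ([uemb_reflect], [limit_embedding]).
So the C*-algebra generated by [g(L)] is a cover of [L], which surjects onto [E];
it contains the image of [A N], which is generated by [S N].

From [ess_pos] to [min_pos] ([ess_pos_min_pos]).  The representation of [A (x) B]
on the tensor product of the Hilbert spaces of [A] and [B] factors through the
maximal tensor product, and it dominates [min_pos]: on a finite set a ucp map
from [S] to [M_k] is a limit of maps [x |-> sum_v v^* x v] with vectors of the
Hilbert space of [A] ([vec_approx]).  This is a separation argument in a finite
dimensional space, and it is also what makes the minimal tensor product
injective.

Positivity in [ess_pos] is required in all maximal tensor products of all
envelopes, so examples of both are needed.  A maximal tensor product is the
direct sum of representations chosen so that every norm bound and every matrix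
positivity violated by some representation is violated by a summand
([max_mapP], [max_map_pos]).  The envelopes come from nuclearity: without them
[ess_pos] would contain the matrix [- 1 (x) 1] ([envelopes_exist]). *)

Set Implicit Arguments.
Unset Strict Implicit.
Unset Printing Implicit Defensive.
Import Order.TTheory GRing.Theory Num.Theory.
Import ComplexField.Normc.
Local Open Scope classical_set_scope.
Local Open Scope complex_scope.
Local Open Scope ring_scope.
Local Notation Re := complex.Re.
Local Notation Im := complex.Im.

(** * Complex numbers and semi-inner products *)

Section ComplexNumbers.
Variable R : realType.
Local Notation C := R[i].
Implicit Types z w : C.

Lemma conjCE z : z^* = conjc z.
Proof. by []. Qed.

Lemma ReD z w : Re (z + w) = Re z + Re w. Proof. by case: z; case: w. Qed.
Lemma ImD z w : Im (z + w) = Im z + Im w. Proof. by case: z; case: w. Qed.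
Lemma ReN z : Re (- z) = - Re z. Proof. by case: z. Qed.
Lemma ImN z : Im (- z) = - Im z. Proof. by case: z. Qed.
Lemma ReM z w : Re (z * w) = Re z * Re w - Im z * Im w.
Proof. by case: z; case: w. Qed.
Lemma ImM z w : Im (z * w) = Re z * Im w + Im z * Re w.
Proof. by case: z => a b; case: w. Qed.
Lemma ReJ z : Re z^* = Re z. Proof. by case: z. Qed.
Lemma ImJ z : Im z^* = - Im z. Proof. by case: z. Qed.
Definition CE := (ReD, ImD, ReN, ImN, ReM, ImM, ReJ, ImJ).

Lemma eqCri z w : Re z = Re w -> Im z = Im w -> z = w.
Proof. by case: z => a b; case: w => c d /= -> ->. Qed.

Lemma Re_sum (I : Type) (r : seq I) (P : pred I) (F : I -> C) :
  Re (\sum_(i <- r | P i) F i) = \sum_(i <- r | P i) Re (F i).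
Proof. by apply: (big_morph (@complex.Re R) ReD erefl). Qed.

Lemma ge0C z : (0 <= z) <-> (0 <= Re z /\ Im z = 0).
Proof. by rewrite lecE /=; split=> [/andP[/eqP]|[? ->]] //; rewrite eqxx. Qed.

Lemma normCE z : `|z| = (normc z)%:C. Proof. by []. Qed.

Lemma normc_ge0 z : 0 <= normc z.
Proof. by case: z => a b; rewrite sqrtr_ge0. Qed.

Lemma sqr_normcE z : normc z ^+ 2 = Re z ^+ 2 + Im z ^+ 2.
Proof. by case: z => a b /=; rewrite sqr_sqrtr// addr_ge0 ?sqr_ge0. Qed.

Lemma normcD z w : normc (z + w) <= normc z + normc w.
Proof. exact: le_normcD. Qed.

Lemma normcB z w : normc (z - w) <= normc z + normc w.
Proof. by rewrite -(normcN w); exact: le_normcD. Qed.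

Lemma normc_sum (I : Type) (r : seq I) (P : pred I) (F : I -> C) :
  normc (\sum_(i <- r | P i) F i) <= \sum_(i <- r | P i) normc (F i).
Proof.
apply: (big_ind2 (fun z a => normc z <= a)) => //; first by rewrite normc0.
by move=> z a w b h k; apply: le_trans (normcD _ _) (lerD h k).
Qed.

Lemma normc_conj z : normc z^* = normc z.
Proof. by case: z => a b /=; rewrite sqrrN. Qed.

Lemma normc_real (a : R) : normc a%:C = `|a|.
Proof. by rewrite /= expr0n addr0 sqrtr_sqr. Qed.

Lemma Re_le_normc z : `|Re z| <= normc z.
Proof. by case: z => a b /=; rewrite -sqrtr_sqr ler_sqrt ?lerDl ?addr_ge0 ?sqr_ge0. Qed.

Lemma Im_le_normc z : `|Im z| <= normc z.
Proof. by case: z => a b /=; rewrite -sqrtr_sqr ler_sqrt ?lerDr ?addr_ge0 ?sqr_ge0. Qed.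

Lemma normc_le_ReIm z : normc z <= `|Re z| + `|Im z|.
Proof.
rewrite -(@ler_pXn2r _ 2) ?nnegrE ?normc_ge0 ?addr_ge0 //.
rewrite sqr_normcE -(real_normK (num_real (Re z))) -(real_normK (num_real (Im z))).
have := normr_ge0 (Re z); have := normr_ge0 (Im z).
set a := `|Re z|; set b := `|Im z|; nra.
Qed.

Lemma ler_small (a c : R) : (forall e, 0 < e -> a <= c * e) -> a <= 0.
Proof.
move=> h; rewrite leNgt; apply/negP => a0.
have c1 : 0 < 2 * (`|c| + 1) by have := normr_ge0 c; lra.
have /h : 0 < a / (2 * (`|c| + 1)) by rewrite divr_gt0.
rewrite leNgt => /negP; apply.
rewrite mulrA ltr_pdivrMr// [c * a]mulrC ltr_pM2l//.
have := ler_norm c; have := normr_ge0 c; lra.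
Qed.

Lemma ler_small0 (a : R) : (forall e, 0 < e -> a <= e) -> a <= 0.
Proof. by move=> h; apply: (@ler_small _ 1) => e /h; rewrite mul1r. Qed.

Lemma invn_gt0 n : 0 < n.+1%:R^-1 :> R.
Proof. by rewrite invr_gt0 ltr0n. Qed.

Lemma ex_invn (e : R) : 0 < e ->
  exists N, forall n, (N <= n)%N -> n.+1%:R^-1 <= e.
Proof.
move=> e0; have [N hN] : exists N, e^-1 < N%:R.
  by exists (Num.truncn e^-1).+1; apply: truncnS_gt.
exists N => n Nn; rewrite -[e]invrK lef_pV2 ?posrE ?invr_gt0 ?ltr0n//.
by apply: le_trans (ltW hN) _; rewrite ler_nat ltnW.
Qed.

End ComplexNumbers.

Section HermitianForms.
Variable R : realType.
Local Notation C := R[i].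

(** Definiteness is left out: the vectors of length 0 disappear in the
completion. *)
Definition hform (V : lmodType C) (s : V -> V -> C) : Prop :=
  [/\ forall a x y z, s (a *: x + y) z = a * s x z + s y z,
      forall x y, s y x = (s x y)^*
    & forall x, 0 <= s x x].

Variables (V : lmodType C) (s : V -> V -> C).
Hypothesis hs : hform s.
Implicit Types x y z : V.

Lemma hfP a x y z : s (a *: x + y) z = a * s x z + s y z.
Proof. by case: hs. Qed.
Lemma hfC x y : s y x = (s x y)^*. Proof. by case: hs. Qed.
Lemma hf_ge0 x : 0 <= s x x. Proof. by case: hs. Qed.

Lemma hfD x y z : s (x + y) z = s x z + s y z.
Proof. by have := hfP 1 x y z; rewrite scale1r mul1r. Qed.
Lemma hf0 z : s 0 z = 0.
Proof. by have := hfD 0 0 z; rewrite addr0 -{1}[s 0 z]addr0 => /addrI. Qed.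
Lemma hfZ a x z : s (a *: x) z = a * s x z.
Proof. by have := hfP a x 0 z; rewrite !addr0 hf0 addr0. Qed.
Lemma hfN x z : s (- x) z = - s x z.
Proof. by rewrite -scaleN1r hfZ mulN1r. Qed.
Lemma hfB x y z : s (x - y) z = s x z - s y z.
Proof. by rewrite hfD hfN. Qed.
Lemma hfDr x y z : s z (x + y) = s z x + s z y.
Proof. by rewrite hfC hfD rmorphD /= -!hfC. Qed.
Lemma hf0r z : s z 0 = 0. Proof. by rewrite hfC hf0 rmorph0. Qed.
Lemma hfZr a x z : s z (a *: x) = a^* * s z x.
Proof. by rewrite hfC hfZ rmorphM /= -!hfC. Qed.
Lemma hfNr x z : s z (- x) = - s z x.
Proof. by rewrite hfC hfN rmorphN /= -!hfC. Qed.
Lemma hfBr x y z : s z (x - y) = s z x - s z y.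
Proof. by rewrite hfDr hfNr. Qed.
Lemma hf_suml (I : Type) (r : seq I) (P : pred I) F z :
  s (\sum_(i <- r | P i) F i) z = \sum_(i <- r | P i) s (F i) z.
Proof. by apply: (big_morph (s^~ z) _ (hf0 z)) => x y; apply: hfD. Qed.
Lemma hf_sumr (I : Type) (r : seq I) (P : pred I) F z :
  s z (\sum_(i <- r | P i) F i) = \sum_(i <- r | P i) s z (F i).
Proof. by apply: (big_morph (s z) _ (hf0r z)) => x y; apply: hfDr. Qed.

Lemma hfIm x : Im (s x x) = 0.
Proof. by have /ge0C[] := hf_ge0 x. Qed.
Lemma hfRe x : 0 <= Re (s x x).
Proof. by have /ge0C[] := hf_ge0 x. Qed.

Definition sn x : R := Num.sqrt (Re (s x x)).

Lemma sn_ge0 x : 0 <= sn x. Proof. exact: sqrtr_ge0. Qed.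
Lemma sqr_sn x : sn x ^+ 2 = Re (s x x).
Proof. by rewrite sqr_sqrtr// hfRe. Qed.
Lemma hf_diag x : s x x = (sn x ^+ 2)%:C.
Proof. by rewrite sqr_sn; apply: eqCri => //=; rewrite hfIm. Qed.

Lemma sn_le x c : 0 <= c -> (sn x <= c) = (Re (s x x) <= c ^+ 2).
Proof. by move=> c0; rewrite -sqr_sn ler_pXn2r// nnegrE sn_ge0. Qed.

Lemma sn0 : sn 0 = 0. Proof. by rewrite /sn hf0 sqrtr0. Qed.

(** The polynomial [|x - l s(x, y) y|^2] in the real variable [l] is
nonnegative; it is evaluated at [l = 1 / |y|^2], and when [|y| = 0] it is affine
in [l], which forces [s x y = 0]. *)
Lemma hf_CS x y : normc (s x y) <= sn x * sn y.
Proof.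
rewrite -(@ler_pXn2r _ 2) ?nnegrE ?mulr_ge0 ?normc_ge0 ?sn_ge0//.
rewrite exprMn !sqr_sn.
have key l : 0 <= Re (s x x) - 2 * l * normc (s x y) ^+ 2
               + l ^+ 2 * normc (s x y) ^+ 2 * Re (s y y).
  have := hfRe (x - (l%:C * s x y) *: y).
  rewrite !(hfB, hfBr, hfZ, hfZr) (hfC x y) sqr_normcE !CE /= !hfIm.
  congr (0 <= _); ring.
have a0 := hfRe x; have := hfRe y; rewrite le_eqVlt => /orP[/eqP b0|b0].
  rewrite -b0 mulr0; set c := _ ^+ 2.
  have c0 : 0 <= c by rewrite sqr_ge0.
  rewrite leNgt; apply/negP => c1.
  have := key ((Re (s x x) + 1) / c); rewrite -b0 -/c mulr0 addr0.
  rewrite -mulrA divfK ?gt_eqF//; lra.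
have := key (Re (s y y))^-1; set c := _ ^+ 2.
set b := Re (s y y) in b0 *; set a := Re (s x x) => h.
rewrite -subr_ge0; have -> : a * b - c =
   b * (a - 2 * b^-1 * c + b^-1 ^+ 2 * c * b) by field; rewrite gt_eqF.
by rewrite mulr_ge0// ltW.
Qed.

Lemma snZ a x : sn (a *: x) = normc a * sn x.
Proof.
apply/eqP; rewrite -(@eqrXn2 _ 2) ?mulr_ge0 ?normc_ge0 ?sn_ge0//.
rewrite exprMn !sqr_sn hfZ hfZr sqr_normcE !CE hfIm; apply/eqP; ring.
Qed.

Lemma snN x : sn (- x) = sn x.
Proof. by rewrite /sn hfN hfNr opprK. Qed.

Lemma snD x y : sn (x + y) <= sn x + sn y.
Proof.
rewrite sn_le ?addr_ge0 ?sn_ge0// hfD !hfDr !CE sqrrD -!sqr_sn.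
have := hf_CS x y; have := Re_le_normc (s x y).
have := ler_norm (Re (s x y)); rewrite (hfC x y) ReJ => h1 h2 h3.
by rewrite mulr2n; lra.
Qed.

Lemma snB x y : sn (x - y) <= sn x + sn y.
Proof. by rewrite -(snN y) snD. Qed.

Lemma sn_dist x y : sn (x - y) = sn (y - x).
Proof. by rewrite -snN opprB. Qed.

End HermitianForms.

(** * Limits along a free ultrafilter, and norms in Hilbert spaces *)

Section GeneralizedLimit.
Variable R : realType.
Local Notation C := R[i].
Implicit Types (x : nat -> R) (z : nat -> C).

Definition free_ultra : set_system nat := sval (cid (ultraFilterLemma eventually_filter)).
Local Notation U := free_ultra.

Lemma free_ultraP : UltraFilter U.
Proof. by rewrite /U; case: cid => G /= []. Qed.
#[local] Existing Instance free_ultraP.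

Lemma free_ultra_tail (A : set nat) N : (forall n, (N <= n)%N -> A n) -> U A.
Proof.
move=> h; rewrite /U; case: cid => G /= [_]; apply.
by exists N => // n /= Nn; apply: h.
Qed.

(** The limit of a bounded [x] along the ultrafilter, written as a supremum so
that it is total. *)
Definition ulim x : R := sup [set t | U [set n | t <= x n]].

Lemma ulimP x M : U [set n | `|x n| <= M] ->
  forall e, 0 < e -> U [set n | `|x n - ulim x| <= e].
Proof.
move=> xM e e0; set S := [set t | U [set n | t <= x n]].
have SM : S (- M).
  apply: filterS xM => n /=; rewrite ler_norml; by case/andP.
have Sb t : S t -> t <= M.
  move=> St; have [n [/= h1 h2]] := filter_ex (filterI St xM).
  by apply: le_trans h1 _; apply: le_trans (ler_norm _) h2.
have hS : has_sup S by split; [exists (- M) | exists M].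
have [t St et] := sup_adherent e0 hS.
have nS : ~ S (ulim x + e).
  by move=> /(ub_le_sup hS.2); rewrite /ulim -/S; lra.
have [//|nS'] := in_ultra_setVsetC [set n | ulim x + e <= x n] free_ultraP.
apply: filterS (filterI St nS') => n /= [h1 /negP].
by rewrite -ltNge ler_distl => h2; apply/andP; split; rewrite /ulim -/S in h2 *; lra.
Qed.

Definition clim z : C := ulim (fun n => Re (z n)) +i* ulim (fun n => Im (z n)).

Arguments clim : simpl never.

Definition ubounded z := exists M, U [set n | normc (z n) <= M].

Lemma climP z : ubounded z ->
  forall e, 0 < e -> U [set n | normc (z n - clim z) <= e].
Proof.
move=> [M zM] e e0; have e2 : 0 < e / 2 by rewrite divr_gt0.
have h1 : U [set n | `|Re (z n)| <= M].
  by apply: filterS zM => n /=; apply: le_trans (Re_le_normc _).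
have h2 : U [set n | `|Im (z n)| <= M].
  by apply: filterS zM => n /=; apply: le_trans (Im_le_normc _).
apply: filterS (filterI (ulimP h1 e2) (ulimP h2 e2)) => n /= [k1 k2].
apply: le_trans (normc_le_ReIm _) _; rewrite !CE /=.
by rewrite [e]splitr lerD.
Qed.

Lemma clim_unique z l : (forall e, 0 < e -> U [set n | normc (z n - l) <= e]) ->
  clim z = l.
Proof.
move=> h.
have zb : ubounded z.
  exists (1 + normc l); apply: filterS (h 1 ltr01) => n /= k.
  by rewrite -[z n](subrK l); apply: le_trans (normcD _ _) _; rewrite lerD2r.
apply/eqP; rewrite -subr_eq0; apply/eqP; apply: eq0_normc; apply/eqP.
rewrite eq_le normc_ge0 andbT; apply: (@ler_small _ _ 2) => e e0.
have [n [/= h1 h2]] := filter_ex (filterI (h e e0) (climP zb e0)).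
have -> : clim z - l = (z n - l) - (z n - clim z) by ring.
by apply: le_trans (normcB _ _) _; lra.
Qed.

Lemma climD z w : ubounded z -> ubounded w ->
  clim (fun n => z n + w n) = clim z + clim w.
Proof.
move=> hz hw; apply: clim_unique => e e0.
have e2 : 0 < e / 2 by rewrite divr_gt0.
apply: filterS (filterI (climP hz e2) (climP hw e2)) => n /= [k1 k2].
rewrite opprD addrACA; apply: le_trans (normcD _ _) _.
by rewrite [e]splitr lerD.
Qed.

Lemma climZ a z : ubounded z -> clim (fun n => a * z n) = a * clim z.
Proof.
move=> hz; apply: clim_unique => e e0.
have a1 : 0 < normc a + 1 by have := normc_ge0 a; lra.
have e2 : 0 < e / (normc a + 1) by rewrite divr_gt0.
apply: filterS (climP hz e2) => n /= k1.
rewrite -mulrBr normcM; apply: le_trans (_ : (normc a + 1) * (e / (normc a + 1)) <= e).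
  by apply: ler_pM; rewrite ?normc_ge0 ?lerDl.
by rewrite mulrC divfK// gt_eqF.
Qed.

Lemma climJ z : ubounded z -> clim (fun n => (z n)^*) = (clim z)^*.
Proof.
move=> hz; apply: clim_unique => e e0.
by apply: filterS (climP hz e0) => n /=; rewrite -rmorphB normc_conj.
Qed.

Lemma clim_Re_ge c z : ubounded z -> U [set n | c <= Re (z n)] -> c <= Re (clim z).
Proof.
move=> hz; move: (climP hz); move: (clim z) => l hl h.
rewrite -subr_le0; apply: ler_small0 => e e0.
have [n [/= h1 h2]] := filter_ex (filterI h (hl e e0)).
have := Re_le_normc (z n - l); have := ler_norm (Re (z n - l)).
rewrite !CE; lra.
Qed.

Lemma clim_ge0 z : ubounded z -> U [set n | 0 <= z n] -> 0 <= clim z.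
Proof.
move=> hz h; apply/ge0C; split.
  by apply: clim_Re_ge => //; apply: filterS h => n /= /ge0C[].
move: (climP hz); move: (clim z) => l hl.
apply/eqP; rewrite -normr_eq0 eq_le normr_ge0 andbT; apply: ler_small0 => e e0.
have [n [/= /ge0C[_ h1] h2]] := filter_ex (filterI h (hl e e0)).
have := Im_le_normc (z n - l); rewrite !CE h1 add0r normrN; lra.
Qed.

(** A Cauchy sequence converges to its limit along the ultrafilter, since every
tail contains indices at which the sequence is close to that limit. *)
Lemma C_complete z :
  (forall e : R, 0 < e -> exists N, forall m n, (N <= m)%N -> (N <= n)%N ->
     normc (z m - z n) <= e) ->
  exists l, forall e, 0 < e -> exists N, forall n, (N <= n)%N -> normc (z n - l) <= e.
Proof.
move=> h; have zb : ubounded z.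
  have [N hN] := h 1 ltr01; exists (1 + normc (z N)).
  apply: (@free_ultra_tail _ N) => n Nn /=.
  by rewrite -[z n](subrK (z N)); apply: le_trans (normcD _ _) _; rewrite lerD2r hN.
exists (clim z) => e e0; have e2 : 0 < e / 2 by rewrite divr_gt0.
have [N hN] := h _ e2; exists N => n Nn.
have k : U [set n | (N <= n)%N] by apply: (@free_ultra_tail _ N).
have [m [/= h1 h2]] := filter_ex (filterI k (climP zb e2)).
rewrite -(subrKA (z m)); apply: le_trans (normcD _ _) _.
by rewrite [e]splitr lerD ?hN.
Qed.

End GeneralizedLimit.

Section Hilbert.
Variable R : realType.
Local Notation C := R[i].

Lemma hdotP (H : hilbert R) : hform (hdot H).
Proof.
split=> [a x y z|x y|x]; first exact: linearPl.
  by rewrite (hermC (hdot H)) expr0 mul1r.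
by have [->|x0] := eqVneq x 0; rewrite ?linear0r // ltW// neq0_dnorm_gt0.
Qed.

Definition hn (H : hilbert R) (x : H) : R := sn (hdot H) x.

Section One.
Variable H : hilbert R.
Implicit Types x y : H.
Let hs := hdotP H.

Lemma hn_eq0 x : hn x = 0 -> x = 0.
Proof.
move=> h; apply/eqP; apply/negPn/negP => x0.
have := neq0_dnorm_gt0 (s := hdot H) x x0.
by rewrite (hf_diag hs) -/(hn x) h expr0n ltxx.
Qed.

Lemma hnormE x : hnorm x = (hn x)%:C.
Proof.
rewrite /hnorm /dot_norm (hf_diag hs) rmorphXn /=.
by rewrite sqrCK// ler0c sn_ge0.
Qed.

Lemma hdot_inj x y : (forall z, hdot H x z = hdot H y z) -> x = y.
Proof.
move=> h; apply/eqP; rewrite -subr_eq0; apply/eqP; apply: hn_eq0.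
by rewrite /hn /sn (hfB hs) h subrr sqrtr0.
Qed.

Lemma hcompleteR (x : nat -> H) :
  (forall e : R, 0 < e -> exists N, forall m n, (N <= m)%N -> (N <= n)%N ->
     hn (x m - x n) <= e) ->
  exists l, forall e, 0 < e -> exists N, forall n, (N <= n)%N -> hn (x n - l) <= e.
Proof.
move=> h; have [|l hl] := @hcomplete _ H x.
  move=> e /[dup] /ltW/ge0C[e0 ei]; rewrite ltcE /= => /andP[_ e1].
  have /h[N hN] : 0 < Re e / 2 by rewrite divr_gt0.
  exists N => m n Nm Nn; rewrite -/(hnorm _) hnormE.
  rewrite ltcE /= ei eqxx /=; have := hN m n Nm Nn; lra.
exists l => e e0; have [|N hN] := hl e%:C; first by rewrite ltcR.
exists N => n /hN; rewrite -/(hnorm _) hnormE ltcR; exact: ltW.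
Qed.

Definition bnd (f : H -> H) (M : R) := 0 <= M /\ forall x, hn (f x) <= M * hn x.

Lemma opnorm_leE f c : opnorm_le f c <-> exists2 M, c = M%:C & bnd f M.
Proof.
split=> [[/ge0C[c0 ci] h]|[M -> [M0 h]]].
  have ec : c = (Re c)%:C by exact: eqCri.
  by exists (Re c) => //; split=> // x; have := h x; rewrite !hnormE ec -rmorphM lecR.
by split=> [|x]; rewrite ?hnormE -?rmorphM ?lecR.
Qed.

Lemma opnorm_leR f M : opnorm_le f M%:C <-> bnd f M.
Proof.
rewrite opnorm_leE; split=> [[N [->]]|] //; by exists M.
Qed.

Lemma bounded_opE f : bounded_op f <-> linear f /\ exists M, bnd f M.
Proof.
split=> -[lf [M hM]]; split=> //.
  by move/opnorm_leE: hM => [N _ h]; exists N.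
by exists M%:C; apply/opnorm_leR.
Qed.
End One.
End Hilbert.

(** * Completion of a semi-inner product space *)

Section Completion.
Variable R : realType.
Local Notation C := R[i].

Lemma ge0C_approx (l : C) :
  (forall e : R, 0 < e -> exists2 a : R, 0 <= a & normc (l - a%:C) <= e) -> 0 <= l.
Proof.
move=> h; apply/ge0C; split.
  rewrite -oppr_le0; apply: ler_small0 => e /h[a a0 ha].
  have := Re_le_normc (l - a%:C); have := ler_norm (- Re (l - a%:C)).
  rewrite normrN !CE /=; lra.
apply/eqP; rewrite -normr_eq0 eq_le normr_ge0 andbT; apply: ler_small0 => e /h[a a0 ha].
by have := Im_le_normc (l - a%:C); rewrite !CE /= oppr0 addr0; lra.
Qed.

Lemma approx_eq (z w : C) (c : R) :
  (forall e : R, 0 < e -> normc (z - w) <= c * e) -> z = w.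
Proof.
move=> h; apply/eqP; rewrite -subr_eq0; apply/eqP; apply: eq0_normc; apply/eqP.
by rewrite eq_le normc_ge0 andbT; apply: (@ler_small _ _ c).
Qed.

Record prehilbert := PreHilbert {
  pv :> lmodType C;
  ps : pv -> pv -> C;
  psP : hform ps }.

Section Fix.
Variable P : prehilbert.
Local Notation s := (@ps P).
Local Notation pn := (sn s).
Let hs := @psP P.
Implicit Types (v w : P) (f g : P -> C).

(** A functional [f] on [P] stands for the vector that represents it; [approx f
v d] says that this vector is within distance [d] of [v]. *)
Definition approx f v (d : R) := forall w, normc (f w - s v w) <= d * pn w.

Definition approximable : set (P -> C) := fun f => forall e : R, 0 < e -> exists v, approx f v e.

Lemma approxP a f g v w d e : approx f v d -> approx g w e ->
  approx (a *: f + g) (a *: v + w) (normc a * d + e).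
Proof.
move=> h k x; rewrite (hfP hs).
have -> : (a *: f + g) x - (a * s v x + s w x) = a * (f x - s v x) + (g x - s w x).
  by rewrite mulrBr opprD addrACA.
apply: le_trans (normcD _ _) _; rewrite normcM mulrDl -mulrA.
by apply: lerD => //; rewrite ler_wpM2l ?normc_ge0.
Qed.

Lemma min_le_l (a b : R) : Order.min a b <= a. Proof. by rewrite ge_min lexx. Qed.
Lemma min_le_r (a b : R) : Order.min a b <= b. Proof. by rewrite ge_min lexx orbT. Qed.

Lemma approx0 : approx 0 0 0.
Proof. by move=> w; rewrite (hf0 hs) subrr normc0 mul0r. Qed.

Lemma approxW f v d e : d <= e -> approx f v d -> approx f v e.
Proof. by move=> de h w; apply: le_trans (h w) _; rewrite ler_wpM2r ?sn_ge0. Qed.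

Definition approximable_pred : {pred P -> C} := mem approximable.

Lemma approximable_submod : GRing.submod_closed approximable_pred.
Proof.
split=> [|a f g]; rewrite !in_setE.
  by move=> e e0; exists 0; apply: approxW approx0; apply: ltW.
move=> hf hg e e0.
have a1 : 0 < 2 * (normc a + 1) by have := normc_ge0 a; lra.
have [v hv] := hf (e / (2 * (normc a + 1))) (divr_gt0 e0 a1).
have [w hw] := hg (e / 2) (divr_gt0 e0 (ltr0Sn _ _)).
exists (a *: v + w); apply: approxW (approxP a hv hw).
have -> : normc a * (e / (2 * (normc a + 1))) = normc a / (normc a + 1) * (e / 2).
  by field; rewrite gt_eqF// ltr_wpDl ?normc_ge0.
rewrite [leRHS]splitr lerD2r ler_piMl//; first by rewrite divr_ge0// ltW.
by rewrite ler_pdivrMr ?mul1r ?lerDl// ltr_wpDl ?normc_ge0.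
Qed.
HB.instance Definition _ :=
  GRing.isSubmodClosed.Build C (P -> C) approximable_pred approximable_submod.
End Fix.

(** A vector of the completion is encoded as the functional [w |-> <f, w>] on
[P]. Vectors of length 0 give the zero functional, so no quotient is taken. *)
Record completion (P : prehilbert) := Completion_ {
  cval :> P -> C;
  cvalP : cval \in @approximable_pred P }.
HB.instance Definition _ P := [isSub for @cval P].
HB.instance Definition _ P := [Choice of completion P by <:].
HB.instance Definition _ P := [SubChoice_isSubLmodule of completion P by <:].

Section Theory.
Variable P : prehilbert.
Local Notation s := (@ps P).
Local Notation pn := (sn s).
Let hs := @psP P.
Implicit Types (v w : P) (f g h : completion P).

Lemma cvalE f : approximable f.
Proof. by have := cvalP f; rewrite in_setE. Qed.

Definition cmk (f : P -> C) (hf : approximable f) : completion P :=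
  @Completion_ P f (mem_set hf).

Lemma completion_eq f g : (forall w, f w = g w) -> f = g.
Proof. by move=> h; apply: val_inj; apply/funext. Qed.

Lemma pn_le v c : 0 <= c -> (forall w, normc (s v w) <= c * pn w) -> pn v <= c.
Proof.
move=> c0 /(_ v); rewrite (hf_diag hs) normc_real ger0_norm ?sqr_ge0//.
have := sn_ge0 s v; rewrite le_eqVlt => /orP[/eqP <-//|v0].
by rewrite expr2 ler_pM2r.
Qed.

Lemma approx_dist f v w d e : 0 <= d -> 0 <= e ->
  approx f v d -> approx f w e -> pn (v - w) <= d + e.
Proof.
move=> d0 e0 hv hw; apply: pn_le => [|x]; first exact: addr_ge0.
rewrite (hfB hs); have -> : s v x - s w x = (f x - s w x) - (f x - s v x) by ring.
by apply: le_trans (normcB _ _) _; have := hv x; have := hw x; rewrite mulrDl; lra.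
Qed.

Lemma approx_bound f v d w : approx f v d -> normc (f w) <= (pn v + d) * pn w.
Proof.
move=> h; rewrite -[f w](subrK (s v w)); apply: le_trans (normcD _ _) _.
by have := h w; have := hf_CS hs v w; rewrite mulrDl; lra.
Qed.

Lemma cval_bound f : exists2 K, 0 < K & forall w, normc (f w) <= K * pn w.
Proof.
have [v hv] := cvalE f ltr01; exists (pn v + 1).
  by rewrite ltr_wpDl// sn_ge0.
by move=> w; apply: approx_bound hv.
Qed.

Lemma cvalB f v w : f (v - w) = f v - f w.
Proof.
apply: (@approx_eq _ _ (pn (v - w) + pn v + pn w)) => e /(cvalE f)[x hx].
have -> : f (v - w) - (f v - f w) =
  (f (v - w) - s x (v - w)) - (f v - s x v) + (f w - s x w).
  by rewrite (hfBr hs); ring.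
apply: le_trans (normcD _ _) _.
have := normcB (f (v - w) - s x (v - w)) (f v - s x v).
by have := hx (v - w); have := hx v; have := hx w; rewrite !mulrDl ![_ * e]mulrC; lra.
Qed.

(** The inner product of [f] and [g] is determined by continuity from [<f, v> =
f v] for [v] in [P]. *)
Definition is_cdot f g (l : C) := forall e : R, 0 < e -> exists2 d, 0 < d &
  forall v, approx g v d -> normc (f v - l) <= e.

(** The values of [f] at approximants of [g] form a Cauchy sequence because [f]
is bounded. *)
Lemma cdot_ex f g : exists l, is_cdot f g l.
Proof.
have [v hv] : {v : nat -> P & forall n, approx g (v n) n.+1%:R^-1}.
  have hv n : exists v, approx g v n.+1%:R^-1 by apply/cvalE/invn_gt0.
  by exists (fun n => sval (cid (hv n))) => n; case: cid.
have [K K0 hK] := cval_bound f.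
have dist e w n : 0 <= e -> approx g w e ->
    normc (f w - f (v n)) <= K * (e + n.+1%:R^-1).
  move=> e0 hw; rewrite -cvalB; apply: le_trans (hK _) _.
  by rewrite ler_pM2l// (approx_dist e0 _ hw (hv n))// ltW// invn_gt0.
have [|l hl] := @C_complete R (fun n => f (v n)).
  move=> e e0; have K2 : 0 < 2 * K by rewrite mulr_gt0.
  have [N hN] := ex_invn (divr_gt0 e0 K2); exists N => m n Nm Nn.
  apply: le_trans (dist _ _ n (ltW (invn_gt0 _ m)) (hv m)) _.
  apply: le_trans (_ : K * (e / (2 * K) + e / (2 * K)) <= e).
    by rewrite ler_pM2l// lerD// hN.
  by rewrite le_eqVlt; apply/orP; left; apply/eqP; field; rewrite gt_eqF.
exists l => e e0; have K3 : 0 < 3 * K by rewrite mulr_gt0.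
have d0 : 0 < e / (3 * K) by rewrite divr_gt0.
exists (e / (3 * K)) => // w hw.
have [N hN] := ex_invn d0; have [M hM] := hl (e / 3) (divr_gt0 e0 (ltr0Sn _ _)).
have := hN _ (leq_maxl N M); have := hM _ (leq_maxr N M).
have := dist _ _ (maxn N M) (ltW d0) hw; set n := maxn N M; set d := n.+1%:R^-1.
move=> h1 h2 h3; rewrite -(subrKA (f (v n))).
apply: le_trans (normcD _ _) _.
have : K * (e / (3 * K) + d) <= K * (e / (3 * K) + e / (3 * K)).
  by rewrite ler_pM2l// lerD2l.
have -> : K * (e / (3 * K) + e / (3 * K)) = 2 * (e / 3) by field; rewrite gt_eqF.
by lra.
Qed.

Lemma is_cdot_unique f g l m : is_cdot f g l -> is_cdot f g m -> l = m.
Proof.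
move=> hl hm; apply: (@approx_eq _ _ 2) => e e0.
have [d d0 hd] := hl e e0; have [d' d0' hd'] := hm e e0.
have dd : 0 < Order.min d d' by rewrite lt_min d0.
have [v hv] := cvalE g dd.
have := hd v (approxW (min_le_l _ _) hv); have := hd' v (approxW (min_le_r _ _) hv).
have -> : l - m = (f v - m) - (f v - l) by ring.
by have := normcB (f v - m) (f v - l); lra.
Qed.

Definition cdot f g : C := sval (cid (cdot_ex f g)).

Lemma cdotP f g : is_cdot f g (cdot f g).
Proof. by rewrite /cdot; case: cid. Qed.

Lemma cdot_approx f g e : 0 < e -> exists d0, 0 < d0 /\
  forall d, 0 < d -> d <= d0 -> exists2 v, approx g v d & normc (f v - cdot f g) <= e.
Proof.
move=> e0; have [d0 d00 h] := cdotP f g e0; exists d0; split=> // d dp dd.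
have [v hv] := cvalE g dp; exists v => //; apply: h; exact: approxW hv.
Qed.

Lemma cdot_lin a f g h : cdot (a *: f + g) h = a * cdot f h + cdot g h.
Proof.
apply: is_cdot_unique (cdotP _ _) _ => e e0.
have a1 : 0 < 2 * (normc a + 1) by have := normc_ge0 a; lra.
have [d d0 hd] := cdotP f h (divr_gt0 e0 a1).
have [d' d0' hd'] := cdotP g h (divr_gt0 e0 (ltr0Sn R 1)).
exists (Order.min d d'); first by rewrite lt_min d0.
move=> v hv.
have h1 := hd v (approxW (min_le_l _ _) hv).
have h2 := hd' v (approxW (min_le_r _ _) hv).
have -> : (a *: f + g) v - (a * cdot f h + cdot g h) =
   a * (f v - cdot f h) + (g v - cdot g h).
  by rewrite mulrBr opprD addrACA.
apply: le_trans (normcD _ _) _; rewrite normcM.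
have : normc a * normc (f v - cdot f h) <= (normc a + 1) * (e / (2 * (normc a + 1))).
  by apply: ler_pM; rewrite ?normc_ge0 ?lerDl.
have -> : (normc a + 1) * (e / (2 * (normc a + 1))) = e / 2.
  by field; rewrite gt_eqF// ltr_wpDl ?normc_ge0.
lra.
Qed.

(** Both sides are close to [s w v] for approximants [v] of [f] and [w] of [g],
whose lengths stay bounded. *)
Lemma cdot_sym f g : cdot g f = (cdot f g)^*.
Proof.
have [v0 hv0] := cvalE f ltr01; have [w0 hw0] := cvalE g ltr01.
have bd h x0 x d : approx h x0 1 -> 0 < d -> d <= 1 -> approx h x d -> pn x <= pn x0 + 2.
  move=> h0 d0 d1 hx; rewrite -[x](subrK x0); apply: le_trans (snD hs _ _) _.
  have := approx_dist (ltW d0) ler01 hx h0; lra.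
apply: (@approx_eq _ _ (2 + (pn v0 + pn w0 + 4))) => e e0.
have [d [d0 hd]] := cdot_approx f g e0; have [d' [d0' hd']] := cdot_approx g f e0.
pose m := Order.min (Order.min d d') (Order.min e 1).
have m0 : 0 < m by rewrite !lt_min d0 d0' e0 ltr01.
have md : m <= d by rewrite /m !ge_min lexx.
have md' : m <= d' by rewrite /m !ge_min lexx orbT.
have me : m <= e by rewrite /m !ge_min lexx !orbT.
have m1 : m <= 1 by rewrite /m !ge_min lexx !orbT.
have [w hw1 hw2] := hd m m0 md; have [v hv1 hv2] := hd' m m0 md'.
have bv := bd _ _ _ _ hv0 m0 m1 hv1; have bw := bd _ _ _ _ hw0 m0 m1 hw1.
have h1 := hv1 w; have h2 := hw1 v.
rewrite -normc_conj rmorphB /= in hw2; rewrite -normc_conj rmorphB /= in h1.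
have e1 : cdot g f - (cdot f g)^* =
  - (g v - cdot g f) + (g v - s w v) - ((f w)^* - (s v w)^*) + ((f w)^* - (cdot f g)^*).
  by rewrite (hfC hs v w); ring.
rewrite e1; apply: le_trans (normcD _ _) _.
have := normcB (- (g v - cdot g f) + (g v - s w v)) ((f w)^* - (s v w)^*).
have := normcD (- (g v - cdot g f)) (g v - s w v); rewrite normcN.
have : m * pn w <= e * (pn w0 + 2) by rewrite ler_pM ?sn_ge0// ltW.
have : m * pn v <= e * (pn v0 + 2) by rewrite ler_pM ?sn_ge0// ltW.
nra.
Qed.
End Theory.
End Completion.

Section MkDot.
Variable R : realType.
Local Notation C := R[i].
Variables (V : lmodType C) (s : V -> V -> C) (hs : hform s).
Hypothesis hdef : forall x, s x x = 0 -> x = 0.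

Let bil : bilinear_for (GRing.mul : C -> C -> C) (Num.conj \; *%R : C -> C -> C) s.
Proof.
split=> [z a x y|z a x y] /=; first exact: hfP.
by rewrite (hfDr hs) (hfZr hs).
Qed.

Let herm : forall x y, s x y = (-1) ^+ false * Num.conj (s y x).
Proof. by move=> x y; rewrite expr0 mul1r (hfC hs). Qed.

Let pos : forall x, x != 0 -> 0 < s x x.
Proof.
move=> x x0; rewrite lt_neqAle hf_ge0// andbT eq_sym.
by apply: contra x0 => /eqP/hdef->.
Qed.
Definition dot_of_hform : {dot V for Num.conj} :=
  HB.pack s (@bilinear_isBilinear.Build _ _ _ _ _ _ s bil)
    (@isHermitianSesquilinear.Build _ _ _ _ s herm) (@isDotProduct.Build _ _ s pos).
Lemma dot_of_hformE x y : dot_of_hform x y = s x y.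
Proof. by []. Qed.
End MkDot.

Section CompletionHilbert.
Variable R : realType.
Local Notation C := R[i].
Variable P : prehilbert R.
Local Notation s := (@ps R P).
Local Notation pn := (sn s).
Let hs := @psP R P.
Implicit Types (v w : P) (f g h : completion P).

(** [cdot f f] is a limit of squared lengths of approximants. *)
Lemma cdot_ge0 f : 0 <= cdot f f.
Proof.
have [v0 hv0] := cvalE f ltr01.
have c0 : 0 < pn v0 + 3 by have := sn_ge0 s v0; lra.
apply: ge0C_approx => e e0; have e2 : 0 < e / 2 by rewrite divr_gt0.
have [d [d0 hd]] := cdot_approx f f e2.
pose m := Order.min d (Order.min 1 (e / 2 / (pn v0 + 3))).
have m0 : 0 < m by rewrite !lt_min d0 ltr01 divr_gt0.
have md : m <= d by rewrite /m ge_min lexx.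
have me : m <= e / 2 / (pn v0 + 3) by rewrite /m !ge_min lexx !orbT.
have m1 : m <= 1 by rewrite /m !ge_min lexx !orbT.
have [v hv1 hv2] := hd m m0 md; exists (pn v ^+ 2); first by rewrite sqr_ge0.
have bv : pn v <= pn v0 + 3.
  rewrite -[v](subrK v0); apply: le_trans (snD hs _ _) _.
  have := approx_dist (ltW m0) ler01 hv1 hv0; lra.
have h1 := hv1 v; rewrite (hf_diag hs) in h1.
have -> : cdot f f - (pn v ^+ 2)%:C = (f v - (pn v ^+ 2)%:C) - (f v - cdot f f) by ring.
apply: le_trans (normcB _ _) _.
have : m * pn v <= e / 2.
  apply: le_trans (_ : e / 2 / (pn v0 + 3) * (pn v0 + 3) <= _).
    by rewrite ler_pM ?sn_ge0// ltW.
  by rewrite divfK// gt_eqF.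
lra.
Qed.

Lemma cdotH : hform (@cdot R P).
Proof. by split; [apply: cdot_lin | apply: cdot_sym | apply: cdot_ge0]. Qed.

Lemma iota_subproof v : approximable (s v).
Proof.
move=> e e0; exists v => w; rewrite subrr normc0 mulr_ge0 ?sn_ge0//; exact: ltW.
Qed.
Definition emb v : completion P := cmk (iota_subproof v).

Lemma embE v w : emb v w = s v w. Proof. by []. Qed.

Lemma emb_lin : linear emb.
Proof. by move=> a x y; apply: completion_eq => w; exact: (hfP hs). Qed.

Lemma cdot_emb f w : cdot f (emb w) = f w.
Proof.
apply: is_cdot_unique (cdotP _ _) _ => e e0; have [K K0 hK] := cval_bound f.
exists (e / K); first by rewrite divr_gt0.
move=> v hv; rewrite -cvalB; apply: le_trans (hK _) _.
rewrite mulrC -ler_pdivlMr// sn_dist//; apply: pn_le => [|x].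
  by rewrite divr_ge0// ltW.
by have := hv x; rewrite embE (hfB hs).
Qed.

Local Notation cn := (sn (@cdot R P)).

Lemma cn_emb v : cn (emb v) = pn v.
Proof. by rewrite /sn cdot_emb. Qed.

Lemma cval_le f w : normc (f w) <= cn f * pn w.
Proof. by rewrite -cdot_emb -cn_emb; apply: hf_CS cdotH _ _. Qed.

(** The length of [f] is the norm of [f] as a functional: test it on
approximants of [f] itself. *)
Lemma cn_le f c : 0 <= c -> (forall w, normc (f w) <= c * pn w) -> cn f <= c.
Proof.
move=> c0 h; rewrite (sn_le cdotH)//.
rewrite -subr_le0; apply: (@ler_small _ _ (1 + c)) => e e0.
have [d [d0 hd]] := cdot_approx f f e0.
pose m := Order.min d e.
have m0 : 0 < m by rewrite !lt_min d0.
have [v hv1 hv2] := hd m m0 (min_le_l _ _).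
have me : m <= e by apply: min_le_r.
have bv : pn v <= c + m.
  apply: pn_le => [|w]; first by rewrite addr_ge0// ltW.
  have -> : s v w = f w - (f w - s v w) by ring.
  by apply: le_trans (normcB _ _) _; rewrite mulrDl lerD.
have h1 := h v; have h2 := Re_le_normc (f v - cdot f f); have h3 := Re_le_normc (f v).
have h4 := ler_norm (Re (f v)); have h5 := ler_norm (- Re (f v - cdot f f)).
rewrite normrN !CE in h5; rewrite !CE in h2.
have : c * pn v <= c * (c + e) by rewrite ler_wpM2l//; lra.
nra.
Qed.

Lemma cdot_def f : cdot f f = 0 -> f = 0.
Proof.
move=> h; apply: completion_eq => w; apply: eq0_normc; apply/eqP.
rewrite eq_le normc_ge0 andbT; apply: le_trans (cval_le _ _) _.
by rewrite /sn h sqrtr0 mul0r.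
Qed.

Definition cdotF : {dot completion P for Num.conj} := dot_of_hform cdotH cdot_def.

Lemma emb_dense f e : 0 < e -> exists v, cn (f - emb v) <= e.
Proof.
move=> e0; have [v hv] := cvalE f e0; exists v.
by apply: cn_le (ltW e0) _ => w; exact: hv.
Qed.

(** A Cauchy sequence of functionals converges pointwise, and uniformly on the
unit ball by [cval_le]; so the limit is again approximable. *)
Lemma completion_complete (x : nat -> completion P) :
    (forall e : C, 0 < e -> exists N, forall m n,
       (N <= m)%N -> (N <= n)%N -> dot_norm cdotF (x m - x n) < e) ->
    exists l, forall e : C, 0 < e -> exists N, forall n,
       (N <= n)%N -> dot_norm cdotF (x n - l) < e.
Proof.
have cnE f : dot_norm cdotF f = (cn f)%:C.
  rewrite /dot_norm dot_of_hformE (hf_diag cdotH) rmorphXn /=.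
  by rewrite sqrCK// ler0c sn_ge0.
move=> hx; have {}hx (e : R) : 0 < e -> exists N, forall m n,
    (N <= m)%N -> (N <= n)%N -> cn (x m - x n) <= e.
  move=> e0; have [|N hN] := hx e%:C; first by rewrite ltcR.
  by exists N => m n /hN/[apply]; rewrite cnE ltcR => /ltW.
have hl w : exists l, forall e : R, 0 < e ->
    exists N, forall n, (N <= n)%N -> normc (x n w - l) <= e.
  apply: C_complete => e e0.
  have w1 : 0 < pn w + 1 by have := sn_ge0 s w; lra.
  have [N hN] := hx _ (divr_gt0 e0 w1); exists N => m n Nm Nn.
  apply: le_trans (cval_le (x m - x n) w) _.
  apply: le_trans (_ : e / (pn w + 1) * (pn w + 1) <= _).
    by rewrite ler_pM ?sn_ge0 ?hN ?lerDl.
  by rewrite divfK// gt_eqF.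
pose l w := sval (cid (hl w)).
have lP w (e : R) : 0 < e -> exists N, forall n, (N <= n)%N -> normc (x n w - l w) <= e.
  by move: e; rewrite /l; case: cid.
have unif e : 0 < e -> exists N, forall n, (N <= n)%N ->
    forall w, normc (x n w - l w) <= e * pn w.
  move=> e0; have [N hN] := hx e e0; exists N => n Nn w.
  rewrite -subr_le0; apply: ler_small0 => d d0.
  have [M hM] := lP w d d0; set m := maxn N M.
  have h1 := hN n m Nn (leq_maxl _ _); have h2 := hM m (leq_maxr _ _).
  have := cval_le (x n - x m) w; have := ler_wpM2r (sn_ge0 s w) h1.
  rewrite -(subrKA (x m w) (x n w)); have := normcD (x n w - x m w) (x m w - l w).
  rewrite -[(x n - x m) w]/(x n w - x m w); lra.
have la : approximable l.
  move=> e e0; have e2 : 0 < e / 2 by rewrite divr_gt0.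
  have [N hN] := unif _ e2; have [v hv] := cvalE (x N) e2.
  exists v => w; have -> : l w - s v w = (x N w - s v w) - (x N w - l w) by ring.
  apply: le_trans (normcB _ _) _; have := hN _ (leqnn _) w; have := hv w.
  by rewrite (_ : e * pn w = e / 2 * pn w + e / 2 * pn w); [lra | rewrite -mulrDl -splitr].
exists (cmk la) => e /[dup] /ltW/ge0C[e0 ei]; rewrite ltcE /= => /andP[_ e1].
have [|N hN] := unif (Re e / 2); first by rewrite divr_gt0.
exists N => n Nn; rewrite cnE ltcE /= ei eqxx /=.
apply: le_lt_trans (_ : Re e / 2 < Re e); last by lra.
by apply: cn_le => [|w]; [lra | exact: hN].
Qed.

Definition completion_hilbert : hilbert R := Hilbert completion_complete.

Lemma hdot_completion (f g : completion_hilbert) :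
  hdot completion_hilbert f g = cdot f g.
Proof. by []. Qed.

Lemma hdot_emb v w : hdot completion_hilbert (emb v) (emb w) = s v w.
Proof. by rewrite hdot_completion cdot_emb. Qed.

Lemma hn_emb_dense (f : completion_hilbert) e : 0 < e -> exists v, hn (f - emb v : completion_hilbert) <= e.
Proof. exact: emb_dense. Qed.

(** The continuous extension of an operator on [P] whose adjoint is [b]: on
functionals it is the precomposition with [b]. *)
Definition ext (b : P -> P) (f : completion_hilbert) : completion_hilbert :=
  insubd (0 : completion P) ((f : completion P) \o b).

Definition pbnd (b : P -> P) (M : R) := 0 <= M /\ forall v, pn (b v) <= M * pn v.

Section Ext.
Variables (a b : P -> P) (M : R).
Hypothesis ab : forall v w, s (a v) w = s v (b w).
Hypothesis bM : pbnd b M.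

(** If [v] approximates [f] then [a v] approximates [f \o b], which is therefore
in the completion. *)
Lemma extE f w : ext b f w = f (b w).
Proof.
rewrite /ext insubdK// in_setE => e e0; have [M0 hM] := bM.
have M1 : 0 < M + 1 by lra.
have [v hv] := cvalE f (divr_gt0 e0 M1); exists (a v) => x /=.
rewrite ab; apply: le_trans (hv _) _.
apply: le_trans (_ : e / (M + 1) * (M * pn x) <= _).
  by rewrite ler_wpM2l// ltW// divr_gt0.
rewrite mulrA ler_wpM2r ?sn_ge0// mulrAC -mulrA ler_piMr ?(ltW e0)//.
by rewrite ler_pdivrMr// mul1r lerDl.
Qed.

Lemma ext_emb v : ext b (emb v) = emb (a v).
Proof. by apply: completion_eq => w; rewrite extE !embE ab. Qed.

Lemma ext_lin : linear (ext b).
Proof.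
move=> c f g; apply: completion_eq => w.
by rewrite extE -[RHS]/(c * ext b f w + ext b g w) !extE.
Qed.

Lemma ext_bnd : bnd (ext b) M.
Proof.
have [M0 hM] := bM; split=> // f; apply: cn_le => [|w].
  by rewrite mulr_ge0// sn_ge0.
rewrite extE; apply: le_trans (cval_le _ _) _.
by rewrite -mulrA mulrCA ler_wpM2l ?sn_ge0.
Qed.
End Ext.

Lemma ext_adj (a b : P -> P) M N :
  (forall v w, s (a v) w = s v (b w)) -> pbnd a M -> pbnd b N ->
  adjoint (ext b) (ext a).
Proof.
move=> ab aM bN f g; rewrite !hdot_completion.
have ba v w : s (b v) w = s v (a w) by rewrite (hfC hs) -ab -(hfC hs).
have [N0 hN] := bN; have [M0 hM] := aM; have M1 : 0 < M + 1 by lra.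
apply: is_cdot_unique (cdotP _ _) _ => e e0.
have [d d0 hd] := cdotP f (ext a g) e0.
exists (d / (M + 1)) => [|v hv]; first by rewrite divr_gt0.
rewrite (extE ab bN); apply: hd => w.
rewrite (extE ba aM) ba; apply: le_trans (hv _) _.
apply: le_trans (_ : d / (M + 1) * (M * pn w) <= _).
  by rewrite ler_wpM2l// ltW// divr_gt0.
rewrite mulrA ler_wpM2r ?sn_ge0// mulrAC -mulrA ler_piMr ?(ltW d0)//.
by rewrite ler_pdivrMr// mul1r lerDl.
Qed.

End CompletionHilbert.

(** * Algebraic tensor products *)

Section Tensor.
Variable K : comNzRingType.
Implicit Types V W X : lmodType K.

(** Maps between operator systems are linear by a hypothesis and not by a
bundled structure; these are the usual identities in that setting. *)
Lemma lin_sum V X (f : V -> X) (lf : linear f) (I : Type) (r : seq I) (P : pred I) F :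
  f (\sum_(i <- r | P i) F i) = \sum_(i <- r | P i) f (F i).
Proof.
pose L := GRing.isLinear.Build K V X *:%R f lf.
exact: (@linear_sum K V X *:%R (HB.pack f L : {linear V -> X})).
Qed.

Lemma linD V X (f : V -> X) (lf : linear f) x y : f (x + y) = f x + f y.
Proof. by have := lf 1 x y; rewrite !scale1r. Qed.
Lemma lin0 V X (f : V -> X) (lf : linear f) : f 0 = 0.
Proof. by have := linD lf 0 0; rewrite addr0 -{1}[f 0]addr0 => /addrI. Qed.
Lemma linZ V X (f : V -> X) (lf : linear f) a x : f (a *: x) = a *: f x.
Proof. by have := lf a x 0; rewrite !addr0 lin0 ?addr0. Qed.
Lemma linN V X (f : V -> X) (lf : linear f) x : f (- x) = - f x.
Proof. by rewrite -scaleN1r (linZ lf) scaleN1r. Qed.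
Lemma linB V X (f : V -> X) (lf : linear f) x y : f (x - y) = f x - f y.
Proof. by rewrite (linD lf) (linN lf). Qed.
Lemma lin_comp V W X (f : V -> W) (g : W -> X) : linear f -> linear g -> linear (g \o f).
Proof. by move=> lf lg a x y /=; rewrite lf lg. Qed.

Lemma linear_fct_lin V X a (f g : V -> X) : linear f -> linear g -> linear (a *: f + g).
Proof.
move=> lf lg b x y; rewrite -[LHS]/(a *: f _ + g _) lf lg.
rewrite -[RHS]/(b *: (a *: f x + g x) + (a *: f y + g y)).
by rewrite !scalerDr !scalerA [b * a]mulrC addrACA.
Qed.

Variables V W : lmodType K.
Local Notation T := (tens V W).

Lemma tens_lift_pure X (b : V -> W -> X) v w : is_bilinear b ->
  tens_lift b (tens_pure v w) = b v w.
Proof. by move=> hb; rewrite tens_lift_pi // /tens_eval big_seq1. Qed.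

Lemma tens_lift_linear X (b : V -> W -> X) : is_bilinear b -> linear (tens_lift b).
Proof.
move=> hb a u v; rewrite -[_ + _]/(tens_add _ _) -[a *: u]/(tens_scale _ _).
rewrite tens_lift_pi// /tens_eval big_cat /=; congr (_ + _).
rewrite -/(tens_eval b _) -/(tens_lift b _) tens_lift_pi// /tens_eval big_map scaler_sumr.
by apply: eq_bigr => p _ /=; rewrite (linZ (hb.1 p.2)).
Qed.

Lemma tens_pure_bilinear : is_bilinear (@tens_pure K V W).
Proof.
have eqt (u v : T) : (forall X (b : V -> W -> X), is_bilinear b ->
     tens_lift b u = tens_lift b v) -> u = v by apply: tens_eqP.
split=> [w a x y|v a x y]; apply: eqt => X b hb.
  by rewrite (tens_lift_linear hb) !tens_lift_pure// hb.1.
by rewrite (tens_lift_linear hb) !tens_lift_pure// hb.2.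
Qed.

Lemma pi_tens_sum (l : seq (V * W)) :
  (\pi_T l)%qT = \sum_(p <- l) tens_pure p.1 p.2.
Proof.
apply: tens_eqP => X b hb; rewrite tens_lift_pi// (lin_sum (tens_lift_linear hb)).
by apply: eq_bigr => p _; rewrite tens_lift_pure.
Qed.

Lemma tens_sumE (u : T) : u = \sum_(p <- repr u) tens_pure p.1 p.2.
Proof. by rewrite -pi_tens_sum reprK. Qed.

Lemma tens_ind (Q : T -> Prop) : Q 0 -> (forall u v, Q u -> Q v -> Q (u + v)) ->
  (forall v w, Q (tens_pure v w)) -> forall u, Q u.
Proof.
move=> h0 hD hp u; rewrite [u]tens_sumE.
by apply: (big_ind Q).
Qed.

Lemma tens_lin_ext X (f g : T -> X) : linear f -> linear g ->
  (forall v w, f (tens_pure v w) = g (tens_pure v w)) -> forall u, f u = g u.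
Proof.
move=> lf lg h; apply: tens_ind => [|u v hu hv|//]; first by rewrite (lin0 lf) (lin0 lg).
by rewrite (linD lf) (linD lg) hu hv.
Qed.

Lemma tens_lift_sum X (b : V -> W -> X) u :
  tens_lift b u = \sum_(p <- repr u) b p.1 p.2.
Proof. by []. Qed.
End Tensor.

Section TensorMap.
Variable K : comNzRingType.
Variables V W V' W' : lmodType K.
Variables (f : V -> V') (g : W -> W').
Hypotheses (lf : linear f) (lg : linear g).

Lemma tens_map_bilinear : is_bilinear (fun v w => tens_pure (f v) (g w)).
Proof.
have [h1 h2] := tens_pure_bilinear V' W'.
by split=> [w a x y|v a x y]; rewrite ?lf ?lg ?h1 ?h2.
Qed.

Lemma tens_map_linear : linear (tens_map f g).
Proof. exact: tens_lift_linear tens_map_bilinear. Qed.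

Lemma tens_map_pure v w : tens_map f g (tens_pure v w) = tens_pure (f v) (g w).
Proof. exact: tens_lift_pure tens_map_bilinear. Qed.

Lemma tens_map_lift (X : lmodType K) (b : V' -> W' -> X) u : is_bilinear b ->
  tens_lift b (tens_map f g u) = tens_lift (fun v w => b (f v) (g w)) u.
Proof.
move=> hb; move: u; apply: tens_lin_ext.
- exact: lin_comp tens_map_linear (tens_lift_linear hb).
- apply: tens_lift_linear; split=> [w a x y|v a x y]; rewrite ?lf ?lg ?hb.1 ?hb.2 //.
- move=> v w; rewrite tens_map_pure !tens_lift_pure//.
  by split=> [y a x z|x a y z]; rewrite ?lf ?lg ?hb.1 ?hb.2.
Qed.
End TensorMap.

(** * Operators with an adjoint *)

Section Operators.
Variable R : realType.
Local Notation C := R[i].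
Variable H : hilbert R.
Implicit Types (f g h : H -> H) (x y : H).
Let hs := hdotP H.

Lemma hn_ge0 x : 0 <= hn x. Proof. exact: sn_ge0. Qed.
Lemma sqr_hn x : hn x ^+ 2 = Re (hdot H x x). Proof. exact: sqr_sn hs x. Qed.
Lemma hdot_sqr x : hdot H x x = (hn x ^+ 2)%:C. Proof. exact: hf_diag hs x. Qed.

Lemma hn_small0 x c : (forall e, 0 < e -> hn x <= c * e) -> x = 0.
Proof.
move=> h; apply: hn_eq0; apply/eqP; rewrite eq_le hn_ge0 andbT; exact: ler_small h.
Qed.

Lemma bnd0 : bnd (0 : H -> H) 0.
Proof. by split=> // x; rewrite mul0r /hn sn0. Qed.

Lemma bndW f M N : M <= N -> bnd f M -> bnd f N.
Proof.
move=> MN [M0 h]; split; first exact: le_trans MN.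
by move=> x; apply: le_trans (h x) _; rewrite ler_wpM2r// hn_ge0.
Qed.

Lemma bndD f g M N : bnd f M -> bnd g N -> bnd (f + g) (M + N).
Proof.
move=> [M0 h] [N0 k]; split=> [|x]; first exact: addr_ge0.
by rewrite mulrDl; apply: le_trans (snD hs _ _) (lerD (h x) (k x)).
Qed.

Lemma bndZ a f M : bnd f M -> bnd (a *: f) (normc a * M).
Proof.
move=> [M0 h]; split=> [|x]; first by rewrite mulr_ge0// normc_ge0.
by rewrite /hn (snZ hs) -mulrA ler_wpM2l ?normc_ge0 ?h.
Qed.

Lemma bndN f M : bnd f M -> bnd (- f) M.
Proof. by move=> [M0 h]; split=> // x; rewrite /hn (snN hs) h. Qed.

Lemma bndB f g M N : bnd f M -> bnd g N -> bnd (f - g) (M + N).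
Proof. by move=> h /bndN; apply: bndD. Qed.

Lemma bnd_comp f g M N : bnd f M -> bnd g N -> bnd (f \o g) (M * N).
Proof.
move=> [M0 h] [N0 k]; split=> [|x]; first exact: mulr_ge0.
by apply: le_trans (h _) _; rewrite -mulrA ler_wpM2l.
Qed.

Lemma bnd_id : bnd (id : H -> H) 1.
Proof. by split=> // x; rewrite mul1r. Qed.

Lemma bnd_hdot f M x : bnd f M -> normc (hdot H (f x) x) <= M * hn x ^+ 2.
Proof.
move=> [M0 h]; apply: le_trans (hf_CS hs _ _) _.
by rewrite expr2 mulrA ler_wpM2r ?hn_ge0 ?h.
Qed.

Lemma adjoint_sym f g : adjoint f g -> adjoint g f.
Proof. by move=> h x y; rewrite (hfC hs) -h -(hfC hs). Qed.

Lemma adjoint_unique f g h : adjoint f g -> adjoint f h -> g = h.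
Proof.
move=> fg fh; apply/funext => y; apply: hdot_inj => z.
by rewrite (adjoint_sym fg) (adjoint_sym fh).
Qed.

Lemma adjoint_comp f f' g g' : adjoint f f' -> adjoint g g' ->
  adjoint (f \o g) (g' \o f').
Proof. by move=> h k x y /=; rewrite h k. Qed.

Lemma adjoint_lin a f f' g g' : adjoint f f' -> adjoint g g' ->
  adjoint (a *: f + g) (a^* *: f' + g').
Proof.
move=> h k x y; rewrite -[(a *: f + g) x]/(a *: f x + g x).
rewrite -[(a^* *: f' + g') y]/(a^* *: f' y + g' y).
by rewrite (hfP hs) (hfDr hs) (hfZr hs) conjCK h k.
Qed.

(** [|g x|^2 = <f (g x), x> <= M |g x| |x|]. *)
Lemma bnd_adjoint f g M : adjoint f g -> bnd f M -> bnd g M.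
Proof.
move=> fg [M0 h]; split=> // x.
have := hn_ge0 (g x); rewrite le_eqVlt => /orP[/eqP <-|g0].
  by rewrite mulr_ge0// hn_ge0.
rewrite -(ler_pM2l g0) -expr2 sqr_hn -fg.
apply: le_trans (ler_norm _) _; apply: le_trans (Re_le_normc _) _.
apply: le_trans (hf_CS hs _ _) _; rewrite mulrA.
by rewrite ler_wpM2r ?sn_ge0// mulrC; exact: h.
Qed.

Lemma adjoint_linear f g : adjoint f g -> linear g.
Proof.
move=> fg a x y; apply: hdot_inj => z.
by rewrite (hfP hs) !(adjoint_sym fg) (hfP hs).
Qed.

Lemma op_complete (f : nat -> H -> H) :
  (forall n, linear (f n)) ->
  (forall e, 0 < e -> exists N, forall m n, (N <= m)%N -> (N <= n)%N ->
     bnd (f m - f n) e) ->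
  exists2 g, linear g & forall e, 0 < e -> exists N, forall n, (N <= n)%N ->
     bnd (f n - g) e.
Proof.
move=> lf h.
have hl x : exists l, forall e, 0 < e -> exists N, forall n, (N <= n)%N ->
    hn (f n x - l) <= e.
  apply: hcompleteR => e e0; have x1 : 0 < hn x + 1 by have := hn_ge0 x; lra.
  have [N hN] := h _ (divr_gt0 e0 x1); exists N => m n Nm Nn.
  have [_ /(_ x)] := hN m n Nm Nn; move/le_trans; apply.
  apply: le_trans (_ : e / (hn x + 1) * (hn x + 1) <= _).
    by rewrite ler_wpM2l ?lerDl// divr_ge0// ltW.
  by rewrite divfK// gt_eqF.
pose g x := sval (cid (hl x)).
have gP x e : 0 < e -> exists N, forall n, (N <= n)%N -> hn (f n x - g x) <= e.
  by move: e; rewrite /g; case: cid.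
exists g.
  move=> a x y; apply/eqP; rewrite -subr_eq0; apply/eqP.
  apply: (@hn_small0 _ (1 + normc a + 1)) => e e0.
  have [N1 h1] := gP (a *: x + y) e e0; have [N2 h2] := gP x e e0.
  have [N3 h3] := gP y e e0; pose n := maxn N1 (maxn N2 N3).
  have {}h1 := h1 n (leq_maxl _ _).
  have {}h2 := h2 n (leq_trans (leq_maxl _ _) (leq_maxr _ _)).
  have {}h3 := h3 n (leq_trans (leq_maxr _ _) (leq_maxr _ _)).
  have -> : g (a *: x + y) - (a *: g x + g y) =
     - (f n (a *: x + y) - g (a *: x + y)) + (a *: (f n x - g x) + (f n y - g y)).
    have -> : a *: (f n x - g x) + (f n y - g y) = f n (a *: x + y) - (a *: g x + g y).
      by rewrite lf scalerBr opprD addrACA.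
    by rewrite opprB subrKA.
  apply: le_trans (snD hs _ _) _; have := snD hs (a *: (f n x - g x)) (f n y - g y).
  rewrite (snN hs) (snZ hs) -/(hn _) -/(hn (f n x - g x)) -/(hn (f n y - g y)).
  have := ler_wpM2l (normc_ge0 a) h2; rewrite -/(hn _) -/(hn (f n x - g x)) => k1 k2.
  by rewrite !mulrDl !mul1r; rewrite /hn in h1 h3 k1 k2 *; lra.
move=> e e0; have [N hN] := h e e0; exists N => n Nn; split=> [|x]; first exact: ltW.
rewrite -subr_le0; apply: ler_small0 => d d0; have [M hM] := gP x d d0.
have k1 := hM _ (leq_maxr N M); have [_ /(_ x) k2] := hN n _ Nn (leq_maxl N M).
have -> : (f n - g) x = (f n - f (maxn N M)) x + (f (maxn N M) x - g x).
  by rewrite -[(f n - g) x]/(f n x - g x) -[(f n - _) x]/(f n x - f (maxn N M) x) subrKA.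
have := snD hs ((f n - f (maxn N M)) x) (f (maxn N M) x - g x).
by rewrite /hn in k1 k2 *; lra.
Qed.

(** All bounded operators are of this kind; carrying the adjoint along avoids
the Riesz representation theorem. *)
Definition adjointable f := bounded_op f /\ exists2 g, bounded_op g & adjoint f g.

Lemma adjointableP f : adjointable f <->
  exists g M, [/\ linear f, linear g, adjoint f g, bnd f M & bnd g M].
Proof.
split=> [[/bounded_opE[lf [M hM]] [g /bounded_opE[lg [N hN]] fg]]|].
  exists g, M; split=> //; exact: bnd_adjoint fg hM.
move=> [g [M [lf lg fg fM gM]]]; split; first by apply/bounded_opE; split=> //; exists M.
by exists g => //; apply/bounded_opE; split=> //; exists M.
Qed.

Lemma adjointable_lin a f g : adjointable f -> adjointable g -> adjointable (a *: f + g).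
Proof.
move=> /adjointableP[f' [M [lf lf' ff fM fM']]] /adjointableP[g' [N [lg lg' gg gM gM']]].
apply/adjointableP; exists (a^* *: f' + g'), (normc a * M + N).
split; [exact: linear_fct_lin|exact: linear_fct_lin|exact: adjoint_lin|..].
  by apply: bndD => //; apply: bndZ.
by apply: bndD => //; rewrite -normc_conj; apply: bndZ.
Qed.

Lemma adjointable_comp f g : adjointable f -> adjointable g -> adjointable (f \o g).
Proof.
move=> /adjointableP[f' [M [lf lf' ff fM fM']]] /adjointableP[g' [N [lg lg' gg gM gM']]].
apply/adjointableP; exists (g' \o f'), (M * N).
split; [exact: lin_comp|exact: lin_comp|exact: adjoint_comp|exact: bnd_comp|].
by rewrite mulrC; exact: bnd_comp.
Qed.

Lemma adjointable_id : adjointable id.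
Proof. by apply/adjointableP; exists id, 1; split=> //; exact: bnd_id. Qed.

Lemma adjointable_adj f g : adjointable f -> adjoint f g -> adjointable g.
Proof.
move=> /adjointableP[f' [M [lf lf' ff fM fM']]] fg.
have <- := adjoint_unique ff fg; apply/adjointableP; exists f, M; split=> //.
exact: adjoint_sym.
Qed.

Lemma bnd_closed f g M e : bnd (f - g) e -> bnd g M -> bnd f (e + M).
Proof. by move=> /bndD h /h; rewrite subrK. Qed.

(** Taking adjoints preserves norms, so the adjoints of approximants of [f]
converge in norm, and their limit is adjoint to [f]. *)
Lemma adjointable_closed f : linear f ->
  (forall e, 0 < e -> exists2 g, adjointable g & bnd (f - g) e) -> adjointable f.
Proof.
move=> lf h.
have [g [g' [gP gb]]] : exists (g g' : nat -> H -> H),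
    (forall n, [/\ adjointable (g n), linear (g' n) & adjoint (g n) (g' n)]) /\
    forall n, bnd (f - g n) n.+1%:R^-1.
  have k n : exists2 g, adjointable g & bnd (f - g) n.+1%:R^-1 by apply/h/invn_gt0.
  pose g n := sval (cid2 (k n)).
  have gP n : adjointable (g n) by rewrite /g; case: cid2.
  have k' n : exists g', linear g' /\ adjoint (g n) g'.
    by have /adjointableP[g' [M [_ lg gg _ _]]] := gP n; exists g'.
  exists g, (fun n => sval (cid (k' n))); split=> n; last by rewrite /g; case: cid2.
  by split=> //; case: cid => g' /= [].
have [|e e0|a la ha] := @op_complete g'; first by move=> n; case: (gP n).
  have [N hN] := ex_invn (divr_gt0 e0 (ltr0Sn _ 1)); exists N => m n Nm Nn.
  have : bnd (g m - g n) e.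
    have -> : g m - g n = (f - g n) - (f - g m) by rewrite opprB [RHS]addrC subrKA.
    have := bndB (gb n) (gb m); apply: bndW.
    by rewrite [e]splitr lerD// hN.
  apply: bnd_adjoint => x y; have [_ _ gm] := gP m; have [_ _ gn] := gP n.
  by rewrite (hfB hs) (hfBr hs) gm gn.
have fa : adjoint f a.
  move=> x y; apply: (@approx_eq _ _ _ (2 * (hn x * hn y))) => e e0.
  have [N hN] := ex_invn e0; have [M hM] := ha e e0; pose n := maxn N M.
  have [_ k1] := gb n; have {}k1 := k1 x; have [_ k2] := hM n (leq_maxr _ _).
  have {}k2 := k2 y; have {}hN := hN n (leq_maxl _ _); have [_ _ gn] := gP n.
  have -> : hdot H (f x) y - hdot H x (a y) =
     hdot H ((f - g n) x) y + hdot H x ((g' n - a) y).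
    by rewrite (hfB hs) (hfBr hs) gn addrA subrK.
  apply: le_trans (normcD _ _) _.
  have := hf_CS hs ((f - g n) x) y; have := hf_CS hs x ((g' n - a) y).
  rewrite -/(hn _) -/(hn y) -/(hn x) -/(hn ((f - g n) x)).
  have := hn_ge0 x; have := hn_ge0 y; move: k1 k2; rewrite -/(hn _).
  move: (hn x) (hn y) (hn ((f - g n) x)) (hn ((g' n - a) y)) => p q r t k1 k2 q0 p0.
  have := ler_wpM2r p0 hN => h1.
  have : r * q <= e * q * p by rewrite [leRHS]mulrAC ler_wpM2r// (le_trans k1).
  have : p * t <= e * q * p by rewrite [leRHS]mulrC ler_wpM2l.
  by lra.
have [g0 gA0 gb0] := h 1 ltr01.
have /adjointableP[g0' [M [_ _ _ gM _]]] := gA0.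
have fM := bnd_closed gb0 gM.
by apply/adjointableP; exists a, (1 + M); split=> //; exact: bnd_adjoint fM.
Qed.

End Operators.

(** * C*-algebras generated by operators *)

Section MakeCstar.
Variable R : realType.
Local Notation C := R[i].
Variable H : hilbert R.
Let hs := hdotP H.

Definition star_subalgebra (G : set (H -> H)) : Prop :=
  [/\ G `<=` @adjointable R H, G id,
      forall a f g, G f -> G g -> G (a *: f + g),
      forall f g, G f -> G g -> G (f \o g)
    & forall f, G f -> exists2 g, G g & adjoint f g].

Lemma star_subalgebra_adjointable : star_subalgebra (@adjointable R H).
Proof.
split=> //; [exact: adjointable_id|exact: adjointable_lin|exact: adjointable_comp|].
move=> f hf; have /adjointableP[g [M [_ _ fg _ _]]] := hf.
by exists g => //; exact: adjointable_adj fg.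
Qed.

Variable G : set (H -> H).
Hypothesis hG : star_subalgebra G.

Definition op_closure : set (H -> H) := fun f =>
  adjointable f /\ forall e, 0 < e -> exists2 g, G g & bnd (f - g) e.

Lemma op_closure_sub : G `<=` op_closure.
Proof.
move=> f Gf; split; first by case: hG => h _ _ _ _; exact: h.
by move=> e e0; exists f => //; rewrite subrr; apply: bndW (bnd0 _); exact: ltW.
Qed.

Lemma op_closure_bounded f : op_closure f -> bounded_op f.
Proof. by case=> -[]. Qed.

Lemma op_closure_id : op_closure id.
Proof. by apply: op_closure_sub; case: hG. Qed.

Lemma op_closure_lin (a : C) f g :
  op_closure f -> op_closure g -> op_closure (a *: f + g).
Proof.
move=> [f1 f2] [g1 g2]; split; first exact: adjointable_lin.
move=> e e0; have a1 : 0 < 2 * (normc a + 1) by have := normc_ge0 a; lra.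
have [f' Gf hf] := f2 _ (divr_gt0 e0 a1).
have [g' Gg hg] := g2 _ (divr_gt0 e0 (ltr0Sn _ 1)).
exists (a *: f' + g'); first by case: hG => _ _ h _ _; exact: h.
have -> : a *: f + g - (a *: f' + g') = a *: (f - f') + (g - g').
  by rewrite scalerBr opprD addrACA.
apply: bndW (bndD (bndZ a hf) hg); rewrite [leRHS]splitr lerD2r.
have -> : normc a * (e / (2 * (normc a + 1))) = normc a / (normc a + 1) * (e / 2).
  by field; rewrite gt_eqF// ltr_wpDl ?normc_ge0.
rewrite ler_piMl//; first by rewrite divr_ge0// ltW.
by rewrite ler_pdivrMr ?mul1r ?lerDl// ltr_wpDl ?normc_ge0.
Qed.

Lemma op_closure_comp f g : op_closure f -> op_closure g -> op_closure (f \o g).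
Proof.
move=> [f1 f2] [g1 g2]; split; first exact: adjointable_comp.
move=> e e0; have /adjointableP[_ [M [lf _ _ fM _]]] := f1.
have /adjointableP[_ [N [lg _ _ gN _]]] := g1.
have [M0 _] := fM; have [N0 _] := gN; pose K := M + N + 1.
have K0 : 0 < 2 * K by rewrite /K; lra.
have m0 : 0 < Order.min 1 (e / (2 * K)) by rewrite lt_min ltr01 divr_gt0.
have [f' Gf hf] := f2 _ m0; have [g' Gg hg] := g2 _ m0.
have m1 := min_le_l 1 (e / (2 * K)); have me := min_le_r 1 (e / (2 * K)).
move: (Order.min _ _) hf hg m0 m1 me => m hf hg m0 m1 me.
exists (f' \o g'); first by case: hG => _ _ _ h _; exact: h.
have -> : (f \o g) - (f' \o g') = ((f - f') \o g) + (f' \o (g - g')).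
  apply/funext => x; rewrite -[LHS]/(f (g x) - f' (g' x)).
  rewrite -[RHS]/(f (g x) - f' (g x) + f' (g x - g' x)).
  case: hG => [/(_ _ Gf)/adjointableP[? [? [lf' _ _ _ _]]] _ _ _ _].
  by rewrite (linB lf') subrKA.
have f'M : bnd f' (m + M).
  apply: bnd_closed fM; have := bndN hf; rewrite opprB; exact.
apply: bndW (bndD (bnd_comp hf gN) (bnd_comp f'M hg)).
apply: le_trans (_ : m * (2 * K) <= _); first by rewrite /K; nra.
by rewrite -ler_pdivlMr.
Qed.

Lemma op_closure_adj f : op_closure f -> exists2 g, op_closure g & adjoint f g.
Proof.
move=> [f1 f2]; have /adjointableP[g [M [_ _ fg _ _]]] := f1; exists g => //.
split; first exact: adjointable_adj fg.
move=> e e0; have [f' Gf hf] := f2 e e0.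
have [g' Gg fg'] : exists2 g', G g' & adjoint f' g'.
  by case: hG => _ _ _ _; apply.
exists g' => //; apply: bnd_adjoint hf => x y.
by rewrite (hfB hs) (hfBr hs) fg fg'.
Qed.

Definition closure_opsys : opsys R :=
  OpSys op_closure_bounded op_closure_id op_closure_lin op_closure_adj.

Lemma op_closure_norm_closed : norm_closed closure_opsys.
Proof.
move=> f /bounded_opE[lf _] h.
have {}h e : 0 < e -> exists2 g, op_closure g & bnd (f - g) e.
  move=> e0; have [|g hg] := h e%:C; first by rewrite ltcR.
  by move/opnorm_leR; exists g.
split.
  by apply: adjointable_closed => // e /h[g [hg _] hfg]; exists g.
move=> e e0; have [g [_ hg] hfg] := h _ (divr_gt0 e0 (ltr0Sn _ 1)).
have [g' Gg hg'] := hg _ (divr_gt0 e0 (ltr0Sn _ 1)).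
exists g' => //; have := bndD hfg hg'.
by rewrite subrKA -splitr.
Qed.

Definition closure_cstar : cstar R :=
  @CStar R closure_opsys op_closure_comp op_closure_norm_closed.

End MakeCstar.

(** All of [B(H)], since bounded operators have adjoints. *)
Definition BH (R : realType) (H : hilbert R) : cstar R :=
  closure_cstar (@star_subalgebra_adjointable R H).

Section Elements.
Variable R : realType.
Local Notation C := R[i].

Section Opsys.
Variable S : opsys R.
Implicit Types x y z : S.

Lemma os_eq x y : (forall h, x h = y h) -> x = y.
Proof. by move=> h; apply: val_inj; apply/funext. Qed.
Lemma os_valL a x y h : (a *: x + y) h = a *: x h + y h. Proof. by []. Qed.
Lemma os_valD x y h : (x + y) h = x h + y h. Proof. by []. Qed.
Lemma os_valB x y h : (x - y) h = x h - y h. Proof. by []. Qed.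
Lemma os_valZ a x h : (a *: x) h = a *: x h. Proof. by []. Qed.
Lemma os_val0 h : (0 : S) h = 0. Proof. by []. Qed.
Lemma os_val1 h : os_one S h = h. Proof. by []. Qed.
Lemma os_linear x : linear x. Proof. by have [] := os_bounded (os_setP x). Qed.
Lemma os_bnd x : exists M, bnd x M.
Proof. by have /bounded_opE[] := os_bounded (os_setP x). Qed.
Lemma os_starP x : adjoint x (os_star x). Proof. by rewrite /os_star; case: cid. Qed.
Lemma os_starE x y : adjoint x y -> os_star x = y.
Proof. by move=> h; apply: val_inj; apply: adjoint_unique (os_starP x) h. Qed.
Lemma os_starK x : os_star (os_star x) = x.
Proof. by apply: os_starE; apply: adjoint_sym; exact: os_starP. Qed.
Lemma os_star_lin a x y : os_star (a *: x + y) = a^* *: os_star x + os_star y.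
Proof. by apply: os_starE; apply: adjoint_lin; exact: os_starP. Qed.
Lemma os_starD x y : os_star (x + y) = os_star x + os_star y.
Proof. by have := os_star_lin 1 x y; rewrite conjC1 !scale1r. Qed.
Lemma os_star0 : os_star (0 : S) = 0.
Proof. by have := os_starD 0 0; rewrite addr0 -{1}[os_star 0]addr0 => /addrI. Qed.
Lemma os_starZ a x : os_star (a *: x) = a^* *: os_star x.
Proof. by have := os_star_lin a x 0; rewrite !addr0 os_star0 addr0. Qed.
Lemma os_starB x y : os_star (x - y) = os_star x - os_star y.
Proof. by rewrite addrC -scaleN1r os_star_lin rmorphN /= conjC1 scaleN1r addrC. Qed.
Lemma os_star1 : os_star (os_one S) = os_one S.
Proof. exact: os_starE. Qed.
Lemma os_adjointable x : adjointable x.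
Proof.
split; first exact: os_bounded (os_setP x).
by exists (os_star x); [exact: os_bounded (os_setP _)|exact: os_starP].
Qed.
End Opsys.

Section Cs.
Variable A : cstar R.
Implicit Types x y z : A.
Lemma cs_mulE x y h : cs_mul x y h = x (y h). Proof. by []. Qed.
Lemma cs_star_mul x y : os_star (cs_mul x y) = cs_mul (os_star y) (os_star x).
Proof. by apply: os_starE; apply: adjoint_comp; exact: os_starP. Qed.
Lemma cs_mul1 x : cs_mul x (os_one A) = x. Proof. exact: os_eq. Qed.
Lemma cs_1mul x : cs_mul (os_one A) x = x. Proof. exact: os_eq. Qed.
End Cs.
End Elements.

(** * *-homomorphisms are contractive *)

Section PositiveOperators.
Variable R : realType.
Local Notation C := R[i].
Variable H : hilbert R.
Let hs := hdotP H.

Lemma positive_hform (P : H -> H) : linear P -> adjoint P P ->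
  (forall x, 0 <= Re (hdot H (P x) x)) -> hform (fun x y => hdot H (P x) y).
Proof.
move=> lP aP p; split=> [a x y z|x y|x].
- by rewrite lP (hfP hs).
- by rewrite aP (hfC hs).
- apply/ge0C; split=> //; have := aP x x; rewrite [RHS](hfC hs).
  by move=> /(congr1 (@complex.Im R)); rewrite ImJ; lra.
Qed.

(** Cauchy-Schwarz for the form [<P x, y>] gives [|P x|^4 <= <P x, x> <P P x, P
x>], whose last factor is at most [c |P x|^2]. *)
Lemma positive_bound (P : H -> H) c : linear P -> adjoint P P ->
  (forall x, 0 <= Re (hdot H (P x) x) <= c * hn x ^+ 2) ->
  forall x, hn (P x) ^+ 2 <= c * Re (hdot H (P x) x).
Proof.
move=> lP aP hP x.
have hf := positive_hform lP aP (fun y => proj1 (andP (hP y))).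
have := hn_ge0 (P x); rewrite le_eqVlt => /orP[/eqP e|p0].
  have Px0 : P x = 0 by apply: hn_eq0.
  by rewrite Px0 (hf0 hs) mulr0 /hn sn0 // expr0n.
have h1 : (hn (P x) ^+ 2) ^+ 2 <= Re (hdot H (P x) x) * Re (hdot H (P (P x)) (P x)).
  rewrite -(sqr_sn hf) -(sqr_sn hf) -exprMn ler_pXn2r ?nnegrE ?mulr_ge0 ?sqr_ge0 ?sn_ge0//.
  by have := hf_CS hf x (P x); rewrite hdot_sqr normc_real ger0_norm ?sqr_ge0.
have /andP[_ h2] := hP (P x); have h3 := hfRe hf x.
have pp : 0 < hn (P x) ^+ 2 by rewrite exprn_gt0.
rewrite -(ler_pM2r pp) -[leLHS]expr2; apply: le_trans h1 _.
by rewrite [leRHS]mulrAC [leRHS]mulrC ler_wpM2l.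
Qed.
End PositiveOperators.

(** Bernoulli's inequality for the inverse of [r], in the form [r^n (1 + n (1 -
r)) <= 1]. *)
Lemma geometric_small (R : realType) (r e : R) : 0 <= r -> r < 1 -> 0 < e ->
  exists N, forall n, (N <= n)%N -> r ^+ n <= e.
Proof.
move=> r0 r1 e0.
have key n : r ^+ n * (1 + n%:R * (1 - r)) <= 1.
  elim: n => [|n IH]; first by rewrite mul0r addr0 mulr1.
  apply: le_trans IH; rewrite exprSr -mulrA ler_wpM2l ?exprn_ge0//.
  rewrite -natr1; have : 0 <= n%:R :> R by [].
  move: n%:R => m m0; have : 0 <= (m + 1) * (1 - r) ^+ 2.
    by rewrite mulr_ge0 ?sqr_ge0// addr_ge0.
  by rewrite expr2; lra.
have d0 : 0 < e * (1 - r) by rewrite mulr_gt0// subr_gt0.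
have [N hN] := ex_invn d0; exists N.+1 => -[//|n] Nn.
have n0 : 0 < n.+1%:R :> R by rewrite ltr0n.
have := hN n Nn; rewrite invf_ple ?posrE// => h1.
have h2 := key n.+1; have h3 := exprn_ge0 n.+1 r0.
have : r ^+ n.+1 * (n.+1%:R * (1 - r)) <= 1 by nra.
rewrite -ler_pdivlMr ?mulr_gt0 ?subr_gt0// => /le_trans; apply.
by rewrite mul1r invf_ple ?posrE ?mulr_gt0 ?subr_gt0// -ler_pdivrMr ?subr_gt0// -invfM.
Qed.

Section Neumann.
Variable R : realType.
Local Notation C := R[i].
Variable A : cstar R.
Let H := os_hilb A.

(** The partial sums of the series of the powers of [k] satisfy [s n.+1 = 1 + k
* s n] and form a Cauchy sequence; the equation passes to their limit. *)
Lemma Neumann (k : A) r : r < 1 -> bnd k r ->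
  exists z : A, z = os_one A + cs_mul k z.
Proof.
move=> r1 kr; have [r0 _] := kr.
pose s := fix s n : A := if n is n.+1 then os_one A + cs_mul k (s n) else 0.
have r1' : 0 < 1 - r by rewrite subr_gt0.
have b1 n : bnd (s n) (1 - r)^-1.
  elim: n => [|n IH]; first by apply: bndW (bnd0 _); rewrite invr_ge0 ltW.
  apply: bndW (bndD (bnd_id _) (bnd_comp kr IH)).
  by rewrite -[X in X + _](divff (lt0r_neq0 r1')) -mulrDl subrK mul1r.
have b2 n p : bnd (s (n + p)%N - s n) (r ^+ n * (1 - r)^-1).
  elim: n => [|n IH]; first by rewrite subr0 add0n expr0 mul1r; exact: b1.
  have -> : os_val (s (n.+1 + p)%N - s n.+1) = k \o os_val (s (n + p)%N - s n).
    apply/funext => x; rewrite addSn -[LHS]/(x + k (s (n + p)%N x) - (x + k (s n x))).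
    by rewrite opprD addrACA subrr add0r -[RHS]/(k (s (n + p)%N x - s n x)) (linB (os_linear k)).
  by rewrite exprS -mulrA; exact: bnd_comp.
have [||g lg hg] := @op_complete _ H (fun n => os_val (s n)).
- by move=> n; exact: os_linear.
- move=> e e0; have [|N hN] := @geometric_small _ r (e * (1 - r)) r0 r1.
    by rewrite mulr_gt0.
  have hN' n : (N <= n)%N -> r ^+ n * (1 - r)^-1 <= e.
    by move=> /hN; rewrite ler_pdivrMr.
  exists N => m n Nm Nn; case/orP: (leq_total m n) => mn.
    rewrite -opprB; apply: bndN; rewrite -(subnKC mn).
    by apply: bndW (b2 _ _); exact: hN'.
  by rewrite -(subnKC mn); apply: bndW (b2 _ _); exact: hN'.
have hb : bounded_op g.
  apply/bounded_opE; split=> //; have [N hN] := hg 1 ltr01.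
  exists (1 + (1 - r)^-1); apply: (@bnd_closed _ _ _ (s N)) (b1 N).
  by rewrite -opprB; apply/bndN/hN.
have gA : @os_set _ A g.
  apply: cs_closed hb _ => e /[dup]/ltW/ge0C[_ ei]; rewrite ltcE => /andP[_ /= e0].
  have [N hN] := hg _ e0; exists (s N); first exact: os_setP.
  apply/opnorm_leE; exists (Re e); first exact: eqCri.
  by rewrite -opprB; apply/bndN/hN.
exists (os_mk gA); apply: os_eq => x.
rewrite -[LHS]/(g x) -[RHS]/(x + k (g x)).
apply/eqP; rewrite -subr_eq0; apply/eqP.
apply: (@hn_small0 _ _ _ (2 * hn x)) => e e0.
have [N hN] := hg e e0.
have [_ /(_ x) h1] := hN N.+1 (leqnSn _); have [_ /(_ x) h2] := hN N (leqnn _).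
have -> : g x - (x + k (g x)) = - (s N.+1 x - g x) + k (s N x - g x).
  rewrite (linB (os_linear k)) -[s N.+1 x]/(x + k (s N x)) opprB.
  by rewrite !(opprD x) !(addrA (g x)) subrKA.
apply: le_trans (snD (hdotP _) _ _) _; rewrite (snN (hdotP _)).
have [_ /(_ (s N x - g x))] := kr.
rewrite -[s N.+1 x - g x]/((os_val (s N.+1) - g) x) -[s N x - g x]/((os_val (s N) - g) x).
have := hn_ge0 ((os_val (s N) - g) x).
by rewrite /hn in h1 h2 *; nra.
Qed.
End Neumann.

Section Contractive.
Variable R : realType.
Local Notation C := R[i].

(** This replaces spectral theory. Let [t] be the least nonnegative real such
that [Y + t >= 0]. If [t > 0] then [Y + t] is positive and bounded below, hence
it stays positive when a small multiple of 1 is subtracted; so [t = 0]. *)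
Lemma positive_of_bounded_below (H : hilbert R) (Y : H -> H) N :
  linear Y -> adjoint Y Y -> bnd Y N ->
  (forall t, 0 < t -> exists K, forall x, hn x <= K * hn (Y x + t%:C *: x)) ->
  forall x, 0 <= Re (hdot H (Y x) x).
Proof.
move=> lY aY YN below; have hs := hdotP H; have [N0 _] := YN.
pose T := [set t : R | 0 <= t /\ forall x, 0 <= Re (hdot H (Y x) x) + t * hn x ^+ 2].
have Yb x : `|Re (hdot H (Y x) x)| <= N * hn x ^+ 2.
  exact: le_trans (Re_le_normc _) (bnd_hdot _ YN).
have TN : T N by split=> // x; have := Yb x; rewrite ler_norml; lra.
have hT : has_inf T by split; [exists N | exists 0 => t []].
have t0 : 0 <= inf T by apply: lb_le_inf => [|t []//]; exists N.
have Tt : forall x, 0 <= Re (hdot H (Y x) x) + inf T * hn x ^+ 2.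
  move=> x; rewrite -oppr_le0; apply: (@ler_small _ _ (hn x ^+ 2)) => e e0.
  have [t [_ /(_ x) ht] te] := inf_adherent e0 hT.
  have := sqr_ge0 (hn x); nra.
(* It remains to show that the least admissible shift is 0. *)
suff i0 : inf T = 0 by move=> x; have := Tt x; rewrite i0 mul0r addr0.
apply/eqP; rewrite eq_le t0 andbT leNgt; apply/negP => t1.
have [K hK] := below _ t1; set t := inf T in t0 t1 hK Tt *.
have tr : (t%:C)^* = t%:C by rewrite conjCE /= oppr0.
pose P x := Y x + t%:C *: x.
have PE x : Re (hdot H (P x) x) = Re (hdot H (Y x) x) + t * hn x ^+ 2.
  by rewrite /P (hfD hs) (hfZ hs) !CE hdot_sqr /= mul0r subr0.
have lP : linear P.
  move=> a x y; rewrite /P lY !scalerDr !scalerA [a * _]mulrC -!addrA; congr (_ + _).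
  by rewrite addrCA.
have aP : adjoint P P.
  by move=> x y; rewrite /P (hfD hs) (hfDr hs) (hfZ hs) (hfZr hs) aY tr.
have h1 := @positive_bound _ _ P (N + t) lP aP.
have {}h1 x : hn (P x) ^+ 2 <= (N + t) * Re (hdot H (P x) x).
  apply: h1 => {}x; rewrite PE Tt mulrDl lerD2r.
  exact: le_trans (ler_norm _) (Yb x).
pose D := K ^+ 2 * (N + t) + 1.
have D0 : 0 < D by rewrite ltr_wpDl// mulr_ge0 ?sqr_ge0// addr_ge0.
have h2 x : hn x ^+ 2 <= D * Re (hdot H (P x) x).
  have h3 : hn x ^+ 2 <= K ^+ 2 * hn (P x) ^+ 2.
    rewrite -exprMn ler_pXn2r ?nnegrE ?hn_ge0//.
    by apply: le_trans (hn_ge0 x) _; exact: hK.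
  apply: le_trans h3 _; apply: le_trans (ler_wpM2l (sqr_ge0 K) (h1 x)) _.
  by rewrite mulrA ler_wpM2r ?lerDl// PE.
have : t <= Order.max 0 (t - D^-1).
  apply: ge_inf; first exact: hT.2.
  split=> [|x]; first by rewrite le_max lexx.
  have h3 : t - D^-1 <= Order.max 0 (t - D^-1) by rewrite le_max lexx orbT.
  have := h2 x; rewrite mulrC -ler_pdivrMr// PE mulrC => h4.
  by have := ler_wpM2r (sqr_ge0 (hn x)) h3; rewrite mulrBl; lra.
by rewrite le_max leNgt t1 /= lerBrDr gerDl leNgt invr_gt0 D0.
Qed.

Variables (A B : cstar R) (p : A -> B).
Hypothesis hp : star_hom p.

(** For [t > 0] a Neumann series inverts [y + t], hence [p y + t] is invertible
and therefore bounded below. *)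
Lemma star_hom_positive (y : A) : os_star y = y ->
  (forall h, 0 <= Re (hdot _ (y h) h)) -> forall h, 0 <= Re (hdot _ (p y h) h).
Proof.
case: hp => lp p1 pM pS yS yP.
have [N yN] := os_bnd y; have [N0 _] := yN; have [M yM] := os_bnd (p y).
have [hA hB] := (hdotP (os_hilb A), hdotP (os_hilb B)).
apply: positive_of_bounded_below (os_linear _) _ yM _.
  by have := os_starP (p y); rewrite -pS yS.
move=> t t0; pose c := N + t; have c0 : 0 < c by rewrite /c; lra.
have cr (a : R) : (a%:C)^* = a%:C by rewrite conjCE /= oppr0.
(* [k] has norm at most [N / (N + t) < 1] because [0 <= N - y <= N]. *)
pose k : A := c^-1%:C *: (N%:C *: os_one A - y).
have PE h : Re (hdot _ ((N%:C *: os_one A - y) h) h) =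
    N * hn h ^+ 2 - Re (hdot _ (y h) h).
  rewrite os_valB os_valZ (hfB hA) (hfZ hA) !CE hdot_sqr /= mul0r subr0.
  by [].
have kr : bnd k (N / c).
  split=> [|h]; first by rewrite divr_ge0// ltW.
  rewrite os_valZ /hn (snZ hA) normc_real ger0_norm ?invr_ge0 ?(ltW c0)//.
  rewrite [N / c]mulrC -mulrA ler_pM2l ?invr_gt0// -/(hn _) -/(hn h).
  rewrite -(@ler_pXn2r _ 2) ?nnegrE ?mulr_ge0 ?hn_ge0//.
  have bb x : `|Re (hdot _ (y x) x)| <= N * hn x ^+ 2.
    exact: le_trans (Re_le_normc _) (bnd_hdot _ yN).
  have := @positive_bound _ _ (N%:C *: os_one A - y) N (os_linear _).
  move/(_ _ _ h)/le_trans; apply.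
  - have := os_starP (N%:C *: os_one A - y).
    by rewrite os_starB yS os_starZ os_star1 cr.
  - by move=> x; rewrite PE; have := bb x; have := yP x; rewrite ler_norml; lra.
  - by rewrite exprMn expr2 -mulrA ler_wpM2l// PE; have := yP h; lra.
have [|z hz] := @Neumann _ A k (N / c) _ kr.
  by rewrite ltr_pdivrMr// mul1r /c; lra.
have [Z zZ] := os_bnd (p z); have [Z0 _] := zZ.
(* Taking adjoints turns the right inverse [p z] into a left inverse. *)
pose w := os_star (p z); have wZ : bnd w Z by apply: bnd_adjoint zZ; exact: os_starP.
have kS : os_star k = k.
  by rewrite /k os_starZ os_starB yS os_starZ os_star1 !cr.
have wk : w = os_one B + cs_mul w (p k).
  rewrite {1}/w hz (linD lp) p1 os_starD os_star1; congr (_ + _).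
  by rewrite pM cs_star_mul -[os_star (p k)]pS kS.
exists (Z * c^-1) => h.
have hw : h = w (c^-1%:C *: (p y h + t%:C *: h)).
  have e1 : c^-1%:C *: (p y h + t%:C *: h) = h - p k h.
    have -> : p k = c^-1%:C *: (N%:C *: os_one B - p y).
      by rewrite /k (linZ lp) (linB lp) (linZ lp) p1.
    have cN : c%:C != 0 :> C by rewrite (inj_eq (@complexI R)) gt_eqF.
    have key (X : os_hilb B) : c%:C *: (c^-1%:C *: X) = X.
      by rewrite scalerA -rmorphM divff ?gt_eqF// scale1r.
    have cE : c%:C = N%:C + t%:C :> C by rewrite -rmorphD.
    apply: (scalerI cN); rewrite os_valZ os_valB os_valZ os_val1 [RHS]scalerBr.
    by rewrite !key cE scalerDl opprB [RHS]addrC subrKA.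
  rewrite e1 (linB (os_linear w)) {1}wk os_valD os_val1 cs_mulE.
  by rewrite addrK.
have [_ h1] := wZ; rewrite {1}hw; apply: le_trans (h1 _) _.
by rewrite /hn (snZ hB) normc_real ger0_norm ?invr_ge0 ?(ltW c0)// mulrA.
Qed.

(** The positive element [M^2 - x^* x] has a positive image. *)
Lemma star_hom_bnd (x : A) M : bnd x M -> bnd (p x) M.
Proof.
case: (hp) => lp p1 pM pS [M0 xM].
have [hA hB] := (hdotP (os_hilb A), hdotP (os_hilb B)).
have cr (a : R) : (a%:C)^* = a%:C by rewrite conjCE /= oppr0.
pose y : A := (M ^+ 2)%:C *: os_one A - cs_mul (os_star x) x.
have yS : os_star y = y.
  by rewrite /y os_starB cs_star_mul os_starK os_starZ os_star1 cr.
have E (D : cstar R) (z : D) h :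
    Re (hdot _ (((M ^+ 2)%:C *: os_one D - cs_mul (os_star z) z) h) h) =
    M ^+ 2 * hn h ^+ 2 - hn (z h) ^+ 2.
  have hD := hdotP (os_hilb D).
  rewrite os_valB os_valZ (hfB hD) (hfZ hD) os_val1 cs_mulE.
  by rewrite (adjoint_sym (os_starP z)) !hdot_sqr !CE /= mul0r subr0.
have pos : forall h, 0 <= Re (hdot _ (p y h) h).
  apply: star_hom_positive yS _ => h; rewrite E subr_ge0 -exprMn.
  by rewrite ler_pXn2r ?nnegrE ?mulr_ge0 ?hn_ge0.
split=> // h; rewrite -(@ler_pXn2r _ 2) ?nnegrE ?mulr_ge0 ?hn_ge0//.
rewrite exprMn -subr_ge0 -E.
by have := pos h; rewrite /y (linB lp) (linZ lp) p1 pM pS.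
Qed.

End Contractive.

(** * Direct sums and ultraproducts of Hilbert spaces *)

Section DependentProduct.
Variables (K : pzRingType) (I : Type) (V : I -> lmodType K).

(** A name for the dependent functions, to carry the pointwise module structure.
*)
Definition dprod : Type := forall i, V i.
HB.instance Definition _ := gen_eqMixin dprod.
HB.instance Definition _ := gen_choiceMixin dprod.
Implicit Types x y : dprod.

Let addA : associative (fun x y : dprod => (fun i => x i + y i) : dprod).
Proof. by move=> x y z; apply: functional_extensionality_dep => i; rewrite addrA. Qed.
Let addC : commutative (fun x y : dprod => (fun i => x i + y i) : dprod).
Proof. by move=> x y; apply: functional_extensionality_dep => i; rewrite addrC. Qed.
Let add0 : left_id ((fun i => 0) : dprod) (fun x y : dprod => (fun i => x i + y i) : dprod).
Proof. by move=> x; apply: functional_extensionality_dep => i; rewrite add0r. Qed.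
Let addN : left_inverse ((fun i => 0) : dprod) (fun x : dprod => (fun i => - x i) : dprod)
  (fun x y : dprod => (fun i => x i + y i) : dprod).
Proof. by move=> x; apply: functional_extensionality_dep => i; rewrite addNr. Qed.
HB.instance Definition _ := GRing.isZmodule.Build dprod addA addC add0 addN.

Let scale (a : K) (x : dprod) : dprod := fun i => a *: x i.
Let scaleA a b x : scale a (scale b x) = scale (a * b) x.
Proof. by apply: functional_extensionality_dep => i; rewrite /scale scalerA. Qed.
Let scale1 : left_id 1 scale.
Proof. by move=> x; apply: functional_extensionality_dep => i; rewrite /scale scale1r. Qed.
Let scaleDr : right_distributive scale +%R.
Proof. by move=> a x y; apply: functional_extensionality_dep => i; apply: scalerDr. Qed.
Let scaleDl x : {morph scale^~ x : a b / a + b}.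
Proof. by move=> a b; apply: functional_extensionality_dep => i; apply: scalerDl. Qed.
HB.instance Definition _ :=
  GRing.Zmodule_isLmodule.Build K dprod scaleA scale1 scaleDr scaleDl.
End DependentProduct.

(** What an inner product on families of vectors needs from a sum over the index
set. Finite sums give the direct sum of a family of Hilbert spaces, and the
limit along an ultrafilter gives its ultraproduct; [sdom] is the class of real
families for which the sum of a dominated family is meaningful. *)
Record summation (R : realType) (I : Type) := Summation {
  sdom : set (I -> R);
  ssum : (I -> R[i]) -> R[i];
  sdom0 : sdom (fun=> 0);
  sdomD : forall f g, sdom f -> sdom g -> sdom (fun i => f i + g i);
  sdomS : forall f g c, sdom g -> (forall i, 0 <= f i <= c * g i) -> sdom f;
  ssumL : forall a z w, sdom (fun i => normc (z i)) -> sdom (fun i => normc (w i)) ->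
    ssum (fun i => a * z i + w i) = a * ssum z + ssum w;
  ssumJ : forall z, sdom (fun i => normc (z i)) ->
    ssum (fun i => (z i)^*) = (ssum z)^*;
  ssum_ge0 : forall z, sdom (fun i => normc (z i)) -> (forall i, 0 <= z i) ->
    0 <= ssum z }.

Section Family.
Variable R : realType.
Local Notation C := R[i].
Variables (I : Type) (M : summation R I) (H : I -> hilbert R).
Implicit Types x y : dprod H.

Definition summable : set (dprod H) := fun x => sdom M (fun i => hn (x i) ^+ 2).

Definition summable_pred : {pred dprod H} := mem summable.

Lemma summable_submod : GRing.submod_closed summable_pred.
Proof.
split=> [|a x y]; rewrite !in_setE.
  rewrite /summable (_ : (fun i => _) = (fun=> 0)); first exact: sdom0.
  by apply/funext => i; rewrite /hn (sn0 (hdotP _)) expr0n.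
move=> hx hy; apply: (@sdomS _ _ _ _ (fun i => normc a ^+ 2 * hn (x i) ^+ 2 + hn (y i) ^+ 2) 2).
  apply: sdomD => //; apply: (sdomS (c := normc a ^+ 2)) hx _ => i.
  by rewrite lexx andbT mulr_ge0 ?sqr_ge0.
move=> i; rewrite sqr_ge0 /=.
have := snD (hdotP _) (a *: x i) (y i); rewrite (snZ (hdotP _)) => h.
have n0 : 0 <= hn (a *: x i + y i) by exact: hn_ge0.
apply: le_trans (_ : (normc a * hn (x i) + hn (y i)) ^+ 2 <= _).
  by rewrite ler_pXn2r ?nnegrE// addr_ge0 ?mulr_ge0 ?hn_ge0 ?normc_ge0.
rewrite -exprMn; move: (normc a * _) (hn (y i)) => p q.
by rewrite -subr_ge0 (_ : _ - _ = (p - q) ^+ 2) ?sqr_ge0//; ring.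
Qed.
HB.instance Definition _ := GRing.isSubmodClosed.Build C (dprod H)
  summable_pred summable_submod.

Record family := Family {
  fval : dprod H;
  fvalP : fval \in summable_pred }.
HB.instance Definition _ := [isSub for @fval].
HB.instance Definition _ := [Choice of family by <:].
HB.instance Definition _ := [SubChoice_isSubLmodule of family by <:].

Definition fapp (u : family) : forall i, H i := fval u.
Coercion fapp : family >-> Funclass.
Implicit Types u v w : family.

Definition fmk x (hx : summable x) : family := @Family x (mem_set hx).
Lemma fvalE u : summable u. Proof. by have := fvalP u; rewrite in_setE. Qed.
Lemma family_eq u v : (forall i, u i = v i) -> u = v.
Proof. by move=> h; apply: val_inj; apply: functional_extensionality_dep. Qed.

Definition fdot u v : C := ssum M (fun i => hdot (H i) (u i) (v i)).

Lemma fdot_dom u v : sdom M (fun i => normc (hdot (H i) (u i) (v i))).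
Proof.
apply: (sdomS (c := 1) (sdomD (fvalE u) (fvalE v))) => i.
rewrite normc_ge0 mul1r; apply: le_trans (hf_CS (hdotP _) _ _) _.
rewrite -/(hn (u i)) -/(hn (v i)); have := sqr_ge0 (hn (u i) - hn (v i)).
have := hn_ge0 (u i); have := hn_ge0 (v i); nra.
Qed.

Lemma fdotH : hform fdot.
Proof.
split=> [a u v w|u v|u].
- rewrite /fdot -ssumL; [|exact: fdot_dom|exact: fdot_dom].
  by congr ssum; apply/funext => i; rewrite -(hfP (hdotP _)).
- rewrite /fdot -ssumJ; last exact: fdot_dom.
  by congr ssum; apply/funext => i; rewrite (hfC (hdotP _)).
- by apply: ssum_ge0 => [|i]; [exact: fdot_dom|exact: hf_ge0 (hdotP _) _].
Qed.

Definition family_pre : prehilbert R := PreHilbert fdotH.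
Definition family_hilbert := completion_hilbert family_pre.

Lemma ssum_mono (z w : I -> C) : sdom M (fun i => normc (z i)) ->
  sdom M (fun i => normc (w i)) -> (forall i, 0 <= w i - z i) ->
  0 <= ssum M w - ssum M z.
Proof.
move=> hz hw h; have := ssumL (-1) hz hw; rewrite mulN1r addrC => <-.
apply: ssum_ge0 => [|i]; last by rewrite mulN1r addrC.
apply: (sdomS (c := 1) (sdomD hz hw)) => i.
rewrite normc_ge0 mul1r; apply: le_trans (normcD _ _) _.
by rewrite mulN1r normcN.
Qed.

Lemma fam_summable (a : forall i, H i -> H i) N u :
  (forall i, bnd (a i) N) -> summable (fun i => a i (u i)).
Proof.
move=> aN; apply: (sdomS (c := N ^+ 2) (fvalE u)) => i; rewrite sqr_ge0 -exprMn.
have [N0 h] := aN i; rewrite ler_pXn2r ?nnegrE ?mulr_ge0 ?hn_ge0//; exact: h.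
Qed.

Definition fam_op (a : forall i, H i -> H i) u : family :=
  insubd 0 ((fun i => a i (u i)) : dprod H).

Lemma fam_opE a N u i : (forall i, bnd (a i) N) -> fam_op a u i = a i (u i).
Proof. by move=> aN; rewrite /fam_op /fapp insubdK// in_setE; exact: (fam_summable u aN). Qed.

Lemma fam_op_adj a b N : (forall i, adjoint (a i) (b i)) ->
  (forall i, bnd (a i) N) -> (forall i, bnd (b i) N) ->
  forall u v, fdot (fam_op a u) v = fdot u (fam_op b v).
Proof.
move=> ab aN bN u v; congr ssum; apply/funext => i.
by rewrite (fam_opE _ _ aN) (fam_opE _ _ bN) ab.
Qed.

Lemma fam_op_pbnd a N : 0 <= N -> (forall i, bnd (a i) N) ->
  @pbnd _ family_pre (fam_op a) N.
Proof.
move=> N0 aN; split=> // u; rewrite (sn_le fdotH) ?mulr_ge0 ?sn_ge0// exprMn (sqr_sn fdotH).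
have d1 := fdot_dom (fam_op a u) (fam_op a u); have d2 := fdot_dom u u.
have d3 : sdom M (fun i => normc ((N ^+ 2)%:C * hdot (H i) (u i) (u i))).
  apply: (sdomS (c := normc (N ^+ 2)%:C) d2) => i.
  by rewrite normc_ge0 normcM lexx.
have hi i : 0 <= (N ^+ 2)%:C * hdot (H i) (u i) (u i)
    - hdot (H i) (fam_op a u i) (fam_op a u i).
  rewrite (fam_opE _ _ aN) !hdot_sqr -rmorphM -rmorphB ler0c subr_ge0 -exprMn.
  have [_ h] := aN i; rewrite ler_pXn2r ?nnegrE ?mulr_ge0 ?hn_ge0//; exact: h.
have /ge0C[+ _] := ssum_mono d1 d3 hi.
have d0 : sdom M (fun i => normc (0 : C)) by rewrite normc0; exact: sdom0.
rewrite [X in X - _](_ : _ = (N ^+ 2)%:C * fdot u u); last first.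
  have := ssumL (N ^+ 2)%:C d2 d0.
  have -> : ssum M (fun=> 0) = 0.
    have := ssumL 1 d0 d0; rewrite mul1r addr0 mul1r.
    by rewrite -[X in X = _]addr0 => /addrI.
  by rewrite addr0 => <-; congr ssum; apply/funext => i; rewrite addr0.
by rewrite !CE /= mul0r subr0 subr_ge0.
Qed.

End Family.

Lemma emb_ext (R : realType) (P : prehilbert R) (f g : completion_hilbert P -> completion_hilbert P) M N :
  linear f -> linear g -> bnd f M -> bnd g N ->
  (forall v, f (emb v) = g (emb v)) -> f = g.
Proof.
move=> lf lg [M0 fM] [N0 gN] h; apply/funext => x.
have hs := hdotP (completion_hilbert P).
apply/eqP; rewrite -subr_eq0; apply/eqP; apply: (@hn_small0 _ _ _ (M + N)) => e e0.
have [v hv] := hn_emb_dense x e0.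
have -> : f x - g x = f (x - emb v) - g (x - emb v).
  by rewrite (linB lf) (linB lg) h opprB subrKA.
apply: le_trans (snB hs _ _) _.
have := fM (x - emb v); have := gN (x - emb v); rewrite /hn in hv *.
have := ler_wpM2l M0 hv; have := ler_wpM2l N0 hv.
by rewrite mulrDl; lra.
Qed.

Section FamilyRep.
Variable R : realType.
Local Notation C := R[i].
Variables (I : Type) (M : summation R I) (D : I -> cstar R).
Let H i := os_hilb (D i).
Local Notation P := (family_pre M H).
Local Notation K := (family_hilbert M H).
Implicit Types d : forall i, D i.

Definition ubd d := exists2 N, 0 <= N & forall i, bnd (d i) N.

Definition pop (a : forall i, H i -> H i) : P -> P := fam_op (M := M) a.

Lemma ubd_star d : ubd d -> ubd (fun i => os_star (d i)).
Proof.
by move=> [N N0 h]; exists N => // i; apply: bnd_adjoint (h i); exact: os_starP.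
Qed.

Definition fam_ext d : K -> K := ext (pop (fun i => os_val (os_star (d i)))).

Section Bounded.
Variables (d : forall i, D i) (N : R).
Hypotheses (N0 : 0 <= N) (dN : forall i, bnd (d i) N).

Lemma star_bnd i : bnd (os_star (d i)) N.
Proof. by apply: bnd_adjoint (dN i); exact: os_starP. Qed.

Let adj v w : @ps _ P (pop (fun i => os_val (d i)) v) w =
  @ps _ P v (pop (fun i => os_val (os_star (d i))) w).
Proof. by apply: (@fam_op_adj _ _ _ _ _ _ N) => // i; [exact: os_starP|exact: star_bnd]. Qed.

Let b1 := @fam_op_pbnd _ _ M _ _ _ N0 dN.
Let b2 := @fam_op_pbnd _ _ M _ _ _ N0 star_bnd.

Lemma fam_ext_emb (v : P) : fam_ext d (emb v) = emb (pop (fun i => os_val (d i)) v).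
Proof. exact: ext_emb adj b2 _. Qed.

Lemma fam_ext_lin : linear (fam_ext d).
Proof. exact: ext_lin adj b2. Qed.

Lemma fam_ext_bnd : bnd (fam_ext d) N.
Proof. exact: ext_bnd adj b2. Qed.

Lemma fam_ext_adj : adjoint (fam_ext d) (fam_ext (fun i => os_star (d i))).
Proof.
have -> : fam_ext (fun i => os_star (d i)) = ext (pop (fun i => os_val (d i))).
  rewrite /fam_ext; congr (ext (pop _)); apply: functional_extensionality_dep => i.
  by rewrite os_starK.
exact: ext_adj adj b1 b2.
Qed.

Lemma fam_ext_adjointable : adjointable (fam_ext d).
Proof.
split; first by apply/bounded_opE; split; [exact: fam_ext_lin|exists N; exact: fam_ext_bnd].
exists (fam_ext (fun i => os_star (d i))); last exact: fam_ext_adj.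
apply/bounded_opE; split; first exact: adjoint_linear fam_ext_adj.
by exists N; exact: bnd_adjoint fam_ext_adj fam_ext_bnd.
Qed.
End Bounded.

Lemma ubd_adjointable d : ubd d -> adjointable (fam_ext d).
Proof. by case=> N N0 h; exact: fam_ext_adjointable N0 h. Qed.

(** The operator acting as [d i] in the component [i], with value 0 when the
norms of the [d i] are not bounded. *)
Definition fam_rep d : BH K :=
  if pselect (ubd d) is left h then
    @os_mk R (BH K) (fam_ext d)
      (op_closure_sub (star_subalgebra_adjointable K) (ubd_adjointable h))
  else 0.

Section RepTheory.
Implicit Types u : P.

Lemma fam_repE d : ubd d -> os_val (fam_rep d) = fam_ext d.
Proof. by rewrite /fam_rep; case: pselect. Qed.

Lemma fam_rep_emb d u : ubd d -> fam_rep d (emb u) = emb (pop (fun i => os_val (d i)) u).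
Proof. by move=> h; rewrite fam_repE//; case: h => N N0 h; exact: fam_ext_emb N0 h _. Qed.

Lemma fam_rep_bnd d N : 0 <= N -> (forall i, bnd (d i) N) -> bnd (fam_rep d) N.
Proof.
move=> N0 h; rewrite fam_repE; last by exists N.
exact: fam_ext_bnd.
Qed.

Lemma popE d u i : ubd d -> fapp (pop (fun i => os_val (d i)) u) i = d i (fapp u i).
Proof. by move=> [N _ h]; exact: (@fam_opE _ _ _ _ (fun i => os_val (d i)) N). Qed.

Lemma fam_rep_ext d (x : BH K) : ubd d ->
  (forall u, x (emb u) = emb (pop (fun i => os_val (d i)) u)) -> fam_rep d = x.
Proof.
move=> h e; apply: val_inj; have [N N0 hN] := h; have [N' hN'] := os_bnd x.
apply: (@emb_ext R P (os_val (fam_rep d)) (os_val x) N N' (os_linear (fam_rep d))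
  (os_linear x) (fam_rep_bnd N0 hN) hN') => u.
by rewrite [RHS]e; exact: fam_rep_emb.
Qed.

Lemma fam_rep_lin a d d' : ubd d -> ubd d' ->
  fam_rep (fun i => a *: d i + d' i) = a *: fam_rep d + fam_rep d'.
Proof.
move=> h h'; have h2 : ubd (fun i => a *: d i + d' i).
  have [N N0 hN] := h; have [N' N0' hN'] := h'; exists (normc a * N + N').
    by rewrite addr_ge0// mulr_ge0// normc_ge0.
  by move=> i; apply: bndD => //; apply: bndZ.
apply: fam_rep_ext => // u; rewrite os_valL !fam_rep_emb// -emb_lin; congr emb.
by apply: family_eq => i; rewrite popE// os_valL -!popE.
Qed.

Lemma fam_rep_mul d d' : ubd d -> ubd d' ->
  fam_rep (fun i => cs_mul (d i) (d' i)) = cs_mul (fam_rep d) (fam_rep d').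
Proof.
move=> h h'; have h2 : ubd (fun i => cs_mul (d i) (d' i)).
  have [N N0 hN] := h; have [N' N0' hN'] := h'; exists (N * N'); first exact: mulr_ge0.
  by move=> i; apply: bnd_comp.
apply: fam_rep_ext => // u; rewrite cs_mulE !fam_rep_emb//; congr emb.
by apply: family_eq => i; rewrite !popE.
Qed.

Lemma fam_rep1 : fam_rep (fun i => os_one (D i)) = os_one (BH K).
Proof.
have h : ubd (fun i => os_one (D i)) by exists 1 => // i; exact: bnd_id.
by apply: fam_rep_ext => // u; congr emb; apply: family_eq => i; rewrite popE.
Qed.

Lemma fam_rep_star d : ubd d -> fam_rep (fun i => os_star (d i)) = os_star (fam_rep d).
Proof.
move=> h; apply/esym/os_starE; rewrite !fam_repE//; last exact: ubd_star.
by case: h => N N0 h; exact: fam_ext_adj N0 h.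
Qed.

Lemma fam_rep_hdot d (u v : P) : ubd d ->
  hdot K (fam_rep d (emb u)) (emb v) = ssum M (fun i => hdot (H i) (d i (fapp u i)) (fapp v i)).
Proof.
move=> h; rewrite fam_rep_emb// hdot_emb; congr ssum; apply/funext => i.
by rewrite popE.
Qed.
End RepTheory.
End FamilyRep.

Section Ultra.
Variable R : realType.
Local Notation C := R[i].
Local Notation U := free_ultra.
#[local] Existing Instance free_ultraP.

Definition bounded_dom : set (nat -> R) := fun f => exists M, forall n, `|f n| <= M.

Lemma bounded_dom_ub (z : nat -> C) : bounded_dom (fun n => normc (z n)) -> ubounded z.
Proof.
move=> [M hM]; exists M; apply: (@free_ultra_tail _ 0) => n _ /=.
by have := hM n; rewrite ger0_norm ?normc_ge0.
Qed.

Lemma bounded_dom0 : bounded_dom (fun=> 0).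
Proof. by exists 0 => n; rewrite normr0. Qed.
Lemma bounded_domD f g : bounded_dom f -> bounded_dom g -> bounded_dom (fun i => f i + g i).
Proof.
by move=> [M h] [N k]; exists (M + N) => n; apply: le_trans (ler_normD _ _) (lerD _ _).
Qed.
Lemma bounded_domS f g c : bounded_dom g -> (forall i, 0 <= f i <= c * g i) -> bounded_dom f.
Proof.
move=> [M h] k; exists (`|c| * M) => n; have /andP[k0 k1] := k n.
rewrite ger0_norm//; apply: le_trans k1 _; apply: le_trans (ler_norm _) _.
by rewrite normrM ler_wpM2l.
Qed.
Lemma clim_lin a z w : bounded_dom (fun i => normc (z i)) -> bounded_dom (fun i => normc (w i)) ->
  clim (fun i => a * z i + w i) = a * clim z + clim w :> C.
Proof.
move=> /bounded_dom_ub hz /bounded_dom_ub hw; rewrite climD ?climZ//.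
have [M hM] := hz; exists (normc a * M); apply: filterS hM => n /= h.
by rewrite normcM ler_wpM2l ?normc_ge0.
Qed.

Definition ultra_sum : summation R nat.
Proof.
refine (@Summation R nat bounded_dom (@clim R) bounded_dom0 bounded_domD bounded_domS
  clim_lin _ _).
- by move=> z /bounded_dom_ub; exact: climJ.
- move=> z /bounded_dom_ub h k; apply: clim_ge0 => //.
  by apply: (@free_ultra_tail _ 0) => n _ /=; exact: k.
Defined.
End Ultra.

Section FiniteSum.
Variables (R : realType) (I : choiceType).
Local Notation C := R[i].

Definition finite_dom : set (I -> R) := fun f => exists r : seq I, forall i, i \notin r -> f i = 0.
Definition fsum (z : I -> C) : C := \sum_(i \in [set: I]) z i.

Lemma fsumE (z : I -> C) (r : seq I) : uniq r -> (forall i, i \notin r -> z i = 0) ->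
  fsum z = \sum_(i <- r) z i.
Proof.
move=> ur hr; rewrite /fsum (bigfs _ ur (P := xpredT)) => [|i _]; last exact: hr.
suff -> : [set` xpredT] = [set: I] by [].
by apply/seteqP; split.
Qed.

Lemma finite_domP (z : I -> C) : finite_dom (fun i => normc (z i)) ->
  exists2 r : seq I, uniq r & forall i, i \notin r -> z i = 0.
Proof.
move=> [r hr]; exists (undup r); first exact: undup_uniq.
by move=> i; rewrite mem_undup => /hr/eq0_normc.
Qed.

Lemma finite_dom0 : finite_dom (fun=> 0). Proof. by exists [::]. Qed.
Lemma finite_domD f g : finite_dom f -> finite_dom g -> finite_dom (fun i => f i + g i).
Proof.
move=> [r h] [s k]; exists (r ++ s) => i; rewrite mem_cat negb_or => /andP[/h -> /k ->].
by rewrite addr0.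
Qed.
Lemma finite_domS f g c : finite_dom g -> (forall i, 0 <= f i <= c * g i) -> finite_dom f.
Proof.
move=> [r h] k; exists r => i /h e; have := k i; rewrite e mulr0 -eq_le => /eqP <- //.
Qed.
Lemma fsum_lin a z w : finite_dom (fun i => normc (z i)) -> finite_dom (fun i => normc (w i)) ->
  fsum (fun i => a * z i + w i) = a * fsum z + fsum w.
Proof.
move=> /finite_domP[r ur hr] /finite_domP[s us hs]; pose t := undup (r ++ s).
have ut : uniq t by exact: undup_uniq.
have hz i : i \notin t -> z i = 0.
  by rewrite mem_undup mem_cat negb_or => /andP[/hr].
have hw i : i \notin t -> w i = 0.
  by rewrite mem_undup mem_cat negb_or => /andP[_ /hs].
rewrite (fsumE ut) => [|i it]; last by rewrite hz// hw// mulr0 addr0.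
by rewrite (fsumE ut hz) (fsumE ut hw) mulr_sumr -big_split.
Qed.

Definition finite_sum : summation R I.
Proof.
refine (@Summation R I finite_dom fsum finite_dom0 finite_domD finite_domS
  fsum_lin _ _).
- move=> z /finite_domP[r ur hr]; rewrite (fsumE ur hr) (fsumE ur).
    by rewrite rmorph_sum.
  by move=> i /hr ->; rewrite rmorph0.
- by move=> z /finite_domP[r ur hr] h; rewrite (fsumE ur hr); apply: sumr_ge0.
Defined.

Lemma fsum_delta (z : I -> C) j : (forall i, i != j -> z i = 0) -> fsum z = z j.
Proof.
move=> h; rewrite (@fsumE _ [:: j])// ?big_seq1// => i.
by rewrite inE => /h.
Qed.
End FiniteSum.

(** * Tensor products of Hilbert spaces and the spatial representation *)

Section Schur.
Variable R : realType.
Local Notation C := R[i].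
Variables (V W : lmodType C).
Implicit Types (s : V -> V -> C) (t : W -> W -> C) (l m : seq (V * W)).

Definition hprod s t l m : C :=
  \sum_(p <- l) \sum_(q <- m) s p.1 q.1 * t p.2 q.2.

(** The Schur product theorem, by Gram-Schmidt in the second factor. Let [(h,
k)] be the first pair. If [t k k > 0], each second component is the sum of a
multiple of [k] and a vector orthogonal to [k]: the multiples of [k] contribute
[t k k] times a square, and the orthogonal parts form a shorter list. If [t k k
= 0] then [(h, k)] contributes nothing. *)
Lemma hprod_ge0 s t l : hform s -> hform t -> 0 <= hprod s t l l.
Proof.
move=> hs ht; have [n] := ubnP (size l); elim: n l => // n IH [_|[h k] l].
  by rewrite /hprod big_nil.
rewrite ltnS /= => ln.
have [b0|b0] := eqVneq (t k k) 0.
  have t0 y : t k y = 0.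
    apply: eq0_normc; apply/eqP; rewrite eq_le normc_ge0 andbT.
    by apply: le_trans (hf_CS ht _ _) _; rewrite /sn b0 sqrtr0 mul0r.
  have t0' y : t y k = 0 by rewrite (hfC ht) t0 rmorph0.
  rewrite /hprod big_cons big1 ?add0r => [|p _]; last by rewrite t0 mulr0.
  rewrite (eq_bigr (fun p => \sum_(q <- l) s p.1 q.1 * t p.2 q.2)); first exact: IH.
  by move=> p _; rewrite big_cons t0' mulr0 add0r.
pose c (p : V * W) := t p.2 k / t k k.
pose l' := [seq (p.1, p.2 - c p *: k) | p <- (h, k) :: l].
have bJ : (t k k)^* = t k k by rewrite -(hfC ht).
have key p q : t p.2 q.2 = t (p.2 - c p *: k) (q.2 - c q *: k) + c p * (c q)^* * t k k.
  rewrite !(hfB ht, hfBr ht, hfZ ht, hfZr ht) /c fmorph_div /= bJ.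
  by rewrite (hfC ht q.2 k); field.
have -> : hprod s t ((h, k) :: l) ((h, k) :: l) =
   hprod s t l' l' + t k k * s (\sum_(p <- (h, k) :: l) c p *: p.1)
                               (\sum_(p <- (h, k) :: l) c p *: p.1).
  rewrite (hf_suml hs) mulr_sumr [X in X + _]/hprod big_map -big_split /=.
  apply: eq_bigr => p _; rewrite big_map (hf_sumr hs) mulr_sumr -big_split /=.
  apply: eq_bigr => q _; rewrite {1}key (hfZ hs) (hfZr hs); ring.
apply: addr_ge0; last by rewrite mulr_ge0 ?hf_ge0.
have -> : hprod s t l' l' = hprod s t (behead l') (behead l').
  have k0 : k - c (h, k) *: k = 0 by rewrite /c divff// scale1r subrr.
  rewrite /l' /= k0 /hprod big_cons big1 ?add0r => [|p _]; last first.
    by rewrite (hf0 ht) mulr0.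
  by apply: eq_bigr => p _; rewrite big_cons (hf0r ht) mulr0 add0r.
by apply: IH; rewrite /= size_map.
Qed.

Definition tform s t (u v : tens V W) : C := hprod s t (repr u) (repr v).

Section Tform.
Variables (s : V -> V -> C) (t : W -> W -> C).
Hypotheses (hs : hform s) (ht : hform t).

Let tb v w : is_bilinear (fun x y => s x v * t y w : C^o).
Proof.
split=> [y a x z|x a y z]; rewrite ?(hfP hs) ?(hfP ht).
  by rewrite mulrDl -mulrA.
by rewrite mulrDr mulrCA.
Qed.

Lemma tform_liftl u v : tform s t u v =
  \sum_(q <- repr v) tens_lift (fun x y => s x q.1 * t y q.2 : C^o) u.
Proof. by rewrite /tform /hprod exchange_big. Qed.

Lemma tformC u v : tform s t v u = (tform s t u v)^*.
Proof.
rewrite /tform /hprod rmorph_sum exchange_big; apply: eq_bigr => p _.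
rewrite rmorph_sum; apply: eq_bigr => q _.
by rewrite rmorphM /= -(hfC hs) -(hfC ht).
Qed.

Lemma tformP a u v w : tform s t (a *: u + v) w = a * tform s t u w + tform s t v w.
Proof.
rewrite !tform_liftl mulr_sumr -big_split; apply: eq_bigr => q _.
by rewrite (tens_lift_linear (tb q.1 q.2)).
Qed.

Lemma tformH : hform (tform s t).
Proof.
split; [exact: tformP | by move=> u v; exact: tformC|].
by move=> u; exact: hprod_ge0.
Qed.

Lemma tform_pure v w v' w' :
  tform s t (tens_pure v w) (tens_pure v' w') = s v v' * t w w'.
Proof.
rewrite tform_liftl (eq_bigr (fun q => (s q.1 v * t q.2 w)^*)) => [|q _].
  rewrite -rmorph_sum -(@tens_lift_sum _ _ _ _ (fun x y => s x v * t y w : C^o)).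
  by rewrite tens_lift_pure// rmorphM /= -(hfC hs) -(hfC ht).
by rewrite tens_lift_pure// rmorphM /= -(hfC hs) -(hfC ht).
Qed.

End Tform.
End Schur.

Lemma conjC_rc (R : realType) (a : R) : (a%:C)^* = a%:C.
Proof. by rewrite conjCE /= oppr0. Qed.

Section TensorOperators.
Variable R : realType.
Local Notation C := R[i].
Variables H K : hilbert R.
Let hH := hdotP H.
Let hK := hdotP K.

Definition tensor_pre : prehilbert R := PreHilbert (tformH hH hK).
Definition tensor_hilbert := completion_hilbert tensor_pre.
Local Notation T := (tens H K).
Local Notation s := (tform (hdot H) (hdot K)).

Implicit Types (f : H -> H) (g : K -> K).

Lemma tens_map_adj f f' g g' : linear f -> linear f' -> linear g -> linear g' ->
  adjoint f f' -> adjoint g g' ->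
  forall u v : T, s (tens_map f g u) v = s u (tens_map f' g' v).
Proof.
move=> lf lf' lg lg' ff gg u v.
rewrite [u]tens_sumE [v]tens_sumE (lin_sum (tens_map_linear lf lg)).
rewrite (lin_sum (tens_map_linear lf' lg')).
have hT := tformH hH hK.
rewrite !(hf_suml hT); apply: eq_bigr => p _.
rewrite !(hf_sumr hT); apply: eq_bigr => q _.
by rewrite !tens_map_pure// !tform_pure// ff gg.
Qed.

(** Tensoring this positive form with an inner product bounds the norm of [h (x)
1] by [M]. *)
Lemma defect_form (X : hilbert R) (h : X -> X) M : linear h -> bnd h M ->
  hform (fun x y => (M ^+ 2)%:C * hdot X x y - hdot X (h x) (h y)).
Proof.
move=> lh [M0 hM]; have hX := hdotP X; split=> [a x y z|x y|x].
- by rewrite lh !(hfP hX); ring.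
- have := conjC_rc (M ^+ 2); move: ((M ^+ 2)%:C) => m mJ.
  by rewrite rmorphB rmorphM /= mJ -!(hfC hX).
- rewrite !hdot_sqr -rmorphM -rmorphB ler0c subr_ge0 -exprMn.
  by rewrite ler_pXn2r ?nnegrE ?mulr_ge0 ?hn_ge0.
Qed.

Lemma tens_map_bnd f g M N : linear f -> linear g -> bnd f M -> bnd g N ->
  @pbnd _ tensor_pre (tens_map f g) (M * N).
Proof.
move=> lf lg fM gN; have [M0 _] := fM; have [N0 _] := gN.
have hT := tformH hH hK; split=> [|u]; first exact: mulr_ge0.
have lid (Y : lmodType C) : linear (id : Y -> Y) by [].
have sq (x : T) : Re (s x x) = sn s x ^+ 2 by rewrite (sqr_sn hT).
have key1 (x : T) : sn s (tens_map f id x) <= M * sn s x.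
  rewrite (sn_le hT) ?mulr_ge0 ?sn_ge0// exprMn -sq.
  have /ge0C[+ _] := hprod_ge0 (repr x) (defect_form lf fM) hK.
  rewrite (_ : hprod _ _ _ _ = (M ^+ 2)%:C * s x x - s (tens_map f id x) (tens_map f id x)).
    by rewrite !CE /= mul0r subr0 subr_ge0.
  move: (tens_sumE x); move: (repr x) => l ->.
  rewrite (lin_sum (tens_map_linear lf (lid K))).
  rewrite !(hf_suml hT) mulr_sumr -sumrB; apply: eq_bigr => p _.
  rewrite !(hf_sumr hT) mulr_sumr -sumrB; apply: eq_bigr => q _.
  by rewrite !tens_map_pure// !tform_pure//; ring.
have key2 (x : T) : sn s (tens_map id g x) <= N * sn s x.
  rewrite (sn_le hT) ?mulr_ge0 ?sn_ge0// exprMn -sq.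
  have /ge0C[+ _] := hprod_ge0 (repr x) hH (defect_form lg gN).
  rewrite (_ : hprod _ _ _ _ = (N ^+ 2)%:C * s x x - s (tens_map id g x) (tens_map id g x)).
    by rewrite !CE /= mul0r subr0 subr_ge0.
  move: (tens_sumE x); move: (repr x) => l ->.
  rewrite (lin_sum (tens_map_linear (lid H) lg)).
  rewrite !(hf_suml hT) mulr_sumr -sumrB; apply: eq_bigr => p _.
  rewrite !(hf_sumr hT) mulr_sumr -sumrB; apply: eq_bigr => q _.
  by rewrite !tens_map_pure// !tform_pure//; ring.
have -> : tens_map f g u = tens_map f id (tens_map id g u).
  move: u; apply: tens_lin_ext; first exact: tens_map_linear.
    by apply: (lin_comp (tens_map_linear _ _) (tens_map_linear _ _)).
  by move=> v w; rewrite !tens_map_pure.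
by apply: le_trans (key1 _) _; rewrite -mulrA ler_wpM2l.
Qed.
End TensorOperators.

Section CompletionBH.
Variables (R : realType) (P : prehilbert R).
Local Notation C := R[i].
Local Notation B := (BH (completion_hilbert P)).

Lemma BH_ext (x y : B) : (forall v, x (emb v : completion P) = y (emb v : completion P)) -> x = y.
Proof.
move=> h; apply: val_inj; have [M hM] := os_bnd x; have [N hN] := os_bnd y.
exact: (@emb_ext R P (os_val x) (os_val y) M N (os_linear x) (os_linear y) hM hN h).
Qed.

Definition adj_pair (a b : P -> P) := (forall v w, ps (a v) w = ps v (b w)) /\
  exists M, pbnd a M /\ pbnd b M.

Lemma adj_pair_sym a b : adj_pair a b -> adj_pair b a.
Proof.
move=> [ab [M [h k]]]; split; last by exists M.
by move=> v w; rewrite (hfC (psP P)) -ab -(hfC (psP P)).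
Qed.

Lemma ext_adjointable a b : adj_pair a b -> adjointable (ext b).
Proof.
move=> [ab [M [h k]]]; split.
  by apply/bounded_opE; split; [exact: ext_lin ab k|exists M; exact: ext_bnd ab k].
have ea := ext_adj ab h k; exists (ext a) => //.
apply/bounded_opE; split; first exact: adjoint_linear ea.
by exists M; exact: bnd_adjoint ea (ext_bnd ab k).
Qed.

Definition bh_ext (a b : P -> P) : B :=
  if pselect (adj_pair a b) is left h then
    @os_mk R B (ext b)
      (op_closure_sub (star_subalgebra_adjointable (completion_hilbert P)) (ext_adjointable h))
  else 0.

Lemma bh_extE a b : adj_pair a b -> os_val (bh_ext a b) = ext b.
Proof. by rewrite /bh_ext; case: pselect. Qed.

Lemma bh_ext_emb a b (v : P) : adj_pair a b ->
  bh_ext a b (emb v : completion P) = (emb (a v) : completion P).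
Proof. by move=> h; rewrite bh_extE//; case: h => ab [M [h k]]; exact: ext_emb ab k _. Qed.

Lemma bh_ext_star a b : adj_pair a b -> os_star (bh_ext a b) = bh_ext b a.
Proof.
move=> h; apply: os_starE; rewrite !bh_extE//; last exact: adj_pair_sym.
by case: h => ab [M [h k]]; exact: ext_adj ab h k.
Qed.
End CompletionBH.

Section Spatial.
Variables (R : realType) (A B : cstar R).
Local Notation C := R[i].
Local Notation H := (os_hilb A).
Local Notation K := (os_hilb B).
Local Notation P := (tensor_pre H K).
Local Notation D := (BH (tensor_hilbert H K)).

Definition spat_op (a : A) (b : B) : P -> P := tens_map (os_val a) (os_val b).

Lemma spat_pair a b : adj_pair (spat_op a b) (spat_op (os_star a) (os_star b)).
Proof.
split; first by move=> v w; apply: tens_map_adj; exact: os_linear || exact: os_starP.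
have [M aM] := os_bnd a; have [N bN] := os_bnd b; exists (M * N).
split; apply: tens_map_bnd => //; try exact: os_linear.
  exact: bnd_adjoint (os_starP a) aM.
exact: bnd_adjoint (os_starP b) bN.
Qed.

Definition spat_pure a b : D := bh_ext (spat_op a b) (spat_op (os_star a) (os_star b)).

Lemma spat_pure_emb a b (v : P) :
  spat_pure a b (emb v : completion P) = (emb (spat_op a b v) : completion P).
Proof. exact: bh_ext_emb (spat_pair a b). Qed.

Lemma spat_op_pure a b h k : spat_op a b (tens_pure h k) = tens_pure (a h) (b k).
Proof. exact: tens_map_pure (os_linear a) (os_linear b) _ _. Qed.

Lemma spat_op_linear a b : linear (spat_op a b).
Proof. exact: tens_map_linear (os_linear a) (os_linear b). Qed.

Lemma spat_bilinear : is_bilinear spat_pure.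
Proof.
split=> [b c x y|a c x y]; apply: BH_ext => v; rewrite os_valL !spat_pure_emb -emb_lin;
  congr emb; move: v; apply: tens_lin_ext; try exact: spat_op_linear.
- by apply: linear_fct_lin; exact: spat_op_linear.
- by move=> h k; rewrite !spat_op_pure os_valL (tens_pure_bilinear _ _).1.
- by apply: linear_fct_lin; exact: spat_op_linear.
- by move=> h k; rewrite !spat_op_pure os_valL (tens_pure_bilinear _ _).2.
Qed.

(** The spatial representation, on the tensor product of the Hilbert spaces. *)
Definition spat : tens A B -> D := tens_lift spat_pure.

Lemma spat_purE a b : spat (tens_pure a b) = spat_pure a b.
Proof. exact: tens_lift_pure spat_bilinear. Qed.

Lemma spat_star_hom : tens_star_hom spat.
Proof.
split; first exact: tens_lift_linear spat_bilinear.
- rewrite spat_purE; apply: BH_ext => v; rewrite spat_pure_emb os_val1; congr emb.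
  move: v; apply: tens_lin_ext; [exact: spat_op_linear|by []|].
  by move=> h k; rewrite spat_op_pure.
- move=> a a' b b'; rewrite !spat_purE; apply: BH_ext => v.
  rewrite cs_mulE !spat_pure_emb; congr emb.
  move: v; apply: tens_lin_ext; [exact: spat_op_linear| |].
    by apply: (lin_comp (spat_op_linear _ _) (spat_op_linear _ _)).
  by move=> h k; rewrite !spat_op_pure.
- move=> a b; rewrite !spat_purE /spat_pure bh_ext_star; last exact: spat_pair.
  by rewrite !os_starK.
Qed.

Lemma spat_hdot u h k h' k' :
  hdot (tensor_hilbert H K) (spat u (emb (tens_pure h k : P) : completion P))
                            (emb (tens_pure h' k' : P) : completion P) =
  tens_lift (fun (a : A) (b : B) => hdot H (a h) h' * hdot K (b k) k' : C^o) u.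
Proof.
rewrite /spat !tens_lift_sum.
pose F (x : D) : C := hdot (tensor_hilbert H K) (x (emb (tens_pure h k : P) : completion P))
                            (emb (tens_pure h' k' : P) : completion P).
have FD x y : F (x + y) = F x + F y by rewrite /F os_valD (hfD (hdotP _)).
have F0 : F 0 = 0 by rewrite /F os_val0 (hf0 (hdotP _)).
rewrite -/(F _) (big_morph F FD F0); apply: eq_bigr => p _.
rewrite /F spat_pure_emb hdot_emb spat_op_pure.
exact: tform_pure (hdotP H) (hdotP K) _ _ _ _.
Qed.
End Spatial.

(** * The maximal tensor product *)

Section TensorReps.
Variables (R : realType) (A B : cstar R).
Local Notation C := R[i].
Local Notation T := (tens A B).

Section OneRep.
Variables (D : cstar R) (p : T -> D).
Hypothesis hp : tens_star_hom p.

Lemma rep_left : star_hom (fun a : A => p (tens_pure a (os_one B))).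
Proof.
case: hp => lp p1 pM pS; split=> //.
- by move=> c x y; rewrite (tens_pure_bilinear _ _).1 lp.
- by move=> x y; rewrite -pM cs_mul1.
- by move=> x; rewrite -pS os_star1.
Qed.

Lemma rep_right : star_hom (fun b : B => p (tens_pure (os_one A) b)).
Proof.
case: hp => lp p1 pM pS; split=> //.
- by move=> c x y; rewrite (tens_pure_bilinear _ _).2 lp.
- by move=> x y; rewrite -pM cs_mul1.
- by move=> x; rewrite -pS os_star1.
Qed.

(** An elementary tensor is sent to the product of its images under two
*-homomorphisms, which are contractive. *)
Lemma rep_pure_bnd (a : A) (b : B) M N : bnd a M -> bnd b N -> bnd (p (tens_pure a b)) (M * N).
Proof.
case: (hp) => lp p1 pM pS aM bN.
have -> : p (tens_pure a b) = cs_mul (p (tens_pure a (os_one B))) (p (tens_pure (os_one A) b)).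
  by rewrite -pM cs_mul1 cs_1mul.
by apply: bnd_comp; [exact: (star_hom_bnd rep_left aM)|exact: (star_hom_bnd rep_right bN)].
Qed.
End OneRep.

Lemma rep_bound (x : T) : exists2 N, 0 <= N &
  forall (D : cstar R) (p : T -> D), tens_star_hom p -> bnd (p x) N.
Proof.
move: x; apply: tens_ind.
- by exists 0 => // D p [lp _ _ _]; rewrite (lin0 lp); exact: bnd0.
- move=> u v [M M0 h] [N N0 k]; exists (M + N) => [|D p hp]; first exact: addr_ge0.
  case: (hp) => lp _ _ _; rewrite (linD lp).
  by apply: bndD; [exact: h|exact: k].
- move=> a b; have [M aM] := os_bnd a; have [N bN] := os_bnd b.
  exists (M * N) => [|D p hp]; last exact: rep_pure_bnd.
  by have [M0 _] := aM; have [N0 _] := bN; exact: mulr_ge0.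
Qed.

(** The algebraic tensor product carries no multiplication here; this is the
product of [x] and [y] as seen by all representations. *)
Lemma rep_mul (x y : T) : exists z, forall (D : cstar R) (p : T -> D), tens_star_hom p ->
  p z = cs_mul (p x) (p y).
Proof.
have mulDl (D : cstar R) (a b c : D) : cs_mul (a + b) c = cs_mul a c + cs_mul b c.
  exact: os_eq.
have mulDr (D : cstar R) (a b c : D) : cs_mul a (b + c) = cs_mul a b + cs_mul a c.
  by apply: os_eq => h; rewrite cs_mulE !os_valD (linD (os_linear a)).
move: x; apply: tens_ind.
- by exists 0 => D p [lp _ _ _]; rewrite (lin0 lp); apply: os_eq.
- move=> u v [z hz] [w hw]; exists (z + w) => D p hp.
  by case: (hp) => lp _ _ _; rewrite !(linD lp) mulDl hz// hw.
move=> a b; move: y; apply: tens_ind.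
- exists 0 => D p [lp _ _ _]; rewrite (lin0 lp); apply: os_eq => h.
  by rewrite cs_mulE os_val0 (lin0 (os_linear _)).
- move=> u v [z hz] [w hw]; exists (z + w) => D p hp.
  by case: (hp) => lp _ _ _; rewrite !(linD lp) mulDr hz// hw.
move=> a' b'; exists (tens_pure (cs_mul a a') (cs_mul b b')) => D p [_ _ pM _].
exact: pM.
Qed.

Lemma rep_star (x : T) : exists z, forall (D : cstar R) (p : T -> D), tens_star_hom p ->
  p z = os_star (p x).
Proof.
move: x; apply: tens_ind.
- by exists 0 => D p [lp _ _ _]; rewrite (lin0 lp) os_star0.
- move=> u v [z hz] [w hw]; exists (z + w) => D p hp.
  by case: (hp) => lp _ _ _; rewrite !(linD lp) os_starD hz// hw.
move=> a b; exists (tens_pure (os_star a) (os_star b)) => D p [_ _ _ pS].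
exact: pS.
Qed.

Record tensor_rep := TensorRep {
  tr_alg : cstar R;
  tr_map :> T -> tr_alg;
  tr_hom : tens_star_hom tr_map }.

(** A norm bound or a matrix positivity, which a representation may violate. *)
Definition test : Type := ((T * C) + {n : nat & 'M[T]_n})%type.
HB.instance Definition _ := gen_eqMixin test.
HB.instance Definition _ := gen_choiceMixin test.

Definition violates (j : test) (r : tensor_rep) : Prop :=
  match j with
  | inl xc => ~ opnorm_le (r xc.1) xc.2
  | inr X => ~ os_pos (map_mx r (tagged X))
  end.

(** If no representation fails the test, any representation will do, for
instance the spatial one. *)
Lemma worst_ex j : exists r : tensor_rep, forall r', violates j r' -> violates j r.
Proof.
have [[r hr]|h] := pselect (exists r, violates j r); first by exists r.
by exists (TensorRep (spat_star_hom A B)) => r' hr'; case: h; exists r'.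
Qed.

Definition worst j : tensor_rep := sval (cid (worst_ex j)).

Lemma worstP j r : violates j r -> violates j (worst j).
Proof. by rewrite /worst; case: cid => w /= h; exact: h. Qed.

Local Notation S := (finite_sum R test).
Local Notation D := (fun j => tr_alg (worst j)).
Local Notation H := (fun j => os_hilb (tr_alg (worst j))).
Local Notation P := (family_pre S H).

Lemma worst_ubd x : ubd (D := D) (fun j => worst j x).
Proof.
have [N N0 h] := rep_bound x; exists N => // j; exact: h (tr_hom (worst j)).
Qed.

(** The direct sum, over all tests, of a representation failing the test if
there is one. Representations are too many to be summed up, whereas the tests
form a type. *)
Definition sumrep (x : T) : BH (family_hilbert S H) := fam_rep (D := D) S (fun j => worst j x).

Lemma sumrep_hom : tens_star_hom sumrep.
Proof.
have E (x : T) d : (forall j, worst j x = d j) -> sumrep x = fam_rep (D := D) S d.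
  by move=> h; congr fam_rep; apply: functional_extensionality_dep.
split.
- move=> a x y; rewrite -(fam_rep_lin S a (worst_ubd x) (worst_ubd y)).
  by apply: E => j; case: (tr_hom (worst j)) => lp _ _ _; rewrite lp.
- by rewrite -fam_rep1; apply: E => j; case: (tr_hom (worst j)).
- move=> a a' b b'.
  rewrite -(fam_rep_mul S (worst_ubd (tens_pure a b)) (worst_ubd (tens_pure a' b'))).
  by apply: E => j; case: (tr_hom (worst j)).
- move=> a b; rewrite -(fam_rep_star S (worst_ubd (tens_pure a b))).
  by apply: E => j; case: (tr_hom (worst j)).
Qed.

Definition max_set : set (family_hilbert S H -> family_hilbert S H) :=
  range (fun x => os_val (sumrep x)).

Lemma max_set_star : star_subalgebra max_set.
Proof.
case: (sumrep_hom) => lq q1 qM qS; split.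
- by move=> _ [x _ <-]; exact: (os_adjointable (sumrep x)).
- by exists (tens_pure (os_one A) (os_one B)) => //; rewrite q1.
- by move=> a _ _ [x _ <-] [y _ <-]; exists (a *: x + y) => //; rewrite lq.
- move=> _ _ [x _ <-] [y _ <-]; have [z hz] := rep_mul x y; exists z => //.
  by rewrite (hz _ _ sumrep_hom).
- move=> _ [x _ <-]; have [z hz] := rep_star x; exists (os_val (sumrep z)); first by exists z.
  by rewrite (hz _ _ sumrep_hom); exact: (os_starP (sumrep x)).
Qed.

Definition max_tensor : cstar R := closure_cstar max_set_star.

Definition max_map (x : T) : max_tensor :=
  @os_mk R max_tensor (os_val (sumrep x))
    (op_closure_sub max_set_star (imageP (fun x => os_val (sumrep x)) (I : setT x))).

Lemma max_map_hom : tens_star_hom max_map.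
Proof.
case: (sumrep_hom) => lq q1 qM qS; split.
- by move=> a x y; apply: val_inj; rewrite /= lq.
- by apply: val_inj; rewrite /= q1.
- by move=> a a' b b'; apply: val_inj; rewrite /= qM.
- move=> a b; apply/esym/os_starE; rewrite /= qS; exact: (os_starP (sumrep _)).
Qed.

Definition single_val j (h : H j) : dprod H := fun i =>
  if pselect (j = i) is left e then ecast i (H i) e h else 0.

Lemma single_valE j h : @single_val j h j = h.
Proof. by rewrite /single_val; case: pselect => // e; rewrite (eq_irrelevance e erefl). Qed.

Lemma single_val0 j h i : i != j -> @single_val j h i = 0.
Proof. by move=> ij; rewrite /single_val; case: pselect => // e; rewrite e eqxx in ij. Qed.

Lemma single_summable j h : summable S (@single_val j h).
Proof.
exists [:: j] => i; rewrite inE => ij.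
by rewrite single_val0// /hn (sn0 (hdotP _)) expr0n.
Qed.

Definition single j (h : H j) : P := fmk (@single_summable j h).

Lemma sumrep_single x j (h k : H j) :
  hdot _ (max_map x (emb (single h) : completion P)) (emb (single k) : completion P) =
  hdot _ (worst j x h) k.
Proof.
rewrite [LHS](fam_rep_hdot _ _ (worst_ubd x)) [LHS](@fsum_delta _ _ _ j).
  by rewrite /fapp /= !single_valE.
by move=> i ij; rewrite /fapp /= [single_val k i]single_val0// (hf0r (hdotP _)).
Qed.

Lemma single_norm j (h : H j) : hn (emb (single h) : family_hilbert S H) = hn h.
Proof.
have := sumrep_single (tens_pure (os_one A) (os_one B)) h h.
case: (tr_hom (worst j)) => _ -> _ _; case: max_map_hom => _ -> _ _.
by rewrite !os_val1 /hn /sn => ->.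
Qed.

(** A positivity violated by [p] is violated by the summand chosen for it. The
matrix order of the maximal tensor product is obtained in this way together with
its norm. *)
Lemma max_map_pos n (X : 'M[T]_n) : os_pos (map_mx max_map X) ->
  forall (E : cstar R) (p : T -> E), tens_star_hom p -> os_pos (map_mx p X).
Proof.
move=> hX E p hp; pose j : test := inr (Tagged (fun n => 'M[T]_n) X).
have [//|np] := pselect (os_pos (map_mx p X)).
case: (@worstP j (TensorRep hp) np) => xi /=.
have := hX (fun i => emb (single (xi i)) : completion P).
congr (0 <= _); apply: eq_bigr => i _; apply: eq_bigr => k _.
by rewrite !mxE sumrep_single.
Qed.

Lemma max_map_bnd x M : bnd (max_map x) M ->
  forall (E : cstar R) (p : T -> E), tens_star_hom p -> bnd (p x) M.
Proof.
move=> [M0 hM] E p hp; pose j : test := inl (x, M%:C).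
have [//|np] := pselect (bnd (p x) M).
case: (@worstP j (TensorRep hp)) => /=; first by rewrite opnorm_leR.
apply/opnorm_leR; split=> // h.
have := hM (emb (single h)); rewrite single_norm; apply: le_trans.
have hs := hdotP (os_hilb max_tensor).
have := hf_CS hs (max_map x (emb (single h) : completion P))
  (emb (single (worst j x h)) : completion P).
rewrite sumrep_single hdot_sqr normc_real ger0_norm ?sqr_ge0//.
rewrite -/(hn _) -[X in _ * X]/(hn _) single_norm.
have := hn_ge0 (worst j x h); rewrite le_eqVlt => /orP[/eqP <- _|h0].
  exact: hn_ge0.
by rewrite expr2 ler_pM2r.
Qed.

Lemma max_mapP : is_max_tensor max_map.
Proof.
split; first exact: max_map_hom.
- move=> x e /[dup]/ltW/ge0C[_ ei]; rewrite ltcE => /andP[_ /= e0].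
  have [_ h] := os_setP x; have [_ [y _ <-] hy] := h _ e0.
  exists (max_map y); first by exists y.
  by apply/opnorm_leE; exists (complex.Re e) => //; exact: eqCri.
- move=> x c; split=> [/opnorm_leE[M -> hM] E p hp|h]; last exact: h max_map_hom.
  by apply/opnorm_leR; exact: max_map_bnd hM _ _ hp.
Qed.
End TensorReps.

(** * Adjoints and norms under positive maps *)

Section TwoByTwo.
Variable R : realType.
Local Notation C := R[i].

Definition mx22 (V : Type) (a b c d : V) : 'M[V]_2 :=
  \matrix_(i, j) if i == ord0 then (if j == ord0 then a else b)
                 else (if j == ord0 then c else d).

Lemma mx22E (V : Type) (a b c d : V) : (mx22 a b c d ord0 ord0 = a) *
  (mx22 a b c d ord0 ord_max = b) * (mx22 a b c d ord_max ord0 = c) *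
  (mx22 a b c d ord_max ord_max = d).
Proof. by rewrite /mx22 !mxE. Qed.

Lemma map_mx22 (V W : Type) (f : V -> W) a b c d :
  map_mx f (mx22 a b c d) = mx22 (f a) (f b) (f c) (f d).
Proof. by apply/matrixP => i j; rewrite !mxE; do 2 case: ifP. Qed.

Lemma sum22 (G : 'I_2 -> 'I_2 -> C) :
  \sum_i \sum_j G i j = (G ord0 ord0 + G ord0 ord_max) + (G ord_max ord0 + G ord_max ord_max).
Proof.
rewrite big_ord_recl big_ord1 !big_ord_recl !big_ord0 !addr0.
by rewrite (_ : lift ord0 ord0 = ord_max)//; apply: val_inj.
Qed.

(** Norms are encoded in the matrix order: the operator matrix with diagonal [M,
M] and off-diagonal [x, x^*] is positive when [x] has norm at most [M]. *)
Lemma os_pos22 (S : opsys R) (x : S) M : bnd x M ->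
  os_pos (mx22 (M%:C *: os_one S) x (os_star x) (M%:C *: os_one S)).
Proof.
move=> [M0 hM] xi; rewrite sum22 !mx22E !os_valZ !os_val1.
have hs := hdotP (os_hilb S); rewrite !(hfZ hs) !hdot_sqr.
rewrite (adjoint_sym (os_starP x)) (hfC hs (x (xi ord_max))).
apply/ge0C; rewrite !CE /= !mul0r !subr0; split; last by lra.
have := Re_le_normc (hdot _ (x (xi ord_max)) (xi ord0)).
have := hf_CS hs (x (xi ord_max)) (xi ord0).
have := hM (xi ord_max); rewrite -/(hn _) -/(hn (xi ord0)).
have := hn_ge0 (xi ord_max); have := hn_ge0 (xi ord0).
move: (hn (xi ord_max)) (hn (xi ord0)) (hn (x (xi ord_max))) => p q r q0 p0 h1 h2 h3.
have := ler_norm (- Re (hdot _ (x (xi ord_max)) (xi ord0))); rewrite normrN => h4.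
have h5 : r * q <= M * p * q by rewrite ler_wpM2r.
have : 0 <= M * (p - q) ^+ 2 by rewrite mulr_ge0 ?sqr_ge0.
by rewrite !expr2; lra.
Qed.

Lemma conj_of_Im (p q : C) : Im (p + q) = 0 -> Im ('i%C * p + ('i%C)^* * q) = 0 -> q = p^*.
Proof.
move=> h1 h2; apply: eqCri; rewrite ?ReJ ?ImJ; move: h1 h2; rewrite !CE /=; lra.
Qed.

(** Apply [f] to the matrix of [os_pos22]. The resulting form is real, which
gives the compatibility with adjoints, and nonnegative, which gives the norm
bound. *)
Lemma ucp_like_star (S T : opsys R) (f : S -> T) : linear f -> f (os_one S) = os_one T ->
  (forall X : 'M[S]_2, os_pos X -> os_pos (map_mx f X)) ->
  (forall x, f (os_star x) = os_star (f x)) /\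
  (forall (x : S) M, bnd x M -> bnd (f x) M).
Proof.
move=> lf f1 fP; have hT := hdotP (os_hilb T).
have key (x : S) M : bnd x M -> forall xi eta, 0 <= (M * hn xi ^+ 2 + M * hn eta ^+ 2)%:C
    + (hdot _ (f x eta) xi + hdot _ (f (os_star x) xi) eta).
  move=> /os_pos22/fP; rewrite map_mx22 !(linZ lf) f1 => h xi eta.
  have := h (fun i => if i == ord0 then xi else eta); rewrite sum22 !mx22E eqxx.
  rewrite (_ : (ord_max == ord0 :> 'I_2) = false)//.
  rewrite !os_valZ !os_val1 !(hfZ hT) !hdot_sqr.
  rewrite addrACA [_ + M%:C * _]addrC addrA; congr (0 <= _).
  by rewrite rmorphD !rmorphM /=; ring.
have fS (x : S) : f (os_star x) = os_star (f x).
  apply/esym/os_starE => xi eta; have [M xM] := os_bnd x.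
  rewrite [RHS](hfC hT); have hIm := key x M xM.
  have -> : hdot _ (f (os_star x) eta) xi = (hdot _ (f x xi) eta)^*; last by rewrite conjCK.
  apply: conj_of_Im.
    by have /ge0C[_] := hIm eta xi; rewrite !CE /=; lra.
  have /ge0C[_] := hIm eta ('i%C *: xi); rewrite (linZ (os_linear _)) (hfZ hT) (hfZr hT).
  by rewrite ImD /= add0r.
split=> // x M xM; have [M0 _] := xM; split=> // eta; have := hn_ge0 (f x eta).
rewrite le_eqVlt => /orP[/eqP <-|a0]; first by rewrite mulr_ge0 ?hn_ge0.
have b0 : 0 < hn eta.
  rewrite lt_neqAle hn_ge0 andbT eq_sym; apply/eqP => /hn_eq0 e0.
  by rewrite e0 (lin0 (os_linear _)) /hn sn0 ?ltxx// in a0; exact: hdotP.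
(* The form is tested at [(- c (f x eta), eta)], both components having the length
   of [eta]. *)
pose c := hn eta / hn (f x eta); have c0 : 0 < c by rewrite divr_gt0.
have /ge0C[+ _] := key x M xM (- c%:C *: f x eta) eta.
rewrite fS (adjoint_sym (os_starP (f x))) [hdot _ (- c%:C *: _) (f x eta)](hfC hT).
rewrite !CE /= /hn (snZ hT) normcN normc_real ger0_norm ?(ltW c0)// -/(hn _) -/(hn eta).
have eR : Re (hdot (os_hilb T) (f x eta) (- c%:C *: f x eta)) = - (c * hn (f x eta) ^+ 2).
  by rewrite (hfZr hT) hdot_sqr -rmorphN conjC_rc !CE /=; lra.
have e1 : c * hn (f x eta) ^+ 2 = hn eta * hn (f x eta).
  by rewrite expr2 mulrA /c divfK// gt_eqF.
have e2 : c * hn (f x eta) = hn eta by rewrite /c divfK// gt_eqF.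
rewrite eR e1 e2 => h; rewrite -(ler_pM2r b0); move: h; rewrite !expr2; lra.
Qed.
End TwoByTwo.

(** * Matrix-valued ucp maps as limits of vector maps *)

Section UcpMatrix.
Variable R : realType.
Local Notation C := R[i].

Definition qform (n k : nat) (X : 'I_n -> 'I_n -> 'I_k -> 'I_k -> C) (z : 'I_n -> 'I_k -> C) : C :=
  \sum_i \sum_j \sum_a \sum_b (z i a)^* * X i j a b * z j b.

Lemma mx_posE k n (X : 'M['M[C]_k]_n) :
  mx_pos X <-> forall z, 0 <= qform (fun i j => X i j) z.
Proof.
have E (xi : 'I_n -> 'cV[C]_k) :
    (\sum_(i < n) \sum_(j < n) map_mx Num.conj (xi i)^T *m X i j *m xi j) 0 0 =
    qform (fun i j => X i j) (fun i a => xi i a 0).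
  rewrite summxE; apply: eq_bigr => i _; rewrite summxE; apply: eq_bigr => j _.
  rewrite !mxE exchange_big /=; apply: eq_bigr => b _.
  by rewrite !mxE mulr_suml; apply: eq_bigr => a _; rewrite !mxE.
split=> [h z|h xi]; last by rewrite E.
have := h (fun i => \col_a z i a); rewrite E; congr (0 <= _).
by do 4 (apply: eq_bigr => ? _); rewrite !mxE.
Qed.

Lemma sum_delta2 k (X : 'I_k -> 'I_k -> C) a b (p q : C) :
  \sum_c \sum_d (p * (c == a)%:R)^* * X c d * (q * (d == b)%:R) = p^* * X a b * q.
Proof.
rewrite (bigD1 a)//= [X in _ + X]big1 ?addr0; last first.
  move=> c /negPf ->; rewrite big1// => d _.
  by rewrite mulr0 rmorph0 !mul0r.
rewrite (bigD1 b)//= [X in _ + X]big1 ?addr0 ?eqxx ?mulr1//.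
by move=> d /negPf ->; rewrite !mulr0.
Qed.

Section Fix.
Variables (S : opsys R) (k : nat) (f : S -> 'M[C]_k).
Hypothesis hf : ucp_mx f.

Lemma ucp_mx22 (x : S) M a b (p q : C) : bnd x M ->
  0 <= (p^* * (M%:C * (a == a)%:R) * p + p^* * f x a b * q) +
       (q^* * f (os_star x) b a * p + q^* * (M%:C * (b == b)%:R) * q).
Proof.
case: hf => lf f1 fP /os_pos22/fP; rewrite map_mx22 !(linZ lf) f1 => /mx_posE h.
have := h (fun i c => if i == ord0 then p * (c == a)%:R else q * (c == b)%:R).
rewrite /qform sum22 !mx22E eqxx (_ : (ord_max == ord0 :> 'I_2) = false)//.
by rewrite !sum_delta2 !mxE !eqxx.
Qed.

Lemma ucp_mx_star (x : S) a b : f (os_star x) b a = (f x a b)^*.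
Proof.
have [M xM] := os_bnd x; apply: conj_of_Im.
  have := ucp_mx22 a b 1 1 xM; rewrite !eqxx conjC1 !mul1r !mulr1 => /ge0C[_].
  by rewrite !CE /=; lra.
have := ucp_mx22 a b 1 'i%C xM; rewrite !eqxx conjC1 !mul1r !mulr1 => /ge0C[_].
by rewrite !CE /=; lra.
Qed.

End Fix.
End UcpMatrix.

Section Separation.
Variable R : realType.
Local Notation C := R[i].
Variables (V : lmodType C) (s : V -> V -> C).
Hypothesis hs : hform s.
Variable W : set V.
Hypotheses (W0 : W 0) (WD : forall v w, W v -> W w -> W (v + w))
  (WZ : forall (t : R) v, 0 <= t -> W v -> W (t%:C *: v)).

(** Separation of a point from a convex cone [W] which need not be closed, in a
space which need not be complete. The functional is the inner product with [w0 -
x], for a [w0] in [W] that is almost as close to [x] as possible; it is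
nonnegative on [W] up to [eta]. *)
Lemma separation x : ~ (forall e, 0 < e -> exists2 w, W w & sn s (x - w) <= e) ->
  exists2 d, 0 < d & forall eta, 0 < eta ->
    exists2 z, Re (s x z) <= - d & forall w, W w -> - (eta * sn s w) <= Re (s w z).
Proof.
move=> /existsNP[d /not_implyP[d0 nd]].
have far w : W w -> d < sn s (x - w) by move=> Ww; rewrite ltNge; apply/negP => h; apply: nd; exists w.
pose T := [set sn s (x - w) ^+ 2 | w in W].
have hT : has_inf T.
  split; first by exists (sn s (x - 0) ^+ 2); exists 0.
  by exists 0 => _ [w _ <-]; rewrite sqr_ge0.
pose m := inf T; have m0 : d ^+ 2 <= m.
  apply: lb_le_inf hT.1 _ => _ [w Ww <-].
  by rewrite ler_pXn2r ?nnegrE ?sn_ge0 ?ltW// far.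
have mW w : W w -> m <= sn s (x - w) ^+ 2 by move=> Ww; apply: (ge_inf hT.2); exists w.
have dd : 0 < d ^+ 2 by rewrite exprn_gt0.
pose K := 3 * sn s x + 2; have K0 : 0 < K by have := sn_ge0 s x; rewrite /K; lra.
exists (d ^+ 2 / 2); first by rewrite divr_gt0.
move=> eta0 eta00.
pose eta := Order.min (Order.min eta0 1) (d ^+ 2 / 2 / K).
have e0 : 0 < eta by rewrite !lt_min eta00 ltr01 divr_gt0// divr_gt0.
have e1 : eta <= eta0 by rewrite /eta !ge_min lexx.
have e2 : eta <= 1 by rewrite /eta !ge_min lexx !orbT.
have e3 : eta * K <= d ^+ 2 / 2 by rewrite -ler_pdivlMr// /eta !ge_min lexx !orbT.
have [_ [w0 Ww0 <-] hw0] := inf_adherent (exprn_gt0 2 e0) hT.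
rewrite -/m in hw0; pose z := w0 - x.
have zE : sn s z ^+ 2 < m + eta ^+ 2 by rewrite /z sn_dist.
have expand v w t : sn s (v + t%:C *: w) ^+ 2 =
    sn s v ^+ 2 + 2 * t * Re (s w v) + t ^+ 2 * sn s w ^+ 2.
  rewrite !(sqr_sn hs) (hfD hs) !(hfDr hs) !(hfZ hs) !(hfZr hs) conjC_rc (hfC hs w v).
  by rewrite !CE /= (hfIm hs); ring.
have bw w : normc (s w z) <= sn s w * sn s z by exact: hf_CS.
(* Moving from [w0] in the direction [w] does not leave [W], so it cannot bring
   the point much closer to [x]. *)
have lower w : W w -> - (eta * sn s w) <= Re (s w z).
  move=> Ww; have := sn_ge0 s w; rewrite le_eqVlt => /orP[/eqP w00|wp].
    have := bw w; rewrite -w00 mul0r => h; have := Re_le_normc (s w z).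
    by rewrite ler_norml mulr0 oppr0; lra.
  pose t := eta / sn s w; have t0 : 0 < t by rewrite divr_gt0.
  have := mW _ (WD Ww0 (WZ (ltW t0) Ww)); rewrite sn_dist// addrAC -/z expand.
  have tw : t * sn s w = eta by rewrite divfK// gt_eqF.
  rewrite -exprMn tw => h.
  have h2 : 0 <= 2 * t * Re (s w z) + 2 * eta ^+ 2 by lra.
  rewrite -subr_ge0 opprK -(pmulr_rge0 _ t0) mulrDr mulrCA tw -expr2; lra.
exists z; last first.
  by move=> w Ww; apply: le_trans (lower w Ww); rewrite lerN2 ler_wpM2r ?sn_ge0.
have zb : sn s z <= sn s x + 1.
  rewrite -(@ler_pXn2r _ 2) ?nnegrE ?addr_ge0 ?sn_ge0//.
  have := mW 0 W0; rewrite subr0; have := sn_ge0 s x.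
  have : eta ^+ 2 <= 1 by rewrite expr_le1 // ltW.
  by move: zE; rewrite sqrrD expr1n mulr1 mulr2n; lra.
(* Shrinking [w0] does not leave [W] either. *)
have upper : Re (s w0 z) <= eta * (sn s w0 + sn s z).
  have [wl|wl] := leP eta (sn s w0).
    have wp : 0 < sn s w0 by exact: lt_le_trans wl.
    pose t := eta / sn s w0; have t0 : 0 < t by rewrite divr_gt0.
    have t1 : t <= 1 by rewrite ler_pdivrMr// mul1r.
    have W1 : W ((1 - t)%:C *: w0) by apply: WZ => //; rewrite subr_ge0.
    have := mW _ W1; rewrite sn_dist//.
    have -> : (1 - t)%:C *: w0 - x = z + (- t)%:C *: w0.
      by rewrite rmorphB scalerBl scale1r rmorphN scaleNr addrAC.
    rewrite expand sqrrN; have tw : t * sn s w0 = eta by rewrite divfK// gt_eqF.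
    rewrite -exprMn tw => h.
    have h2 : t * Re (s w0 z) <= eta ^+ 2 by lra.
    have h3 : Re (s w0 z) <= eta * sn s w0.
      by rewrite -(ler_pM2l t0) mulrCA tw -expr2.
    by apply: le_trans h3 _; rewrite mulrDr lerDl mulr_ge0 ?sn_ge0// ltW.
  apply: le_trans (le_trans (ler_norm _) (Re_le_normc _)) _; apply: le_trans (bw _) _.
  rewrite mulrDr; apply: le_trans (_ : eta * sn s z <= _).
    by rewrite ler_wpM2r ?sn_ge0// ltW.
  by rewrite lerDr mulr_ge0 ?sn_ge0// ltW.
have w0b : sn s w0 <= sn s x + sn s z.
  by rewrite -[w0](subrK x) addrC; exact: snD.
have -> : Re (s x z) = Re (s w0 z) - sn s z ^+ 2.
  by rewrite (sqr_sn hs) -ReN -ReD {3}/z (hfB hs) opprB addrC subrK.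
have zm : m <= sn s z ^+ 2 by rewrite /z sn_dist//; exact: mW.
have : eta * (sn s w0 + sn s z) <= eta * K by rewrite ler_pM2l// /K; lra.
lra.
Qed.
End Separation.

Section FiniteVectors.
Variables (R : realType) (J : finType).
Local Notation C := R[i].
Definition l2dot (z w : J -> C) : C := \sum_j z j * (w j)^*.
Lemma l2dotH : hform l2dot.
Proof.
split=> [a x y z|x y|x].
- rewrite /l2dot mulr_sumr -big_split; apply: eq_bigr => j _.
  by rewrite -[(a *: x + y) j]/(a * x j + y j) mulrDl mulrA.
- by rewrite /l2dot rmorph_sum; apply: eq_bigr => j _; rewrite rmorphM /= conjCK mulrC.
- by apply: sumr_ge0 => j _; rewrite mul_conjC_ge0.
Qed.
Lemma l2_coord z j : normc (z j) <= sn l2dot z.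
Proof.
rewrite -(@ler_pXn2r _ 2) ?nnegrE ?normc_ge0 ?sn_ge0// (sqr_sn l2dotH).
rewrite /l2dot Re_sum (bigD1 j)//= -[X in X <= _]addr0; apply: lerD.
  by rewrite -normCK normCE -rmorphXn.
by apply: sumr_ge0 => i _; rewrite -normCK normCE -rmorphXn /= sqr_ge0.
Qed.
Lemma l2_le z c : (forall j, normc (z j) <= c) -> sn l2dot z <= #|J|%:R * c.
Proof.
move=> h; have [/eqP J0|] := eqVneq #|J| 0%N.
  rewrite (eqP J0) mul0r /sn /l2dot big1 ?sqrtr0// => j _.
  by have := card0_eq (eqP J0) j; rewrite inE.
rewrite -lt0n => J0; have c0 : 0 <= c.
  have /card_gt0P[j _] := J0; exact: le_trans (normc_ge0 _) (h j).
have J1 : 1 <= #|J|%:R :> R by rewrite ler1n.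
rewrite (sn_le l2dotH) ?mulr_ge0// Re_sum.
apply: le_trans (_ : \sum_(j : J) c ^+ 2 <= _).
  apply: ler_sum => j _; rewrite -normCK normCE -rmorphXn /=.
  by rewrite ler_pXn2r ?nnegrE ?normc_ge0.
rewrite sumr_const exprMn -[leLHS]mulr_natl ler_wpM2r ?sqr_ge0// expr2.
by rewrite ler_peMr.
Qed.
End FiniteVectors.

Section VectorApprox.
Variable R : realType.
Local Notation C := R[i].

Lemma embedding_star (S T : opsys R) (i : S -> T) : unital_complete_order_embedding i ->
  (forall x, i (os_star x) = os_star (i x)) /\
  (forall (x : S) M, bnd x M -> bnd (i x) M).
Proof. by move=> [li i1 iP]; apply: ucp_like_star => // X; have [_] := iP _ X. Qed.

Variables (S S' : opsys R) (i : S -> S').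
Hypothesis hi : unital_complete_order_embedding i.
Variables (k : nat) (f : S -> 'M[C]_k).
Hypothesis hf : ucp_mx f.
Let H := os_hilb S'.
Let hs : hform (hdot H) := hdotP H.

(** The completely positive map [x |-> sum_v v^* x v], a family [v] of [k]
vectors being seen as an operator from [C^k] to [H]. *)
Definition vec_map (l : seq ('I_k -> H)) (x : S') (a b : 'I_k) : C :=
  \sum_(v <- l) hdot H (x (v b)) (v a).

Section Fix.
Variable E : seq S.
Let J := ('I_k * 'I_k * 'I_(size E))%type.
Let xE (j : J) : S := nth 0 E j.2.
Let vec (l : seq ('I_k -> H)) : J -> C := fun j => vec_map l (i (xE j)) j.1.1 j.1.2.
Let W : set (J -> C) := range vec.
Let fhat : J -> C := fun j => f (xE j) j.1.1 j.1.2.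

Let W0 : W 0.
Proof. by exists [::] => //; apply/funext => j; rewrite /vec /vec_map big_nil. Qed.

Let WD v w : W v -> W w -> W (v + w).
Proof.
move=> [l _ <-] [m _ <-]; exists (l ++ m) => //; apply/funext => j.
by rewrite /vec /vec_map big_cat.
Qed.

Let WZ (t : R) v : 0 <= t -> W v -> W (t%:C *: v).
Proof.
move=> t0 [l _ <-]; exists [seq (fun a => (Num.sqrt t)%:C *: v a) | v <- l] => //.
apply/funext => j; rewrite /vec /vec_map big_map -[RHS]/(t%:C * _) mulr_sumr.
apply: eq_bigr => w _; rewrite (linZ (os_linear _)) (hfZ hs) (hfZr hs) mulrA conjC_rc.
by rewrite -rmorphM -expr2 sqr_sqrtr.
Qed.

(** Otherwise the vector [fhat] of the values of [f] on [E] is separated from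
the cone [W] of vector maps by some [z], that is, by a matrix [Z] over the span
of [E]. As the pairings of [z] with vector maps are almost nonnegative, [Z +
Z^*] becomes positive after a small multiple of 1 is added; then complete
positivity of [f] bounds from below the pairing of [z] with [fhat], against the
separation. *)
Lemma fhat_approx e : 0 < e -> exists2 w, W w & sn (@l2dot R J) (fhat - w) <= e.
Proof.
move: e; apply: contrapT => /(separation (l2dotH R J) W0 WD WZ)[d d0 hd].
have [li i1 iP] := hi; have [iS iB] := embedding_star hi.
have [lf f1 fP] := hf.
have [M M0 hM] : exists2 M, 0 <= M & forall j, bnd (i (xE j)) M.
  have hb j : exists M, bnd (xE j) M by exact: os_bnd.
  pose b j := sval (cid (hb j)); have bP j : bnd (xE j) (b j) by rewrite /b; case: cid.
  exists (\sum_j b j); first by apply: sumr_ge0 => j _; have [] := bP j.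
  move=> j; apply: iB; apply: bndW (bP j); rewrite (bigD1 j)//= lerDl.
  by apply: sumr_ge0 => j' _; have [] := bP j'.
pose c0 := #|{: J}|%:R * M; have c00 : 0 <= c0 by rewrite mulr_ge0.
pose eta := d / (2 * (c0 * k%:R + 1)).
have ck : 0 < c0 * k%:R + 1 by rewrite ltr_wpDl// mulr_ge0.
have eta0 : 0 < eta by rewrite divr_gt0// mulr_gt0.
have [z hz1 hz2] := hd eta eta0.
pose Z a b : S := \sum_e (z (a, b, e))^* *: nth 0 E e.
pose Y : 'M[S]_k := \matrix_(a, b)
  (Z a b + os_star (Z b a) + ((2 * eta * c0)%:C * (a == b)%:R) *: os_one S).
(* Pairing with [z] is evaluation at the matrix [Z]. *)
have pair (g : S -> 'I_k -> 'I_k -> C) : (forall a b, linear (fun x => g x a b : C^o)) ->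
    l2dot (fun j => g (xE j) j.1.1 j.1.2) z = \sum_a \sum_b g (Z a b) a b.
  move=> lg; pose F (p : 'I_k * 'I_k) (e : 'I_(size E)) :=
    g (nth 0 E e) p.1 p.2 * (z (p, e))^*.
  rewrite /l2dot (eq_bigr (fun j => F j.1 j.2)); last by case.
  rewrite -(pair_bigA _ F) [RHS]pair_bigA; apply: eq_bigr => -[a b] _.
  rewrite (lin_sum (lg a b)); apply: eq_bigr => e _.
  by rewrite (linZ (lg a b)) /F mulrC.
have lowv (v : 'I_k -> H) : - (eta * c0 * \sum_a hn (v a) ^+ 2) <=
    Re (\sum_a \sum_b hdot H (i (Z a b) (v b)) (v a)).
  have n0 a : hn (v a) ^+ 2 <= \sum_a hn (v a) ^+ 2.
    by rewrite (bigD1 a)//= lerDl; apply: sumr_ge0 => c _; rewrite sqr_ge0.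
  have Wv : W (vec [:: v]) by exists [:: v].
  have vE : vec [:: v] = fun j => hdot H (i (xE j) (v j.1.2)) (v j.1.1).
    by apply/funext => j; rewrite /vec /vec_map big_seq1.
  have := hz2 _ Wv; rewrite {2}vE (pair (fun x a b => hdot H (i x (v b)) (v a))); last first.
    by move=> a b c x y; rewrite li os_valL (hfP hs).
  apply: le_trans; rewrite lerN2 -mulrA ler_pM2l// /c0 -mulrA.
  apply: l2_le => j; rewrite vE; apply: le_trans (hf_CS hs _ _) _.
  have [_ hb] := hM j; have := hb (v j.1.2); rewrite -/(hn _) -[sn _ (v _)]/(hn _) => h1.
  apply: le_trans (ler_wpM2r (hn_ge0 _) h1) _; rewrite -mulrA ler_wpM2l//.
  have := n0 j.1.1; have := n0 j.1.2; move: (\sum_a _) => N.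
  move: (hn_ge0 (v j.1.1)) (hn_ge0 (v j.1.2)).
  move: (hn (v j.1.1)) (hn (v j.1.2)) => p q p0 q0 hq hp.
  have : 0 <= (p - q) ^+ 2 by rewrite sqr_ge0.
  by rewrite !expr2 in hp hq *; lra.
have Ypos : os_pos (map_mx i Y).
  move=> xi; set T := \sum_a \sum_b hdot H (i (Z a b) (xi b)) (xi a).
  rewrite [X in 0 <= X](_ : _ = T + T^* + (2 * eta * c0 * \sum_a hn (xi a) ^+ 2)%:C).
    apply/ge0C; rewrite !CE /= addr0 subrr; split=> //.
    by have := lowv xi; rewrite -/T; lra.
  have -> : T^* = \sum_a \sum_b (hdot H (i (Z a b) (xi b)) (xi a))^*.
    by rewrite /T rmorph_sum; apply: eq_bigr => a _; rewrite rmorph_sum.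
  rewrite [X in _ + X + _]exchange_big -big_split /= mulr_sumr rmorph_sum -big_split /=.
  apply: eq_bigr => a _.
  have EY b : hdot H (map_mx i Y a b (xi b)) (xi a) =
      hdot H (i (Z a b) (xi b)) (xi a) + (hdot H (i (Z b a) (xi a)) (xi b))^* +
      ((2 * eta * c0)%:C * (a == b)%:R) * hdot H (xi b) (xi a).
    rewrite !mxE !(linD li) (linZ li) i1 iS.
    rewrite !os_valD os_valZ os_val1 !(hfD hs) (hfZ hs); congr (_ + _ + _).
    by rewrite (adjoint_sym (os_starP (i (Z b a)))) [LHS](hfC hs).
  rewrite (eq_bigr _ (fun b _ => EY b)) big_split /= big_split /=; congr (_ + _).
  rewrite (bigD1 a)//= big1 ?addr0 => [|b]; last first.
    by rewrite eq_sym => /negPf ->; rewrite mulr0 mul0r.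
  by rewrite eqxx mulr1 hdot_sqr -rmorphM.
have /fP/mx_posE/(_ (fun a c => (c == a)%:R))/ge0C[+ _] := (iP _ _).1 Ypos.
have -> : qform (fun a b => map_mx f Y a b) (fun a c => (c == a)%:R) =
   \sum_a \sum_b (f (Z a b) a b + (f (Z b a) b a)^* + ((2 * eta * c0)%:C * (a == b)%:R) * (a == b)%:R).
  apply: eq_bigr => a _; apply: eq_bigr => b _.
  have := sum_delta2 (fun c d => map_mx f Y a b c d) a b 1 1; rewrite conjC1 mul1r mulr1.
  under eq_bigr do under eq_bigr do rewrite !mul1r; move=> ->.
  by rewrite !mxE !(linD lf) (linZ lf) f1 !mxE (ucp_mx_star hf).
rewrite -/(fhat) in hz1.
rewrite (pair (fun x a b => f x a b)) in hz1; last by move=> a b c x y; rewrite lf !mxE.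
set T := \sum_a _ in hz1.
rewrite (_ : \sum_a _ = T + T^* + (2 * eta * c0 * k%:R)%:C); last first.
  have -> : T^* = \sum_a \sum_b (f (Z a b) a b)^*.
    by rewrite /T rmorph_sum; apply: eq_bigr => a _; rewrite rmorph_sum.
  rewrite [X in _ + X + _]exchange_big -big_split /=.
  have -> : (2 * eta * c0 * k%:R)%:C = \sum_(a < k) (2 * eta * c0)%:C.
    by rewrite sumr_const card_ord rmorphM /= rmorph_nat mulr_natr.
  rewrite -big_split /=; apply: eq_bigr => a _; rewrite -big_split /= big_split /=; congr (_ + _).
  rewrite (bigD1 a)//= big1 ?addr0 ?eqxx ?mulr1// => b.
  by rewrite eq_sym => /negPf ->; rewrite !mulr0.
rewrite !CE /=.
have : 2 * eta * c0 * k%:R < d.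
  rewrite /eta [ltLHS](_ : _ = d * (c0 * k%:R / (c0 * k%:R + 1))); last by field; rewrite gt_eqF.
  by rewrite gtr_pMr// ltr_pdivrMr// mul1r ltrDl.
lra.
Qed.
End Fix.
End VectorApprox.

(** A substitute, on finite sets, for the extension of ucp maps from [S] to [S']
and for their Stinespring dilation: vector maps make sense on all of [S']. *)
Lemma vec_approx (R : realType) (S S' : opsys R) (i : S -> S')
    (hi : unital_complete_order_embedding i) k (f : S -> 'M[R[i]]_k) (hf : ucp_mx f)
    (E : seq S) (e : R) : 0 < e ->
  exists l, forall x a b, x \in E -> normc (f x a b - vec_map l (i x) a b) <= e.
Proof.
move=> e0; have [_ [l _ <-] hl] := fhat_approx hi hf E e0.
exists l => x a b xE; have xs : (index x E < size E)%N by rewrite index_mem.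
have := le_trans (l2_coord _ (a, b, Ordinal xs)) hl.
by rewrite -[((fun _ => _) - _) _]/(_ - _) /= nth_index.
Qed.

Section Compression.
Variable R : realType.
Local Notation C := R[i].
Variable H : hilbert R.
Let hs := hdotP H.

Definition orthonormal k (e : 'I_k -> H) := forall a b, hdot H (e a) (e b) = (a == b)%:R.

Lemma Gram_Schmidt (l : seq H) : exists k (e : 'I_k -> H), orthonormal e /\
  forall h, h \in l -> exists c : 'I_k -> C, h = \sum_a c a *: e a.
Proof.
elim: l => [|h l [k [e [eo el]]]].
  by exists 0%N, (fun _ => 0); split=> // -[].
pose h' := h - \sum_a hdot H h (e a) *: e a.
have ho a : hdot H h' (e a) = 0.
  rewrite /h' (hfB hs) (hf_suml hs) (bigD1 a)//= big1 => [|b ba].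
    by rewrite (hfZ hs) eo eqxx mulr1 addr0 subrr.
  by rewrite (hfZ hs) eo (negPf ba) mulr0.
have hE : h = h' + \sum_a hdot H h (e a) *: e a by rewrite subrK.
have [h0|h0] := eqVneq (hn h') 0.
  exists k, e; split=> // x; rewrite inE => /orP[/eqP ->|/el//].
  by exists (fun a => hdot H h (e a)); rewrite {1}hE (hn_eq0 h0) add0r.
pose u := (hn h')^-1%:C *: h'.
have uu : hdot H u u = 1.
  rewrite /u (hfZ hs) (hfZr hs) conjC_rc hdot_sqr -!rmorphM /=.
  by rewrite expr2 mulrA mulrACA !mulVf// mulr1.
have ue a : hdot H u (e a) = 0 by rewrite /u (hfZ hs) ho mulr0.
pose e' (a : 'I_k.+1) := if unlift ord0 a is Some a' then e a' else u.
have e'0 : e' ord0 = u by rewrite /e' unlift_none.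
have e'S a : e' (lift ord0 a) = e a by rewrite /e' liftK.
exists k.+1, e'; split=> [a b|x].
  case: (unliftP ord0 a) => [a' ->|->]; case: (unliftP ord0 b) => [b' ->|->].
  - by rewrite !e'S eo (inj_eq lift_inj).
  - by rewrite e'S e'0 (hfC hs) ue rmorph0 [_ == _]eq_sym (negPf (neq_lift _ _)).
  - by rewrite e'S e'0 ue (negPf (neq_lift _ _)).
  - by rewrite e'0 uu eqxx.
rewrite inE => /orP[/eqP ->|/el[c ->]].
  exists (fun a => if unlift ord0 a is Some a' then hdot H h (e a') else (hn h')%:C).
  rewrite big_ord_recl e'0 unlift_none {1}hE; congr (_ + _).
    by rewrite /u scalerA -rmorphM mulfV// scale1r.
  by apply: eq_bigr => a _; rewrite liftK e'S.
exists (fun a => if unlift ord0 a is Some a' then c a' else 0).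
rewrite big_ord_recl unlift_none scale0r add0r.
by apply: eq_bigr => a _; rewrite liftK e'S.
Qed.
End Compression.

Section CompressionUcp.
Variable R : realType.
Local Notation C := R[i].
Variable S : opsys R.
Let H := os_hilb S.
Let hs : hform (hdot H) := hdotP H.

Definition compress k (e : 'I_k -> H) (x : S) : 'M[C]_k :=
  \matrix_(a, b) hdot H (x (e b)) (e a).

Lemma compress_ucp k (e : 'I_k -> H) : orthonormal e -> ucp_mx (compress e).
Proof.
move=> eo; split.
- by move=> c x y; apply/matrixP => a b; rewrite !mxE os_valL (hfP hs).
- by apply/matrixP => a b; rewrite !mxE os_val1 eo eq_sym.
- move=> n X hX; apply/mx_posE => z.
  have := hX (fun i => \sum_a z i a *: e a); congr (0 <= _).
  apply: eq_bigr => i _; apply: eq_bigr => j _.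
  rewrite (hf_sumr hs); apply: eq_bigr => a _; rewrite (hfZr hs).
  rewrite (lin_sum (os_linear _)) (hf_suml hs) mulr_sumr; apply: eq_bigr => b _.
  by rewrite !mxE (linZ (os_linear _)) (hfZ hs); ring.
Qed.

(** A vector map is a sum of conjugates of the compression to the span of the
vectors involved; unlike the vector map, the compression is unital. *)
Lemma vec_map_compress k (l : seq ('I_k -> H)) : exists k' (F : S -> 'M[C]_k') cs,
  ucp_mx F /\ forall x a b, vec_map l x a b =
    \sum_(w <- cs) \sum_c \sum_d (w c a)^* * F x c d * w d b.
Proof.
have [k' [e [eo el]]] := Gram_Schmidt (flatten [seq [seq v a | a <- enum 'I_k] | v <- l]).
exists k', (compress e).
have {}el : forall v, v \in l -> exists w : 'I_k' -> 'I_k -> C, forall a, v a = \sum_c w c a *: e c.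
  move=> v vl; have h a : exists c : 'I_k' -> C, v a = \sum_c' c c' *: e c'.
    apply: el; apply/flatten_mapP; exists v => //; apply/mapP; exists a => //.
    exact: mem_enum.
  by exists (fun c a => sval (cid (h a)) c) => a; case: cid.
elim: l el => [|v l IH] el.
  exists [::]; split; first exact: compress_ucp.
  by move=> x a b; rewrite /vec_map !big_nil.
have [|cs [_ hcs]] := IH; first by move=> v0 vl; apply: el; rewrite inE vl orbT.
have [w hw] := el v (mem_head _ _).
exists (w :: cs); split; first exact: compress_ucp.
move=> x a b; rewrite /vec_map !big_cons -/(vec_map l x a b) hcs; congr (_ + _).
rewrite !hw (hf_sumr hs); apply: eq_bigr => c _; rewrite (hfZr hs).
rewrite (lin_sum (os_linear _)) (hf_suml hs) mulr_sumr; apply: eq_bigr => d _.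
by rewrite mxE (linZ (os_linear _)) (hfZ hs); ring.
Qed.

Lemma unit_state : (exists h : H, h != 0) -> exists f : S -> 'M[C]_1, ucp_mx f.
Proof.
move=> [h h0]; have hh : hn h != 0 by apply: contra h0 => /eqP/hn_eq0 ->.
exists (compress (fun _ => (hn h)^-1%:C *: h)); apply: compress_ucp => a b.
rewrite !ord1 eqxx (hfZ hs) (hfZr hs) conjC_rc hdot_sqr -!rmorphM /=.
by rewrite expr2 mulrA mulrACA !mulVf// mulr1.
Qed.
End CompressionUcp.

(** * The minimal cone *)

Section KForm.
Variable R : realType.
Local Notation C := R[i].
Variables k m : nat.
Implicit Types (A : 'I_k -> 'I_k -> C) (B : 'I_m -> 'I_m -> C) (z w : 'I_k -> 'I_m -> C).

(** [<(A (x) B) w, z>] in the tensor product of [C^k] and [C^m]. *)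
Definition kq A B z w : C :=
  \sum_a \sum_b \sum_c \sum_d (z a c)^* * (A a b * B c d) * w b d.

Lemma kq_linl t A A' B z w :
  kq (fun a b => t * A a b + A' a b) B z w = t * kq A B z w + kq A' B z w.
Proof.
do 4 (rewrite /kq !mulr_sumr -big_split; apply: eq_bigr => ? _; rewrite -/(kq)).
by rewrite /=; ring.
Qed.
Lemma kq_linr t A B B' z w :
  kq A (fun a b => t * B a b + B' a b) z w = t * kq A B z w + kq A B' z w.
Proof.
do 4 (rewrite /kq !mulr_sumr -big_split; apply: eq_bigr => ? _; rewrite -/(kq)).
by rewrite /=; ring.
Qed.

Lemma kq0l B z w : kq (fun _ _ => 0) B z w = 0.
Proof. by rewrite /kq; do 4 (rewrite big1// => ? _); rewrite mul0r mulr0 mul0r. Qed.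
Lemma kq0r A z w : kq A (fun _ _ => 0) z w = 0.
Proof. by rewrite /kq; do 4 (rewrite big1// => ? _); rewrite mulr0 mulr0 mul0r. Qed.

Lemma eq_kq A A' B B' z w : (forall a b, A a b = A' a b) -> (forall c d, B c d = B' c d) ->
  kq A B z w = kq A' B' z w.
Proof. by move=> h h'; do 4 (apply: eq_bigr => ? _); rewrite h h'. Qed.

Lemma kq_suml (I : Type) (r : seq I) (A : I -> 'I_k -> 'I_k -> C) B z w :
  kq (fun a b => \sum_(i <- r) A i a b) B z w = \sum_(i <- r) kq (A i) B z w.
Proof.
elim: r => [|i r IH].
  by rewrite big_nil -[RHS](kq0l B z w); apply: eq_kq => // a b; rewrite big_nil.
rewrite big_cons -IH -[kq (A i) B z w]mul1r -kq_linl.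
by apply: eq_kq => // a b; rewrite big_cons mul1r.
Qed.
Lemma kq_sumr (I : Type) (r : seq I) A (B : I -> 'I_m -> 'I_m -> C) z w :
  kq A (fun a b => \sum_(i <- r) B i a b) z w = \sum_(i <- r) kq A (B i) z w.
Proof.
elim: r => [|i r IH].
  by rewrite big_nil -[RHS](kq0r A z w); apply: eq_kq => // a b; rewrite big_nil.
rewrite big_cons -IH -[kq A (B i) z w]mul1r -kq_linr.
by apply: eq_kq => // a b; rewrite big_cons mul1r.
Qed.

Lemma kq_bound A B z w p q : 0 <= p -> (forall a b, normc (A a b) <= p) ->
  (forall c d, normc (B c d) <= q) ->
  normc (kq A B z w) <= p * q * \sum_a \sum_b \sum_c \sum_d normc (z a c) * normc (w b d).
Proof.
move=> p0 hA hB; do 4 (rewrite /kq mulr_sumr; apply: le_trans (normc_sum _ _ _) _;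
  apply: ler_sum => ? _).
rewrite !normcM normc_conj [leLHS]mulrAC [leLHS]mulrC ler_wpM2r ?mulr_ge0 ?normc_ge0//.
by rewrite ler_pM ?normc_ge0.
Qed.

End KForm.

Lemma kq_compress (R : realType) k k' m (F : 'I_k' -> 'I_k' -> R[i]) (w : 'I_k' -> 'I_k -> R[i])
    (B : 'I_m -> 'I_m -> R[i]) z z' :
  kq (fun a b => \sum_c \sum_d (w c a)^* * F c d * w d b) B z z' =
  kq F B (fun c t => \sum_a w c a * z a t) (fun c t => \sum_a w c a * z' a t).
Proof.
rewrite /kq.
transitivity (\sum_a \sum_b \sum_c \sum_d \sum_s \sum_t
    (w s a * z a c)^* * (F s t * B c d) * (w t b * z' b d)).
  do 4 (apply: eq_bigr => ? _).
  rewrite mulr_suml mulr_sumr mulr_suml; apply: eq_bigr => s _.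
  rewrite mulr_suml mulr_sumr mulr_suml; apply: eq_bigr => t _.
  by rewrite rmorphM /=; ring.
have ex6 (G : 'I_k -> 'I_k -> 'I_m -> 'I_m -> 'I_k' -> 'I_k' -> R[i]) :
  \sum_a \sum_b \sum_c \sum_d \sum_s \sum_t G a b c d s t =
  \sum_s \sum_t \sum_c \sum_d \sum_a \sum_b G a b c d s t.
  rewrite pair_bigA /= (eq_bigr (fun p => \sum_s \sum_t \sum_c \sum_d G p.1 p.2 c d s t)).
    rewrite exchange_big; apply: eq_bigr => s _; rewrite exchange_big; apply: eq_bigr => t _.
    rewrite exchange_big; apply: eq_bigr => c _; rewrite exchange_big; apply: eq_bigr => d _.
    by rewrite pair_bigA.
  move=> p _; rewrite [LHS]pair_bigA /= [RHS]pair_bigA /= exchange_big /=.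
  rewrite (eq_bigr (fun s => \sum_(t : 'I_k') \sum_(q : 'I_m * 'I_m) G p.1 p.2 q.1 q.2 s t)).
    rewrite pair_bigA; apply: eq_bigr => q _ /=; by rewrite pair_bigA.
  by move=> s _; rewrite exchange_big.
rewrite ex6; do 4 (apply: eq_bigr => ? _).
rewrite rmorph_sum !mulr_suml; apply: eq_bigr => a _.
by rewrite mulr_sumr; apply: eq_bigr => b _.
Qed.

Section QForm.
Variable R : realType.
Local Notation C := R[i].

Definition lfam (V : lmodType C) k (phi : V -> 'I_k -> 'I_k -> C) :=
  forall a b, linear (fun x => phi x a b : C^o).

Lemma kq_bilinear (V W : lmodType C) k m (phi : V -> 'I_k -> 'I_k -> C)
    (psi : W -> 'I_m -> 'I_m -> C) z w : lfam phi -> lfam psi ->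
  is_bilinear (fun s t => kq (phi s) (psi t) z w : C^o).
Proof.
move=> lp lq; split=> [t a x y|s a x y].
  by rewrite -[RHS]kq_linl; apply: eq_kq => // c d; exact: lp.
by rewrite -[RHS]kq_linr; apply: eq_kq => // c d; exact: lq.
Qed.

Section Fix.
Variables (V W : lmodType C) (n : nat) (X : 'M[tens V W]_n).

(** The form at [z] of the matrix obtained from [X] by applying [phi (x) psi] to
its entries. By [min_posE] the cone [min_pos] is read off these numbers. *)
Definition Q k m (phi : V -> 'I_k -> 'I_k -> C) (psi : W -> 'I_m -> 'I_m -> C)
    (z : 'I_n -> 'I_k -> 'I_m -> C) : C :=
  \sum_i \sum_j tens_lift (fun s t => kq (phi s) (psi t) (z i) (z j) : C^o) (X i j).

(** The left factors in a choice of decompositions of the entries of [X] into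
elementary tensors. *)
Definition lsupp : seq V := [seq p.1 | ij <- enum {: 'I_n * 'I_n}, p <- repr (X ij.1 ij.2)].
Definition rsupp : seq W := [seq p.2 | ij <- enum {: 'I_n * 'I_n}, p <- repr (X ij.1 ij.2)].

Variables (k m : nat) (z : 'I_n -> 'I_k -> 'I_m -> C).

(** [Q] depends on [phi] only through its values on a finite set. *)
Lemma Q_approxl (psi : W -> 'I_m -> 'I_m -> C) : exists2 K, 0 <= K &
  forall (phi phi' : V -> 'I_k -> 'I_k -> C) e, 0 <= e ->
    (forall x a b, x \in lsupp -> normc (phi x a b - phi' x a b) <= e) ->
    normc (Q phi psi z - Q phi' psi z) <= K * e.
Proof.
pose b t := \sum_c \sum_d normc (psi t c d).
pose N i j := \sum_a \sum_b \sum_c \sum_d normc (z i a c) * normc (z j b d).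
exists (\sum_i \sum_j \sum_(p <- repr (X i j)) b p.2 * N i j).
  do 2 (apply: sumr_ge0 => ? _); apply: sumr_ge0 => p _; apply: mulr_ge0.
    by do 2 (apply: sumr_ge0 => ? _); exact: normc_ge0.
  by do 4 (apply: sumr_ge0 => ? _); rewrite mulr_ge0 ?normc_ge0.
move=> phi phi' e e0 he; rewrite /Q -sumrB mulr_suml.
apply: le_trans (normc_sum _ _ _) _; apply: ler_sum => i _.
rewrite -sumrB mulr_suml; apply: le_trans (normc_sum _ _ _) _; apply: ler_sum => j _.
rewrite !tens_lift_sum -sumrB mulr_suml; apply: le_trans (normc_sum _ _ _) _.
rewrite !big_seq; apply: ler_sum => p pX.
rewrite -[X in _ - X]mul1r -mulNr addrC -kq_linl mulrC.
rewrite mulrA; apply: kq_bound => // [a c|c d].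
  rewrite mulN1r addrC; apply: he; apply/allpairsPdep; exists (i, j), p; split=> //.
  exact: mem_enum.
rewrite /b (bigD1 c)//= (bigD1 d)//= -addrA lerDl addr_ge0//.
  by apply: sumr_ge0 => ? _; exact: normc_ge0.
by do 2 (apply: sumr_ge0 => ? _); exact: normc_ge0.
Qed.

Lemma Q_approxr (phi : V -> 'I_k -> 'I_k -> C) : exists2 K, 0 <= K &
  forall (psi psi' : W -> 'I_m -> 'I_m -> C) e, 0 <= e ->
    (forall x a b, x \in rsupp -> normc (psi x a b - psi' x a b) <= e) ->
    normc (Q phi psi z - Q phi psi' z) <= K * e.
Proof.
pose b t := \sum_c \sum_d normc (phi t c d).
have b0 t : 0 <= b t by do 2 (apply: sumr_ge0 => ? _); exact: normc_ge0.
pose N i j := \sum_a \sum_b \sum_c \sum_d normc (z i a c) * normc (z j b d).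
exists (\sum_i \sum_j \sum_(p <- repr (X i j)) b p.1 * N i j).
  do 2 (apply: sumr_ge0 => ? _); apply: sumr_ge0 => p _; apply: mulr_ge0 => //.
  by do 4 (apply: sumr_ge0 => ? _); rewrite mulr_ge0 ?normc_ge0.
move=> psi psi' e e0 he; rewrite /Q -sumrB mulr_suml.
apply: le_trans (normc_sum _ _ _) _; apply: ler_sum => i _.
rewrite -sumrB mulr_suml; apply: le_trans (normc_sum _ _ _) _; apply: ler_sum => j _.
rewrite !tens_lift_sum -sumrB mulr_suml; apply: le_trans (normc_sum _ _ _) _.
rewrite !big_seq; apply: ler_sum => p pX.
rewrite -[X in _ - X]mul1r -mulNr addrC -kq_linr mulrAC.
apply: kq_bound => // [c d|a c].
  rewrite /b (bigD1 c)//= (bigD1 d)//= -addrA lerDl addr_ge0//.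
    by apply: sumr_ge0 => ? _; exact: normc_ge0.
  by do 2 (apply: sumr_ge0 => ? _); exact: normc_ge0.
rewrite mulN1r addrC; apply: he; apply/allpairsPdep; exists (i, j), p; split=> //.
exact: mem_enum.
Qed.
End Fix.

Lemma Q_map (V W V' W' : lmodType C) n (X : 'M[tens V W]_n) (f : V -> V') (g : W -> W')
    k m (phi : V' -> 'I_k -> 'I_k -> C) (psi : W' -> 'I_m -> 'I_m -> C) z :
  linear f -> linear g -> lfam phi -> lfam psi ->
  Q (map_mx (tens_map f g) X) phi psi z = Q X (phi \o f) (psi \o g) z.
Proof.
move=> lf lg lp lq; apply: eq_bigr => i _; apply: eq_bigr => j _.
by rewrite mxE (tens_map_lift lf lg (X := C^o))//; exact: kq_bilinear.
Qed.

Lemma eq_Q (V W : lmodType C) n (X : 'M[tens V W]_n) k m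
    (phi phi' : V -> 'I_k -> 'I_k -> C) (psi psi' : W -> 'I_m -> 'I_m -> C) z :
  (forall x a b, phi x a b = phi' x a b) -> (forall x a b, psi x a b = psi' x a b) ->
  Q X phi psi z = Q X phi' psi' z.
Proof.
move=> h h'; apply: eq_bigr => i _; apply: eq_bigr => j _.
by rewrite !tens_lift_sum; apply: eq_bigr => p _; apply: eq_kq.
Qed.

Lemma lfam_ucp (S : opsys R) k (f : S -> 'M[C]_k) : ucp_mx f -> lfam (fun x => f x).
Proof. by move=> [lf _ _] a b c x y; rewrite lf !mxE. Qed.

Lemma sum_mxtens k m (G : 'I_(k * m) -> C) :
  \sum_A G A = \sum_a \sum_c G (mxtens_index (a, c)).
Proof.
rewrite pair_bigA (reindex (fun p : 'I_k * 'I_m => mxtens_index p)) /=.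
  by apply: eq_bigr => -[].
by exists (@mxtens_unindex k m) => p _; [exact: mxtens_indexK|exact: mxtens_unindexK].
Qed.

Lemma min_posE (S T : opsys R) n (X : 'M[tens S T]_n) : min_pos X <->
  forall k m (f : S -> 'M[C]_k) (g : T -> 'M[C]_m), ucp_mx f -> ucp_mx g ->
    forall z, 0 <= Q X (fun s => f s) (fun t => g t) z.
Proof.
have E k m (f : S -> 'M[C]_k) (g : T -> 'M[C]_m) z :
   qform (fun i j => map_mx (tens_lift (fun s t => f s *t g t)) X i j) z =
   Q X (fun s => f s) (fun t => g t) (fun i a c => z i (mxtens_index (a, c))).
  apply: eq_bigr => i _; apply: eq_bigr => j _.
  rewrite mxE !tens_lift_sum.
  have -> : \sum_a \sum_b (z i a)^* * (\sum_(p <- repr (X i j)) (f p.1 *t g p.2)) a b * z j b =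
    \sum_(p <- repr (X i j)) \sum_a \sum_b (z i a)^* * (f p.1 *t g p.2) a b * z j b.
    rewrite [RHS]exchange_big; apply: eq_bigr => a _; rewrite [RHS]exchange_big; apply: eq_bigr => b _.
    by rewrite summxE mulr_sumr mulr_suml.
  apply: eq_bigr => p _; rewrite sum_mxtens /kq; apply: eq_bigr => a _.
  rewrite [RHS]exchange_big; apply: eq_bigr => c _.
  rewrite sum_mxtens; apply: eq_bigr => b _; apply: eq_bigr => d _.
  by rewrite tensmxE.
split=> h k m f g hf hg.
  move=> z; have /mx_posE/(_ (fun i A => z i (mxtens_unindex A).1 (mxtens_unindex A).2)) := h _ _ f g hf hg.
  rewrite E; congr (0 <= _); apply: eq_bigr => i _; apply: eq_bigr => j _.
  rewrite !tens_lift_sum; apply: eq_bigr => p _; do 4 (apply: eq_bigr => ? _).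
  by rewrite !mxtens_indexK.
by apply/mx_posE => z; rewrite E; exact: h.
Qed.
End QForm.

Section MinPositivity.
Variable R : realType.
Local Notation C := R[i].

Lemma ge0C_limit (x : C) :
  (forall e : R, 0 < e -> exists2 y, 0 <= y & normc (x - y) <= e) -> 0 <= x.
Proof.
move=> h; apply: ge0C_approx => e /h[y /ge0C[y0 yi] hy]; exists (Re y) => //.
by rewrite (_ : (Re y)%:C = y)//; exact: eqCri.
Qed.

Lemma le_rescaled (x y : C) K (e : R) : 0 <= K -> 0 < e ->
  normc (x - y) <= K * (e / (K + 1)) -> normc (x - y) <= e.
Proof.
move=> K0 e0; move/le_trans; apply; have K1 : 0 < K + 1 by lra.
by rewrite mulrCA ler_piMr ?(ltW e0)// ler_pdivrMr// mul1r lerDl.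
Qed.

Lemma Q_suml (V W : lmodType C) n (X : 'M[tens V W]_n) k m (I : Type) (r : seq I)
    (phi : I -> V -> 'I_k -> 'I_k -> C) (psi : W -> 'I_m -> 'I_m -> C) z :
  Q X (fun x a b => \sum_(i <- r) phi i x a b) psi z = \sum_(i <- r) Q X (phi i) psi z.
Proof.
rewrite [RHS]exchange_big; apply: eq_bigr => i _; rewrite [RHS]exchange_big; apply: eq_bigr => j _.
rewrite tens_lift_sum [RHS]exchange_big; apply: eq_bigr => p _; exact: kq_suml.
Qed.

Lemma Q_sumr (V W : lmodType C) n (X : 'M[tens V W]_n) k m (I : Type) (r : seq I)
    (phi : V -> 'I_k -> 'I_k -> C) (psi : I -> W -> 'I_m -> 'I_m -> C) z :
  Q X phi (fun x a b => \sum_(i <- r) psi i x a b) z = \sum_(i <- r) Q X phi (psi i) z.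
Proof.
rewrite [RHS]exchange_big; apply: eq_bigr => i _; rewrite [RHS]exchange_big; apply: eq_bigr => j _.
rewrite tens_lift_sum [RHS]exchange_big; apply: eq_bigr => p _; exact: kq_sumr.
Qed.

(** Injectivity of the minimal tensor product: a ucp map on [S] is approximated
by vector maps, which extend to [S']. *)
Lemma min_pos_pullback (S S' T : opsys R) (i : S -> S')
    (hi : unital_complete_order_embedding i) n (X : 'M[tens S T]_n) :
  min_pos (map_mx (tens_map i id) X) -> min_pos X.
Proof.
move=> hX; apply/min_posE => k m f g hf hg z; apply: ge0C_limit => e e0.
have [li i1 iP] := hi; have lid : linear (id : T -> T) by [].
have [K K0 hK] := Q_approxl X z (fun t => g t).
have K1 : 0 < e / (K + 1) by rewrite divr_gt0// ltr_wpDl.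
have [l hl] := vec_approx hi hf (lsupp X) K1.
exists (Q X (fun x => vec_map l (i x)) (fun t => g t) z); last first.
  by apply: (le_rescaled K0 e0); apply: hK (ltW K1) _; exact: hl.
have [k' [F [cs [hF hcs]]]] := vec_map_compress l.
rewrite (eq_Q X (phi' := fun x a b => \sum_(w <- cs) \sum_c \sum_d (w c a)^* * F (i x) c d * w d b)
  (psi' := fun t => g t))//.
rewrite Q_suml; apply: sumr_ge0 => w _.
rewrite [X in 0 <= X](_ : _ = Q (map_mx (tens_map i id) X) (fun s => F s) (fun t => g t)
   (fun n c t => \sum_a w c a * z n a t)).
  by move/min_posE: hX; apply.
rewrite Q_map//; [|exact: lfam_ucp|exact: lfam_ucp].
apply: eq_bigr => i' _; apply: eq_bigr => j' _; rewrite !tens_lift_sum.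
by apply: eq_bigr => p _; exact: kq_compress.
Qed.

Section SpatialMin.
Variables (A B : cstar R).
Local Notation H := (os_hilb A).
Local Notation K := (os_hilb B).

Lemma spat_vec n (X : 'M[tens A B]_n) k m (v : 'I_k -> H) (w : 'I_m -> K) z :
  os_pos (map_mx (@spat R A B) X) ->
  0 <= Q X (fun x a b => hdot H (x (v b)) (v a)) (fun t c d => hdot K (t (w d)) (w c)) z.
Proof.
have hT := hdotP (tensor_hilbert H K).
pose e a c : tensor_hilbert H K := emb (tens_pure (v a) (w c) : tensor_pre H K).
move=> /(_ (fun i => \sum_a \sum_c z i a c *: e a c)); congr (0 <= _).
apply: eq_bigr => i _; apply: eq_bigr => j _; rewrite mxE.
have lu : linear (os_val (spat (X i j))) by exact: os_linear.
transitivity (\sum_a \sum_b \sum_c \sum_d (z i a c)^* * z j b d *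
    hdot (tensor_hilbert H K) (spat (X i j) (e b d)) (e a c)).
  rewrite (hf_sumr hT); apply: eq_bigr => a _; rewrite [RHS]exchange_big (hf_sumr hT).
  apply: eq_bigr => c _; rewrite (hfZr hT) (lin_sum lu) (hf_suml hT) mulr_sumr.
  apply: eq_bigr => b _; rewrite (lin_sum lu) (hf_suml hT) mulr_sumr.
  by apply: eq_bigr => d _; rewrite (linZ lu) (hfZ hT) mulrA.
rewrite tens_lift_sum /kq.
rewrite [RHS]exchange_big; apply: eq_bigr => a _ /=.
rewrite [RHS]exchange_big; apply: eq_bigr => b _ /=.
rewrite [RHS]exchange_big; apply: eq_bigr => c _ /=.
rewrite [RHS]exchange_big; apply: eq_bigr => d _ /=.
rewrite [X in _ * X](spat_hdot (X i j) (v b) (w d) (v a) (w c)) tens_lift_sum mulr_sumr; apply: eq_bigr => p _.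
by rewrite /=; ring.
Qed.

(** Once [f] and [g] are replaced by vector maps, [Q] becomes a matrix
coefficient of the spatial representation. *)
Lemma spat_min (S T : opsys R) (i : S -> A) (j : T -> B)
    (hi : unital_complete_order_embedding i) (hj : unital_complete_order_embedding j)
    n (X : 'M[tens S T]_n) :
  os_pos (map_mx (@spat R A B) (map_mx (tens_map i j) X)) -> min_pos X.
Proof.
move=> hX; apply/min_posE => k m f g hf hg z; apply: ge0C_limit => e e0.
have [li i1 iP] := hi; have [lj j1 jP] := hj.
have e2 : 0 < e / 2 by rewrite divr_gt0.
have [M M0 hM] := Q_approxl X z (fun t => g t).
have M1 : 0 < e / 2 / (M + 1) by rewrite divr_gt0// ltr_wpDl.
have [l hl] := vec_approx hi hf (lsupp X) M1.
have [N N0 hN] := Q_approxr X z (fun x => vec_map l (i x)).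
have N1 : 0 < e / 2 / (N + 1) by rewrite divr_gt0// ltr_wpDl.
have [l' hl'] := vec_approx hj hg (rsupp X) N1.
exists (Q X (fun x => vec_map l (i x)) (fun t => vec_map l' (j t)) z); last first.
  rewrite -(subrKA (Q X (fun x => vec_map l (i x)) (fun t => g t) z)).
  apply: le_trans (normcD _ _) _; rewrite [e]splitr; apply: lerD.
    by apply: (le_rescaled M0 e2); apply: hM (ltW M1) _; exact: hl.
  by apply: (le_rescaled N0 e2); apply: hN (ltW N1) _; exact: hl'.
rewrite /vec_map Q_suml; apply: sumr_ge0 => v _; rewrite Q_sumr; apply: sumr_ge0 => w _.
have := spat_vec v w z hX; rewrite Q_map//.
  by move=> a b c x y; rewrite os_valL (hfP (hdotP _)).
by move=> a b c x y; rewrite os_valL (hfP (hdotP _)).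
Qed.
End SpatialMin.
End MinPositivity.

(** * Dimension-free bounds *)

Section MatrixBounds.
Variable R : realType.
Local Notation C := R[i].

(** The operator norm of [A] on the Hilbert space [C^k] is at most [p]. *)
Definition mbnd k (A : 'I_k -> 'I_k -> C) (p : R) :=
  forall c : 'I_k -> C, sn (@l2dot R _) (fun a => \sum_b A a b * c b) <= p * sn (@l2dot R _) c.

Lemma sqr_l2 (J : finType) (c : J -> C) :
  sn (@l2dot R J) c ^+ 2 = \sum_j normc (c j) ^+ 2.
Proof.
rewrite (sqr_sn (l2dotH R J)) /l2dot Re_sum; apply: eq_bigr => j _.
by rewrite -normCK normCE -rmorphXn.
Qed.

Lemma sn_pair k m (z : 'I_k -> 'I_m -> C) :
  sn (@l2dot R ('I_k * 'I_m)%type) (fun p => z p.1 p.2) ^+ 2 = \sum_a sn (@l2dot R _) (z a) ^+ 2.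
Proof.
rewrite sqr_l2 -(pair_bigA _ (fun a c => normc (z a c) ^+ 2)); apply: eq_bigr => a _.
by rewrite sqr_l2.
Qed.

(** As for [ucp_like_star], by the positivity of the matrix in [os_pos22]. *)
Lemma ucp_mx_mbnd (S : opsys R) k (f : S -> 'M[C]_k) (x : S) M :
  ucp_mx f -> bnd x M -> mbnd (fun a b => f x a b) M.
Proof.
move=> hf xM c; have [M0 _] := xM; have hl := l2dotH R 'I_k.
set fc := (X in sn _ X <= _).
have := sn_ge0 (@l2dot R _) fc; rewrite le_eqVlt => /orP[/eqP <-|a0].
  by rewrite mulr_ge0 ?sn_ge0.
have key (xi eta : 'I_k -> C) : 0 <= M * sn (@l2dot R _) xi ^+ 2 + M * sn (@l2dot R _) eta ^+ 2
    + 2 * Re (\sum_a \sum_b (xi a)^* * f x a b * eta b).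
  case: (hf) => lf f1 fP.
  have /fP := os_pos22 xM; rewrite map_mx22 !(linZ lf) f1 => /mx_posE h.
  have := h (fun i => if i == ord0 then xi else eta).
  rewrite /qform sum22 !mx22E eqxx (_ : (ord_max == ord0 :> 'I_2) = false)//.
  have dg (v : 'I_k -> C) : \sum_a \sum_b (v a)^* * (M%:C *: (1%:M : 'M[C]_k)) a b * v b =
      (M * sn (@l2dot R _) v ^+ 2)%:C.
    transitivity (M%:C * l2dot v v); last by rewrite (hf_diag hl) -rmorphM.
    rewrite /l2dot mulr_sumr; apply: eq_bigr => a _.
    rewrite (bigD1 a)//= big1 ?addr0 => [|b]; rewrite !mxE; first by rewrite eqxx mulr1n; ring.
    by rewrite eq_sym => /negPf ->; rewrite mulr0n mulr0 mulr0 mul0r.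
  have -> : \sum_a \sum_b (eta a)^* * f (os_star x) a b * xi b =
      (\sum_a \sum_b (xi a)^* * f x a b * eta b)^*.
    rewrite rmorph_sum exchange_big; apply: eq_bigr => b _.
    rewrite rmorph_sum; apply: eq_bigr => a _.
    by rewrite (ucp_mx_star hf) !rmorphM /= conjCK; ring.
  by rewrite !dg => /ge0C[+ _]; rewrite !CE /=; lra.
pose t := sn (@l2dot R _) c / sn (@l2dot R _) fc.
have c0 : 0 < sn (@l2dot R _) c.
  rewrite lt_neqAle sn_ge0 andbT eq_sym; apply/eqP => e0.
  suff e1 : fc = 0 by rewrite e1 (sn0 hl) ltxx in a0.
  apply/funext => a; rewrite /fc big1// => b _.
  have := l2_coord c b; rewrite e0 => h.
  by rewrite (_ : c b = 0) ?mulr0//; apply: eq0_normc; apply/eqP; rewrite eq_le h normc_ge0.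
have t0 : 0 < t by rewrite divr_gt0.
have := key (- t%:C *: fc) c.
have -> : \sum_a \sum_b ((- t%:C *: fc) a)^* * f x a b * c b =
    - (t * sn (@l2dot R _) fc ^+ 2)%:C.
  transitivity (- t%:C * l2dot fc fc); last by rewrite (hf_diag hl) mulNr -rmorphM.
  rewrite /l2dot mulr_sumr; apply: eq_bigr => a _.
  have -> : ((- t%:C *: fc) a)^* = - t%:C * (fc a)^*.
    by rewrite -[(- t%:C *: fc) a]/(- t%:C * fc a); apply: eqCri; rewrite !CE /=; ring.
  rewrite {3}/fc mulr_suml mulr_sumr; apply: eq_bigr => b _; ring.
rewrite (snZ hl) normcN normc_real ger0_norm ?(ltW t0)//.
have e1 : t * sn (@l2dot R _) fc ^+ 2 = sn (@l2dot R _) c * sn (@l2dot R _) fc.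
  by rewrite expr2 mulrA /t divfK// gt_eqF.
have e2 : t * sn (@l2dot R _) fc = sn (@l2dot R _) c by rewrite /t divfK// gt_eqF.
rewrite e1 e2 ReN /= => h; rewrite -(ler_pM2r c0); move: h; rewrite !expr2; lra.
Qed.

(** [A] and [B] are applied one after the other. In contrast with [kq_bound],
nothing depends on [k] and [m], which makes the bound uniform over all pairs of
ucp maps. *)
Lemma kq_mbnd k m (A : 'I_k -> 'I_k -> C) (B : 'I_m -> 'I_m -> C) z w p q :
  0 <= p -> 0 <= q -> mbnd A p -> mbnd B q ->
  normc (kq A B z w) <= p * q * (sn (@l2dot R ('I_k * 'I_m)%type) (fun x => z x.1 x.2) *
                                 sn (@l2dot R ('I_k * 'I_m)%type) (fun x => w x.1 x.2)).
Proof.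
move=> p0 q0 hA hB.
pose w1 b c := \sum_d B c d * w b d.
pose w2 a c := \sum_b A a b * w1 b c.
have n1 : sn (@l2dot R ('I_k * 'I_m)%type) (fun x => w1 x.1 x.2) <=
    q * sn (@l2dot R ('I_k * 'I_m)%type) (fun x => w x.1 x.2).
  rewrite -(@ler_pXn2r _ 2) ?nnegrE ?mulr_ge0 ?sn_ge0// exprMn !sn_pair mulr_sumr.
  apply: ler_sum => b _; rewrite -exprMn ler_pXn2r ?nnegrE ?mulr_ge0 ?sn_ge0//.
  exact: hB.
have swap (v : 'I_k -> 'I_m -> C) : sn (@l2dot R ('I_k * 'I_m)%type) (fun x => v x.1 x.2) ^+ 2 =
    \sum_c sn (@l2dot R _) (v^~ c) ^+ 2.
  rewrite sn_pair (eq_bigr (fun a => \sum_c normc (v a c) ^+ 2)) => [|a _]; last by rewrite sqr_l2.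
  by rewrite exchange_big; apply: eq_bigr => c _; rewrite sqr_l2.
have n2 : sn (@l2dot R ('I_k * 'I_m)%type) (fun x => w2 x.1 x.2) <=
    p * sn (@l2dot R ('I_k * 'I_m)%type) (fun x => w1 x.1 x.2).
  rewrite -(@ler_pXn2r _ 2) ?nnegrE ?mulr_ge0 ?sn_ge0// exprMn !swap mulr_sumr.
  apply: ler_sum => c _; rewrite -exprMn ler_pXn2r ?nnegrE ?mulr_ge0 ?sn_ge0//.
  exact: hA.
have -> : kq A B z w = l2dot (fun x : 'I_k * 'I_m => w2 x.1 x.2) (fun x => z x.1 x.2).
  rewrite /l2dot -(pair_bigA _ (fun a c => w2 a c * (z a c)^*)) /=; apply: eq_bigr => a _.
  rewrite exchange_big; apply: eq_bigr => c _ /=.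
  rewrite /w2 mulr_suml; apply: eq_bigr => b _.
  by rewrite /w1 mulr_sumr mulr_suml; apply: eq_bigr => d _; ring.
apply: le_trans (hf_CS (l2dotH R _) _ _) _.
rewrite mulrC mulrCA; apply: ler_wpM2l; first exact: sn_ge0.
by apply: le_trans n2 _; rewrite -mulrA ler_wpM2l.
Qed.

End MatrixBounds.

Section Approximation.
Variable R : realType.
Local Notation C := R[i].
Variables (S : nat -> opsys R) (u : forall n, S n -> S n.+1).
Variables (L : opsys R) (l : forall n, S n -> L).
Hypothesis lu : forall n (s : S n), l s = l (u s).
Hypothesis ldense : norm_dense (S := L) (\bigcup_n range (@l n)).

Lemma lift_up N m (s : S N) : (N <= m)%N -> exists s' : S m, l s' = l s.
Proof.
elim: m => [|m IH]; first by rewrite leqn0 => /eqP e; subst N; exists s.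
rewrite leq_eqVlt => /orP[/eqP e|]; first by subst N; exists s.
by rewrite ltnS => /IH[s' <-]; exists (u s'); rewrite -lu.
Qed.

Lemma approx_list (E : seq L) e : 0 < e ->
  exists N, exists sg : L -> S N, forall x, x \in E -> bnd (x - l (sg x)) e.
Proof.
move=> e0; suff [N hN] : exists N, forall x, x \in E -> exists s : S N, bnd (x - l s) e.
  exists N; have h x : exists s : S N, x \in E -> bnd (x - l s) e.
    have [/hN[s hs]|nE] := boolP (x \in E); first by exists s.
    by exists 0.
  by exists (fun x => sval (cid (h x))) => x; case: cid.
elim: E => [|x E [N IH]]; first by exists 0%N.
have [|_ [n _ [s _ <-]] hs] := @ldense x e%:C; first by rewrite ltcR.
move/opnorm_leR: hs => hs; exists (maxn N n) => y; rewrite inE => /orP[/eqP ->|/IH[t ht]].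
  by have [s' e'] := lift_up s (leq_maxr N n); exists s'; rewrite e'.
by have [s' e'] := lift_up t (leq_maxl N n); exists s'; rewrite e'.
Qed.
End Approximation.

(** * The limit inside an ultraproduct *)

Section Ultraproduct.
Variable R : realType.
Local Notation C := R[i].
Variable A : nat -> cstar R.
Variable pp : forall n, A n -> A n.+1.
Arguments pp : clear implicits.
Hypothesis hpp : forall n, star_hom (pp n).

(** The image of [a] in [A m] for [m >= N], and 0 for [m < N]; a limit along a
free ultrafilter does not see the first indices. *)
Definition push N (a : A N) : forall m, A m :=
  fix F m := match m with
  | 0 => if pselect (N = 0%N) is left e then ecast m (A m) e a else 0
  | m'.+1 => if pselect (N = m'.+1) is left e then ecast m (A m) e a else pp m' (F m')
  end.

Lemma push_diag N (a : A N) : push a N = a.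
Proof.
by case: N a => [|N] a /=; case: pselect => // e; rewrite (eq_irrelevance e erefl).
Qed.

Lemma pushS N (a : A N) m : (N <= m)%N -> push a m.+1 = pp m (push a m).
Proof. by move=> Nm /=; case: pselect => // e; rewrite e ltnn in Nm. Qed.

Lemma push_lt N (a : A N) m : (m < N)%N -> push a m = 0.
Proof.
elim: m => [|m IH] mN /=; case: pselect => [e|_] //.
- by exfalso; move: mN; rewrite e.
- by exfalso; move: mN; rewrite e ltnn.
- by rewrite IH ?(ltnW mN)//; case: (hpp m) => lp _ _ _; rewrite (lin0 lp).
Qed.

Lemma pushE N m : (forall a : A N, push a m = 0) \/ star_hom (fun a : A N => push a m).
Proof.
have [mN|Nm] := ltnP m N; first by left => a; exact: push_lt.
right; rewrite -(subnK Nm); elim: (m - N)%N => [|k IH].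
  rewrite add0n; have -> : (fun a : A N => push a N) = id by apply/funext => a; rewrite push_diag.
  by split.
have -> : (fun a : A N => push a (k.+1 + N)%N) = fun a => pp (k + N)%N (push a (k + N)%N).
  by apply/funext => a; exact: (pushS a (leq_addl k N)).
case: IH => l1 o1 m1 s1; case: (hpp (k + N)%N) => l2 o2 m2 s2; split.
- exact: (lin_comp l1 l2).
- by rewrite o1 o2.
- by move=> x y; rewrite m1 m2.
- by move=> x; rewrite s1 s2.
Qed.

Lemma push_lin N m c (a b : A N) : push (c *: a + b) m = c *: push a m + push b m.
Proof.
have [h|[l _ _ _]] := pushE N m; last exact: l.
by rewrite !h scaler0 addr0.
Qed.
Lemma push_mul N m (a b : A N) : push (cs_mul a b) m = cs_mul (push a m) (push b m).
Proof.
have [h|[_ _ l _]] := pushE N m; last exact: l.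
by rewrite !h; apply: os_eq.
Qed.
Lemma push_star N m (a : A N) : push (os_star a) m = os_star (push a m).
Proof.
have [h|[_ _ _ l]] := pushE N m; last exact: l.
by rewrite !h os_star0.
Qed.
Lemma push1 N m : (N <= m)%N -> push (os_one (A N)) m = os_one (A m).
Proof.
move=> Nm; rewrite -(subnK Nm); elim: (m - N)%N => [|k IH]; first by rewrite add0n push_diag.
by rewrite addSn pushS ?leq_addl// IH; case: (hpp (k + N)%N).
Qed.
Lemma push_bnd N (a : A N) M : bnd a M -> forall m, bnd (push a m) M.
Proof.
move=> aM m; have [M0 _] := aM; have [h|h] := pushE N m; last exact: (star_hom_bnd h aM).
by rewrite h; apply: bndW (bnd0 _).
Qed.
Lemma push_comp N (a : A N) m : (N < m)%N -> push (pp N a) m = push a m.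
Proof.
move=> Nm; rewrite -(subnK Nm); elim: (m - N.+1)%N => [|k IH].
  by rewrite add0n push_diag pushS// push_diag.
by rewrite addSn !pushS ?leq_addl ?IH// (leq_trans (leqnSn N)) ?leq_addl.
Qed.

Local Notation H := (fun m => os_hilb (A m)).
Local Notation P := (family_pre (ultra_sum R) H).
Local Notation K := (family_hilbert (ultra_sum R) H).

(** An ultraproduct does not see finitely many indices. *)
Lemma fam_rep_tail (d d' : forall m, A m) N : ubd d -> ubd d' ->
  (forall m, (N <= m)%N -> d m = d' m) ->
  fam_rep (ultra_sum R) d = fam_rep (ultra_sum R) d'.
Proof.
move=> h h' dd; apply: fam_rep_ext => // v; rewrite fam_rep_emb//.
apply: completion_eq => w; apply: clim_unique => e e0.
set z := fun m : nat => hdot (H m) (fapp (pop (M := ultra_sum R) (fun i => os_val (d i)) v) m) (fapp w m).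
have zb : ubounded z := bounded_dom_ub (fdot_dom (M := ultra_sum R) (H := H) (pop (M := ultra_sum R) (fun i => os_val (d i)) v) w).
have tl : free_ultra [set m | (N <= m)%N] by apply: (@free_ultra_tail _ N).
have := free_ultraP; move=> uP.
apply: filterS (filterI tl (climP zb e0)) => m /= [Nm]; rewrite /z /= !popE// dd//.
Qed.

(** The representation of [A N] on the ultraproduct of the Hilbert spaces of the
[A m]. *)
Definition upi N (a : A N) : BH K := fam_rep (ultra_sum R) (push a).

Lemma push_ubd N (a : A N) : ubd (push a).
Proof.
have [M aM] := os_bnd a; exists M; first by have [] := aM.
exact: push_bnd.
Qed.

Lemma upi_hom N : star_hom (@upi N).
Proof.
have E (a : A N) d : (forall m, push a m = d m) -> upi a = fam_rep (ultra_sum R) d.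
  by move=> h; congr fam_rep; apply: functional_extensionality_dep.
split.
- move=> c a b; rewrite -(fam_rep_lin _ c (push_ubd a) (push_ubd b)).
  by apply: E => m; exact: push_lin.
- rewrite -fam_rep1; apply: (fam_rep_tail (N := N)) => //; first exact: push_ubd.
    by exists 1 => // m; exact: bnd_id.
  by move=> m; exact: push1.
- move=> a b; rewrite -(fam_rep_mul _ (push_ubd a) (push_ubd b)).
  by apply: E => m; exact: push_mul.
- move=> a; rewrite -(fam_rep_star _ (push_ubd a)).
  by apply: E => m; exact: push_star.
Qed.

Lemma upi_comp N (a : A N) : upi (pp N a) = upi a.
Proof.
apply: (fam_rep_tail (N := N.+1)); try exact: push_ubd.
by move=> m; exact: push_comp.
Qed.
End Ultraproduct.

Section PosTools.
Variable R : realType.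
Local Notation C := R[i].

Lemma embedding_comp (S T U : opsys R) (f : S -> T) (g : T -> U) :
  unital_complete_order_embedding f -> unital_complete_order_embedding g ->
  unital_complete_order_embedding (g \o f).
Proof.
move=> [lf f1 fP] [lg g1 gP]; split; first exact: lin_comp.
  by rewrite /= f1 g1.
by move=> n X; rewrite map_mx_comp gP fP.
Qed.

Lemma embedding_id (S : opsys R) : unital_complete_order_embedding (id : S -> S).
Proof. by split=> // n X; rewrite map_mx_id. Qed.

Section Oform.
Variable H : hilbert R.
Let hs := hdotP H.

Definition oform n (F : 'I_n -> 'I_n -> H -> H) (xi : 'I_n -> H) : C :=
  \sum_i \sum_j hdot H (F i j (xi j)) (xi i).

Definition sqsum n (xi : 'I_n -> H) : R := \sum_i hn (xi i) ^+ 2.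

Lemma sqsum_ge0 n (xi : 'I_n -> H) : 0 <= sqsum xi.
Proof. by apply: sumr_ge0 => i _; exact: sqr_ge0. Qed.

Lemma hn_sqsum n (xi : 'I_n -> H) i j : hn (xi i) * hn (xi j) <= sqsum xi.
Proof.
have h k : hn (xi k) ^+ 2 <= sqsum xi.
  by rewrite /sqsum (bigD1 k)//= lerDl; apply: sumr_ge0 => l _; exact: sqr_ge0.
have := h i; have := h j; have := sqr_ge0 (hn (xi i) - hn (xi j)); nra.
Qed.

Lemma oform_bound n (F : 'I_n -> 'I_n -> H -> H) e xi : (forall i j, bnd (F i j) e) ->
  normc (oform F xi) <= n%:R * n%:R * e * sqsum xi.
Proof.
move=> he; apply: le_trans (_ : \sum_(i < n) \sum_(j < n) e * sqsum xi <= _).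
  apply: le_trans (normc_sum _ _ _) _; apply: ler_sum => i _.
  apply: le_trans (normc_sum _ _ _) _; apply: ler_sum => j _.
  have [e0 h] := he i j; apply: le_trans (hf_CS hs _ _) _.
  apply: le_trans (_ : e * hn (xi j) * hn (xi i) <= _).
    by rewrite ler_wpM2r ?hn_ge0 ?h.
  by rewrite -mulrA ler_wpM2l// hn_sqsum.
by rewrite !sumr_const !card_ord -mulrnA -[leLHS]mulr_natl natrM !mulrA.
Qed.

Lemma oform_diag n c (xi : 'I_n -> H) :
  oform (fun i j => (c * (i == j)%:R) *: (id : H -> H)) xi = c * (sqsum xi)%:C.
Proof.
rewrite /sqsum rmorph_sum mulr_sumr; apply: eq_bigr => i _.
rewrite (bigD1 i)//= big1 ?addr0 => [|j]; last first.
  rewrite eq_sym => /negPf ->; rewrite mulr0.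
  by rewrite -[(0 *: _) _]/(0 *: xi j) scale0r (hf0 hs).
by rewrite eqxx mulr1 -[(c *: _) _]/(c *: xi i) (hfZ hs) hdot_sqr.
Qed.

Lemma oformD n (F G : 'I_n -> 'I_n -> H -> H) xi :
  oform (fun i j => F i j + G i j) xi = oform F xi + oform G xi.
Proof.
rewrite /oform -big_split; apply: eq_bigr => i _; rewrite -big_split.
by apply: eq_bigr => j _; rewrite /= -(hfD hs).
Qed.

Lemma oform_star n (F G : 'I_n -> 'I_n -> H -> H) xi : (forall i j, adjoint (F i j) (G j i)) ->
  oform G xi = (oform F xi)^*.
Proof.
move=> h; rewrite /oform rmorph_sum exchange_big; apply: eq_bigr => i _.
rewrite rmorph_sum; apply: eq_bigr => j _ /=.
by rewrite -[RHS](hfC hs); exact: (adjoint_sym (h i j)).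
Qed.
End Oform.

Lemma clim_sum (I : Type) (r : seq I) (z : I -> nat -> C) :
  (forall i, ubounded (z i)) ->
  ubounded (fun n => \sum_(i <- r) z i n) /\
  clim (fun n => \sum_(i <- r) z i n) = \sum_(i <- r) clim (z i).
Proof.
move=> h; have uP := @free_ultraP; elim: r => [|i r [IH1 IH2]].
  split; first by exists 0; apply: (@free_ultra_tail _ 0) => n _ /=; rewrite big_nil normc0.
  rewrite big_nil; apply: clim_unique => e e0; apply: (@free_ultra_tail _ 0) => n _ /=.
  by rewrite big_nil subrr normc0 ltW.
have -> : (fun n => \sum_(j <- i :: r) z j n) = fun n => z i n + \sum_(j <- r) z j n.
  by apply/funext => n; rewrite big_cons.
split; last by rewrite climD// big_cons IH2.
have [M hM] := h i; have [N hN] := IH1; exists (M + N).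
by apply: filterS (filterI hM hN) => n /= [h1 h2]; apply: le_trans (normcD _ _) (lerD h1 h2).
Qed.

Lemma oform_dense (P : prehilbert R) n (F : 'I_n -> 'I_n -> completion_hilbert P -> completion_hilbert P) M :
  (forall i j, linear (F i j)) -> (forall i j, bnd (F i j) M) ->
  (forall v : 'I_n -> P, 0 <= oform F (fun i => emb (v i) : completion P)) ->
  forall xi, 0 <= oform F xi.
Proof.
move=> lF hM pos xi; set K := completion_hilbert P in F lF hM pos xi *.
have hs := hdotP K; case: n F xi lF hM pos => [|n] F xi lF hM pos.
  by rewrite /oform big_ord0.
have [M0 _] := hM ord0 ord0.
pose r := \sum_i hn (xi i).
have rP i : hn (xi i) <= r.
  by rewrite /r (bigD1 i)//= lerDl; apply: sumr_ge0 => j _; exact: hn_ge0.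
have r0 : 0 <= r by apply: sumr_ge0 => i _; exact: hn_ge0.
pose c := n.+1%:R * n.+1%:R * (M * (2 * r + 1)).
have c0 : 0 <= c by rewrite !mulr_ge0// addr_ge0// mulr_ge0.
apply: ge0C_limit => e e0.
pose d := Order.min 1 (e / (c + 1)).
have d0 : 0 < d by rewrite lt_min ltr01 divr_gt0// ltr_wpDl.
have d1 : d <= 1 by rewrite ge_min lexx.
have de : d <= e / (c + 1) by rewrite ge_min lexx orbT.
have [v hv] : {v : 'I_n.+1 -> P & forall i, hn (xi i - emb (v i) : K) <= d}.
  have hv i : exists v, hn (xi i - emb v : K) <= d by exact: hn_emb_dense.
  by exists (fun i => sval (cid (hv i))) => i; case: cid.
exists (oform F (fun i => emb (v i) : completion P)); first exact: pos.
apply: le_trans (_ : c * d <= e); last first.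
  apply: le_trans (ler_wpM2l c0 de) _; rewrite mulrCA ler_piMr ?(ltW e0)//.
  by rewrite ler_pdivrMr ?mul1r ?lerDl// ltr_wpDl.
rewrite /oform -sumrB; apply: le_trans (normc_sum _ _ _) _.
apply: le_trans (_ : \sum_(i < n.+1) \sum_(j < n.+1) M * (2 * r + 1) * d <= _); last first.
  by rewrite !sumr_const !card_ord -mulrnA -[leLHS]mulr_natl natrM /c !mulrA.
apply: ler_sum => i _; rewrite -sumrB; apply: le_trans (normc_sum _ _ _) _.
apply: ler_sum => j _; set y := emb (v i) : K; set y' := emb (v j) : K.
have hi := hv i; have hj := hv j; rewrite -/y in hi; rewrite -/y' in hj.
have -> : hdot K (F i j (xi j)) (xi i) - hdot K (F i j y') y =
   hdot K (F i j (xi j - y')) y + hdot K (F i j (xi j)) (xi i - y).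
  by rewrite (linB (lF i j)) (hfB hs) (hfBr hs); ring.
have yb : hn y <= r + 1.
  have := snB hs (xi i) (xi i - y); rewrite subKr -/(hn _) -/(hn (xi i)) -/(hn (xi i - y)).
  by have := rP i; rewrite /hn in hi *; lra.
have [_ hF] := hM i j; apply: le_trans (normcD _ _) _.
have h1 := hf_CS hs (F i j (xi j - y')) y; have h2 := hf_CS hs (F i j (xi j)) (xi i - y).
have h3 : hn (F i j (xi j - y')) * hn y <= M * d * (r + 1).
  apply: ler_pM; rewrite ?hn_ge0//; apply: le_trans (hF _) _; exact: ler_wpM2l.
have h4 : hn (F i j (xi j)) * hn (xi i - y) <= M * r * d.
  apply: ler_pM; rewrite ?hn_ge0//; apply: le_trans (hF _) _; apply: ler_wpM2l => //.
have -> : M * (2 * r + 1) * d = M * d * (r + 1) + M * r * d by ring.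
by apply: lerD; [apply: le_trans h3|apply: le_trans h4].
Qed.
End PosTools.

Section UltraEmbedding.
Variable R : realType.
Local Notation C := R[i].
Variables (S : nat -> opsys R) (u : forall n, S n -> S n.+1).
Arguments u : clear implicits.
Hypothesis hu : forall n, unital_complete_order_embedding (u n).
Variables (A : nat -> cstar R) (io : forall n, S n -> A n) (pp : forall n, A n -> A n.+1).
Arguments io : clear implicits.
Arguments pp : clear implicits.
Hypothesis hio : forall n, unital_complete_order_embedding (io n).
Hypothesis hpp : forall n, star_hom (pp n).
Hypothesis hcomm : forall n s, pp n (io n s) = io n.+1 (u n s).

Local Notation H := (fun m => os_hilb (A m)).
Local Notation P := (family_pre (ultra_sum R) H).
Local Notation K := (family_hilbert (ultra_sum R) H).

(** On the [S N] the representations [upi] are compatible with the inclusions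
[u]. *)
Definition uemb N (s : S N) : BH K := upi pp (io N s).

Lemma uemb_lin N : linear (@uemb N).
Proof.
have [l1 _ _] := hio N; have [l2 _ _ _] := upi_hom hpp N.
exact: (lin_comp l1 l2).
Qed.

Lemma uemb_one N : uemb (os_one (S N)) = os_one (BH K).
Proof. by rewrite /uemb; case: (hio N) => _ -> _; case: (upi_hom hpp N). Qed.

Lemma uemb_comp N s : uemb (u N s) = uemb s.
Proof. by rewrite /uemb -hcomm upi_comp. Qed.

Lemma push_io N m : (N <= m)%N -> exists2 w : S N -> S m,
  unital_complete_order_embedding w & forall s, push pp (io N s) m = io m (w s).
Proof.
move=> Nm; rewrite -(subnK Nm); elim: (m - N)%N => [|k [w hw wE]].
  by rewrite add0n; exists id => [|s]; [exact: embedding_id|rewrite push_diag].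
exists (u (k + N)%N \o w); first exact: embedding_comp hw (hu _).
by move=> s; rewrite [LHS](pushS pp (io N s) (leq_addl k N)) wE hcomm.
Qed.

Lemma uemb_clim N n (Y : 'M[S N]_n) (v : 'I_n -> P) :
  let z m := oform (fun i j => os_val (push pp (io N (Y i j)) m)) (fun i => fapp (v i) m) in
  ubounded z /\
  oform (fun i j => os_val (uemb (Y i j))) (fun i => emb (v i) : completion P) = clim z.
Proof.
move=> z; pose zz i j m := hdot (H m) (push pp (io N (Y i j)) m (fapp (v j) m)) (fapp (v i) m).
have zzE i j : hdot K (uemb (Y i j) (emb (v j) : completion P)) (emb (v i) : completion P) =
    clim (zz i j).
  by rewrite /uemb /upi (fam_rep_hdot _ _ (push_ubd hpp _)).
have zb i j : ubounded (zz i j).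
  have -> : zz i j = fun m => hdot (H m) (fapp (pop (M := ultra_sum R)
      (fun m => os_val (push pp (io N (Y i j)) m)) (v j)) m) (fapp (v i) m).
    by apply/funext => m; rewrite popE//; exact: push_ubd.
  exact: bounded_dom_ub (fdot_dom (M := ultra_sum R) (H := H) (pop (M := ultra_sum R)
     (fun m => os_val (push pp (io N (Y i j)) m)) (v j)) (v i)).
have inner i := clim_sum (index_enum 'I_n) (fun j => zb i j).
have [outer1 outer2] := clim_sum (index_enum 'I_n) (fun i => (inner i).1).
split; first exact: outer1.
rewrite [RHS]outer2; apply: eq_bigr => i _; rewrite (inner i).2.
by apply: eq_bigr => j _; exact: zzE.
Qed.

Lemma uemb_pos N n (X : 'M[S N]_n) : os_pos X -> os_pos (map_mx (@uemb N) X).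
Proof.
move=> hX.
have [M hM] : exists M, forall i j, bnd (uemb (X i j)) M.
  have hb i j : exists M, bnd (uemb (X i j)) M by exact: os_bnd.
  pose b i j := sval (cid (hb i j)).
  have bP i j : bnd (uemb (X i j)) (b i j) by rewrite /b; case: cid.
  have b0 i j : 0 <= b i j by have [] := bP i j.
  exists (\sum_i \sum_j b i j) => i j; apply: bndW (bP i j).
  rewrite (bigD1 i)//= (bigD1 j)//= -addrA lerDl addr_ge0//.
    by apply: sumr_ge0 => ? _.
  by do 2 (apply: sumr_ge0 => ? _).
have pos (v : 'I_n -> P) : 0 <= oform (fun i j => os_val (uemb (X i j))) (fun i => emb (v i) : completion P).
  have [zb ->] := uemb_clim X v; apply: clim_ge0 => //.
  apply: (@free_ultra_tail _ N) => m Nm /=.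
  have [w [lw w1 wP] wE] := push_io Nm; have [li i1 iP] := hio m.
  have /(_ (fun i => fapp (v i) m)) : os_pos (map_mx (io m) (map_mx w X)) by apply/iP/wP.
  congr (0 <= _); apply: eq_bigr => i _; apply: eq_bigr => j _.
  by rewrite !mxE wE.
have := oform_dense (fun i j => os_linear (uemb (X i j))) hM pos.
by move=> h xi; have := h xi; congr (0 <= _); apply: eq_bigr => i _; apply: eq_bigr => j _; rewrite mxE.
Qed.

(** If [Y] is not positive, then [Y + d] is not positive for some [d > 0], nor
is its image over any [A m] with [m >= N]. So there are bounded vectors [xi m]
at which the form of the image of [Y] is at most [- d]; the sequence [xi] is a
vector of the ultraproduct at which the form of the image of [Y] is at most [-
d] too. *)
Lemma uemb_reflect N n (Y : 'M[S N]_n) : (forall i j, Y j i = os_star (Y i j)) ->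
  os_pos (map_mx (@uemb N) Y) -> os_pos Y.
Proof.
move=> Yh hY; apply: contrapT => nY.
(* [Y] is not positive by a margin [d], since positivity is a closed condition. *)
pose Yd d : 'M[S N]_n := \matrix_(i, j) (Y i j + (d%:C * (i == j)%:R) *: os_one (S N)).
have [d d0 nd] : exists2 d, 0 < d & ~ os_pos (Yd d).
  apply: contrapT => h; apply: nY => xi; apply: ge0C_limit => e e0.
  have s1 : 0 < sqsum xi + 1 by rewrite ltr_wpDl// sqsum_ge0.
  pose d := e / (sqsum xi + 1); have d0 : 0 < d by rewrite divr_gt0.
  have pd : os_pos (Yd d) by apply: contrapT => nd; apply: h; exists d.
  have -> : \sum_i \sum_j hdot _ (Y i j (xi j)) (xi i) = oform (fun i j => os_val (Y i j)) xi by [].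
  exists (oform (fun i j => os_val (Y i j)) xi + d%:C * (sqsum xi)%:C).
    have := pd xi; congr (0 <= _); rewrite -oform_diag -oformD.
    by apply: eq_bigr => i _; apply: eq_bigr => j _; rewrite mxE.
  have dp : 0 <= d * sqsum xi by apply: mulr_ge0 (ltW d0) (sqsum_ge0 _).
  rewrite opprD addrA subrr add0r normcN -rmorphM normc_real ger0_norm//.
  by rewrite /d mulrAC -mulrA ler_piMr ?(ltW e0)// ler_pdivrMr// mul1r lerDl.
have bad m : exists xi : 'I_n -> H m, (forall i, hn (xi i) <= 1) /\
    ((N <= m)%N -> Re (oform (fun i j => os_val (push pp (io N (Y i j)) m)) xi) <= - d).
  have [mN|Nm] := ltnP m N.
    exists (fun _ => 0); split=> // i; rewrite /hn (sn0 (hdotP _))//.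
  have [w hw wE] := push_io Nm; have [lw w1 wP] := hw; have [li i1 iP] := hio m.
  have : ~ os_pos (map_mx (io m) (map_mx w (Yd d))) by move=> /iP/wP/nd.
  move=> /existsNP[xi hxi].
  have e1 : oform (fun i j => os_val (io m (w (Yd d i j)))) xi =
      oform (fun i j => os_val (push pp (io N (Y i j)) m)) xi + d%:C * (sqsum xi)%:C.
    rewrite -oform_diag -oformD; apply: eq_bigr => i _; apply: eq_bigr => j _.
    by rewrite mxE (linD lw) (linZ lw) w1 (linD li) (linZ li) i1 wE.
  have {}hxi : ~ (0 <= oform (fun i j => os_val (push pp (io N (Y i j)) m)) xi + d%:C * (sqsum xi)%:C).
    move=> h; apply: hxi; move: h; rewrite -e1; congr (0 <= _).
    by apply: eq_bigr => i _; apply: eq_bigr => j _; rewrite !mxE.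
  set x := oform _ xi in hxi e1.
  have xr : Im x = 0.
    have : x = x^*.
      rewrite /x; apply: oform_star => i j.
      by rewrite (Yh i j) (embedding_star (hio N)).1 push_star//; exact: (os_starP (push pp (io N (Y i j)) m)).
    by move=> /(congr1 (@complex.Im R)); rewrite ImJ; lra.
  have neg : Re x + d * sqsum xi < 0.
    rewrite ltNge; apply/negP => h; apply: hxi; apply/ge0C; rewrite !CE /= xr; split; lra.
  have s0 : 0 < sqsum xi.
    have := sqsum_ge0 xi; rewrite le_eqVlt => /orP[/eqP s0|//].
    have xi0 i : xi i = 0.
      apply: hn_eq0; apply/eqP; rewrite -sqrf_eq0 eq_le sqr_ge0 andbT.
      by rewrite expr2; apply: le_trans (hn_sqsum _ _ _) _; rewrite -s0.
    have : x = 0.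
      rewrite /x /oform big1// => i _; rewrite big1// => j _.
      by rewrite [xi i]xi0 (hf0r (hdotP _)).
    by move=> x0; move: neg; rewrite x0 -s0 mulr0 addr0 ltxx.
  pose t := (Num.sqrt (sqsum xi))^-1.
  have t0 : 0 < t by rewrite invr_gt0 sqrtr_gt0.
  have tt : t ^+ 2 = (sqsum xi)^-1 by rewrite /t exprVn sqr_sqrtr// ltW.
  exists (fun i => t%:C *: xi i); split=> [i|_].
    rewrite /hn (snZ (hdotP _)) normc_real ger0_norm ?(ltW t0)// -/(hn _).
    rewrite -(@ler_pXn2r _ 2) ?nnegrE ?mulr_ge0 ?hn_ge0 ?(ltW t0)// expr1n exprMn tt mulrC.
    by rewrite ler_pdivrMr// mul1r expr2 hn_sqsum.
  have -> : oform (fun i j => os_val (push pp (io N (Y i j)) m)) (fun i => t%:C *: xi i) =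
      (t ^+ 2)%:C * x.
    rewrite /x /oform mulr_sumr; apply: eq_bigr => i _; rewrite mulr_sumr; apply: eq_bigr => j _.
    rewrite (linZ (os_linear _)) (hfZ (hdotP _)) (hfZr (hdotP _)) conjC_rc.
    by rewrite expr2 rmorphM mulrA.
  rewrite tt !CE /= mul0r subr0 mulrC ler_pdivrMr//; lra.
pose xi m := sval (cid (bad m)).
have xiP m : (forall i, hn (xi m i) <= 1) /\
    ((N <= m)%N -> Re (oform (fun i j => os_val (push pp (io N (Y i j)) m)) (xi m)) <= - d).
  by rewrite /xi; case: cid.
have vs i : summable (ultra_sum R) (H := H) (fun m => xi m i).
  exists 1 => m; rewrite ger0_norm ?sqr_ge0// expr_le1 ?hn_ge0//.
  by have [h _] := xiP m; exact: h.
pose v i : P := fmk (vs i).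
have [zb zE] := uemb_clim Y v.
have : 0 <= oform (fun i j => os_val (uemb (Y i j))) (fun i => emb (v i) : completion P).
  have := hY (fun i => emb (v i) : completion P); congr (0 <= _).
  by apply: eq_bigr => i _; apply: eq_bigr => j _; rewrite mxE.
rewrite zE => /ge0C[+ _].
set z := (X in clim X) in zb zE *.
have zb' : ubounded (fun m => -1 * z m).
  have [M hM] := zb; have uP := @free_ultraP; exists M; apply: filterS hM => m /=.
  by rewrite mulN1r normcN.
have : d <= Re (clim (fun m => -1 * z m)).
  apply: clim_Re_ge zb' _; apply: (@free_ultra_tail _ N) => m Nm /=.
  by have [_ /(_ Nm)] := xiP m; rewrite mulN1r ReN /z; lra.
rewrite climZ// mulN1r ReN; lra.
Qed.

End UltraEmbedding.

Section Hermitization.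
Variable R : realType.
Local Notation C := R[i].

(** [Y + Y^* + 2 c], whose image is positive exactly when the real part of the
image of [Y] is at least [- c]. *)
Definition hermitize (S : opsys R) n (Y : 'M[S]_n) (c : R) : 'M[S]_n :=
  \matrix_(i, j) (Y i j + os_star (Y j i) + ((2 * c)%:C * (i == j)%:R) *: os_one S).

Lemma hermitize_star (S : opsys R) n (Y : 'M[S]_n) c i j :
  hermitize Y c j i = os_star (hermitize Y c i j).
Proof.
rewrite !mxE !os_starD os_starK os_starZ os_star1 [os_star _ + _]addrC [j == i]eq_sym.
congr (_ + _ *: _).
by case: (i == j); rewrite ?mulr1 ?mulr0 ?rmorph0 ?conjC_rc.
Qed.

Lemma oform_hermitize (S T : opsys R) (f : S -> T) n (Y : 'M[S]_n) c xi :
  linear f -> f (os_one S) = os_one T -> (forall x, f (os_star x) = os_star (f x)) ->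
  oform (fun i j => os_val (f (hermitize Y c i j))) xi =
    (2 * Re (oform (fun i j => os_val (f (Y i j))) xi) + 2 * c * sqsum xi)%:C.
Proof.
move=> lf f1 fS.
pose F i j := os_val (f (Y i j)); pose G i j := os_val (f (os_star (Y j i))).
have -> : oform (fun i j => os_val (f (hermitize Y c i j))) xi =
    oform F xi + oform G xi + (2 * c)%:C * (sqsum xi)%:C.
  rewrite -oform_diag -!oformD; apply: eq_bigr => i _; apply: eq_bigr => j _.
  by rewrite mxE !(linD lf) (linZ lf) f1.
have -> : oform G xi = (oform F xi)^*.
  by apply: oform_star => i j; rewrite /G fS; exact: os_starP.
by apply: eqCri; rewrite !CE /=; ring.
Qed.
End Hermitization.

Section LimitEmbedding.
Variable R : realType.
Local Notation C := R[i].
Variables (S : nat -> opsys R) (u : forall n, S n -> S n.+1).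
Variables (L : opsys R) (l : forall n, S n -> L).
Arguments l : clear implicits.
Hypothesis hl : forall n, unital_complete_order_embedding (l n).
Hypothesis lu : forall n (s : S n), l n s = l n.+1 (u s).
Hypothesis ldense : norm_dense (S := L) (\bigcup_n range (l n)).
Variables (T : opsys R) (f : forall n, S n -> T) (g : L -> T).
Arguments f : clear implicits.
Hypothesis hg : ucp g.
Hypothesis gl : forall n s, g (l n s) = f n s.
Hypothesis f_reflect : forall N n (Y : 'M[S N]_n), (forall i j, Y j i = os_star (Y i j)) ->
  os_pos (map_mx (f N) Y) -> os_pos Y.

Let hgl : linear g. Proof. by case: hg. Qed.
Let g1 : g (os_one L) = os_one T. Proof. by case: hg. Qed.

Lemma ucp_star_bnd : (forall x, g (os_star x) = os_star (g x)) /\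
  (forall (x : L) M, bnd x M -> bnd (g x) M).
Proof. by apply: ucp_like_star => // X; case: hg => _ _; apply. Qed.

(** [X] is approximated by a matrix [Y] over some [S N]. When [c] bounds the
error, [Y + Y^* + 2 c] has a positive image, hence is positive, and the real
part of [X] is at least [- 2 c]. *)
Lemma limit_Re_reflect n (X : 'M[L]_n) :
  (forall xi, 0 <= Re (oform (fun i j => os_val (g (X i j))) xi)) ->
  forall xi, 0 <= Re (oform (fun i j => os_val (X i j)) xi).
Proof.
move=> hX xi; rewrite -oppr_le0; apply: (@ler_small _ _ (2 * (n%:R * n%:R * sqsum xi))) => e e0.
have [N [sg hsg]] := approx_list lu ldense [seq X ij.1 ij.2 | ij <- enum {: 'I_n * 'I_n}] e0.
have {}hsg i j : bnd (X i j - l N (sg (X i j))) e.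
  by apply: hsg; apply/mapP; exists (i, j) => //; exact: mem_enum.
have [gS gB] := ucp_star_bnd; have [ll l1 lP] := hl N; have [lS lB] := embedding_star (hl N).
pose Y := \matrix_(i, j) sg (X i j).
have pert (U : opsys R) (h : L -> U) xi' : linear h -> (forall (x : L) M, bnd x M -> bnd (h x) M) ->
    `|Re (oform (fun i j => os_val (h (X i j))) xi') -
      Re (oform (fun i j => os_val (h (l N (Y i j)))) xi')| <= n%:R * n%:R * e * sqsum xi'.
  move=> lh hB; rewrite -ReN -ReD; apply: le_trans (Re_le_normc _) _.
  have -> : oform (fun i j => os_val (h (X i j))) xi' - oform (fun i j => os_val (h (l N (Y i j)))) xi' =
      oform (fun i j => os_val (h (X i j - l N (sg (X i j))))) xi'.
    rewrite /oform -sumrB; apply: eq_bigr => i _; rewrite -sumrB; apply: eq_bigr => j _.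
    by rewrite mxE (linB lh) os_valB (hfB (hdotP _)).
  by apply: oform_bound => i j; exact: hB.
pose c := n%:R * n%:R * e.
have Zpos : os_pos (hermitize Y c).
  apply: f_reflect; first by move=> i j; exact: hermitize_star.
  move=> xi'; have -> : \sum_i \sum_j hdot _ (map_mx (f N) (hermitize Y c) i j (xi' j)) (xi' i) =
      oform (fun i j => os_val ((g \o l N) (hermitize Y c i j))) xi'.
    by apply: eq_bigr => i _; apply: eq_bigr => j _; rewrite [map_mx _ _ _ _]mxE /= gl.
  rewrite oform_hermitize; [|exact: lin_comp|by rewrite /= l1|by move=> x; rewrite /= lS gS].
  rewrite ler0c; have := pert T g xi' hgl gB; have := hX xi'; rewrite ler_distl -/c => h1.
  by move=> /andP[_]; move: h1; rewrite /=; lra.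
have /(_ xi) : os_pos (map_mx (l N) (hermitize Y c)) by apply/lP.
have -> : \sum_i \sum_j hdot _ (map_mx (l N) (hermitize Y c) i j (xi j)) (xi i) =
      oform (fun i j => os_val (l N (hermitize Y c i j))) xi.
  by apply: eq_bigr => i _; apply: eq_bigr => j _; rewrite [map_mx _ _ _ _]mxE.
rewrite oform_hermitize// ler0c.
have := pert L id xi (fun _ _ _ => erefl) (fun _ _ h => h); rewrite ler_distl /= -/c => /andP[h1 h2].
by rewrite /c in h1 h2 *; nra.
Qed.

(** A map that reflects the order of each [S N] reflects the order of the limit:
[limit_Re_reflect] handles real parts and, applied to [i X] and [- i X], shows
that imaginary parts vanish. *)
Lemma limit_embedding : unital_complete_order_embedding g.
Proof.
split; [exact: hgl|exact: g1|] => n X; split; last by case: hg => _ _; apply.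
move=> hX.
have gX xi : 0 <= oform (fun i j => os_val (g (X i j))) xi.
  have := hX xi; congr (0 <= _).
  by apply: eq_bigr => i _; apply: eq_bigr => j _; rewrite [map_mx _ _ _ _]mxE.
have sc (c : C) (U : opsys R) (h : L -> U) xi : linear h ->
    oform (fun i j => os_val (h ((\matrix_(i, j) (c *: X i j)) i j))) xi =
    c * oform (fun i j => os_val (h (X i j))) xi.
  move=> lh; rewrite /oform mulr_sumr; apply: eq_bigr => i _; rewrite mulr_sumr.
  by apply: eq_bigr => j _; rewrite mxE (linZ lh) (hfZ (hdotP _)).
have rl (c : C) : (forall xi, 0 <= Re (c * oform (fun i j => os_val (g (X i j))) xi)) ->
   forall xi, 0 <= Re (c * oform (fun i j => os_val (X i j)) xi).
  move=> h xi; rewrite -(sc c L id xi (fun _ _ _ => erefl)).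
  by apply: (limit_Re_reflect (X := \matrix_(i, j) (c *: X i j))) => xi'; rewrite sc.
move=> xi; apply/ge0C; split.
  have := rl 1 _ xi; rewrite mul1r; apply => xi'; rewrite mul1r.
  by have /ge0C[] := gX xi'.
have im0 xi' : Im (oform (fun i j => os_val (g (X i j))) xi') = 0.
  by have /ge0C[] := gX xi'.
have h1 : 0 <= Re ('i%C * oform (fun i j => os_val (X i j)) xi).
  by apply: rl => xi'; rewrite !CE /= im0; lra.
have h2 : 0 <= Re (- 'i%C * oform (fun i j => os_val (X i j)) xi).
  by apply: rl => xi'; rewrite !CE /= im0; lra.
rewrite -[LHS]/(Im (oform (fun i j => os_val (X i j)) xi)).
by move: h1 h2; rewrite !CE /=; lra.
Qed.
End LimitEmbedding.

Section GeneratedCover.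
Variable R : realType.
Local Notation C := R[i].
Variables (L : opsys R) (H : hilbert R) (g : L -> BH H).
Hypothesis hg : unital_complete_order_embedding g.

(** The *-algebra generated by the range of [g]. *)
Definition gen_set : set (H -> H) := fun h => forall P : set (H -> H),
  star_subalgebra P -> (forall x, P (os_val (g x))) -> P h.

Lemma gen_set_star : star_subalgebra gen_set.
Proof.
split.
- move=> h hh; apply: (hh _ (star_subalgebra_adjointable H)) => x.
  exact: (os_adjointable (g x)).
- by move=> P [].
- by move=> a x y hx hy P hP gP; case: (hP) => _ _ h _ _; apply: h; [exact: hx|exact: hy].
- by move=> x y hx hy P hP gP; case: (hP) => _ _ _ h _; apply: h; [exact: hx|exact: hy].
- move=> x hx; have xa : adjointable x.
    apply: (hx _ (star_subalgebra_adjointable H)) => y; exact: (os_adjointable (g y)).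
  have /adjointableP[x' [M [_ _ xx _ _]]] := xa; exists x' => // P hP gP.
  have Px := hx P hP gP; case: (hP) => _ _ _ _ /(_ x Px)[y Py xy].
  by rewrite (adjoint_unique xx xy).
Qed.

Definition gen_cstar : cstar R := closure_cstar gen_set_star.

Lemma gen_in x : op_closure gen_set (os_val (g x)).
Proof. by apply: (op_closure_sub gen_set_star) => P _; exact. Qed.

Definition gen_map (x : L) : gen_cstar := @os_mk R gen_cstar _ (gen_in x).

Lemma gen_map_embedding : unital_complete_order_embedding gen_map.
Proof.
have [lg g1 gP] := hg; split.
- by move=> a x y; apply: val_inj; rewrite /= lg.
- by apply: val_inj; rewrite /= g1.
- move=> n X; rewrite -gP; split=> h xi; have := h xi; congr (0 <= _);
    by apply: eq_bigr => i _; apply: eq_bigr => j _; rewrite !mxE.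
Qed.

Lemma gen_map_cover : is_cstar_cover gen_map.
Proof.
split; first exact: gen_map_embedding.
move=> P [P1 PL PM PS Pc] gP.
have sub : star_subalgebra (fun h : H -> H => exists2 x : gen_cstar, os_val x = h & P x).
  split.
  - by move=> _ [x <- _]; exact: (os_adjointable x).
  - by exists (os_one gen_cstar).
  - by move=> a _ _ [x <- Px] [y <- Py]; exists (a *: x + y) => //; exact: PL.
  - by move=> _ _ [x <- Px] [y <- Py]; exists (cs_mul x y) => //; exact: PM.
  - move=> _ [x <- Px]; exists (os_val (os_star x)); last exact: (os_starP x).
    by exists (os_star x) => //; exact: PS.
apply/seteqP; split=> // x _; apply: Pc => e /[dup]/ltW/ge0C[_ ei]; rewrite ltcE => /andP[_ /= e0].
have [_ h] := os_setP x; have [y Gy hy] := h _ e0.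
have [|z zE Pz] := Gy _ sub.
  by move=> s; exists (gen_map s) => //; apply: gP; exists s.
exists z => //; apply/opnorm_leE; exists (Re e); first exact: eqCri.
by move: hy; rewrite -zE.
Qed.
End GeneratedCover.

(** * Canonical maps into the C*-envelope of the limit *)

Lemma star_hom_comp (R : realType) (A B D : cstar R) (p : A -> B) (q : B -> D) :
  star_hom p -> star_hom q -> star_hom (q \o p).
Proof.
move=> [l1 o1 m1 s1] [l2 o2 m2 s2]; split=> [||x y|x] /=; first exact: lin_comp.
- by rewrite o1 o2.
- by rewrite m1 m2.
- by rewrite s1 s2.
Qed.

(** The preimage is closed because [p] is contractive. *)
Lemma star_hom_preimage (R : realType) (A : cstar R) (H : hilbert R) (G : set (H -> H))
    (hG : star_subalgebra G) (p : A -> BH H) : star_hom p ->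
  is_cstar_subalgebra (fun a : A => op_closure G (os_val (p a))).
Proof.
move=> hp; have [lp p1 pM pS] := hp; split.
- have -> : os_val (p (os_one A)) = id by rewrite p1.
  exact: op_closure_id hG.
- move=> c x y hx hy.
  have -> : os_val (p (c *: x + y)) = c *: os_val (p x) + os_val (p y) by rewrite lp.
  exact: op_closure_lin hG _ _ _ hx hy.
- move=> x y hx hy.
  have -> : os_val (p (cs_mul x y)) = os_val (p x) \o os_val (p y) by rewrite pM.
  exact: op_closure_comp hG _ _ hx hy.
- move=> x hx; have -> : os_val (p (os_star x)) = os_val (os_star (p x)) by rewrite pS.
  have [y hy xy] := op_closure_adj hG hx.
  by rewrite -(adjoint_unique xy (os_starP (p x))).
- move=> x hx; have /= clo := @op_closure_norm_closed R H G hG.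
  apply: clo; first exact: os_bounded (os_setP (p x)).
  move=> e /hx[y hy /opnorm_leE[M eM xy]]; exists (os_val (p y)) => //.
  apply/opnorm_leE; exists M => //.
  have -> : os_val (p x) - os_val (p y) = os_val (p (x - y)) by rewrite (linB lp).
  exact: (star_hom_bnd hp xy).
Qed.

Section CanonicalMaps.
Variable R : realType.
Local Notation C := R[i].
Variables (S : nat -> opsys R) (u : forall n, S n -> S n.+1).
Variables (L : opsys R) (l : forall n, S n -> L).
Arguments u : clear implicits.
Arguments l : clear implicits.
Hypothesis hu : forall n, unital_complete_order_embedding (u n).
Hypothesis u_increasing : forall n, cstar_e_increasing (u n).
Hypothesis L_lim : is_inductive_limit u l.
Variables (A : nat -> cstar R) (io : forall n, S n -> A n).
Arguments io : clear implicits.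
Hypothesis hio : forall n, is_cstar_envelope (io n).
Variables (E : cstar R) (iL : L -> E).
Hypothesis hE : is_cstar_envelope iL.

(** The C*-algebra generated by the range of [L] in the ultraproduct contains
the image of [A N], because [A N] is generated by [S N]; being a cover of [L] it
is mapped to [E]. *)
Lemma canonical_map N : exists r : A N -> E, star_hom r /\ forall s, r (io N s) = iL (l N s).
Proof.
have emb n : unital_complete_order_embedding (io n) by case: (hio n) => -[].
pose pp n := sval (cid (u_increasing (hio n) (hio n.+1))).
have ppP n : star_hom (pp n) /\ forall s, pp n (io n s) = io n.+1 (u n s).
  by rewrite /pp; case: cid => p /= [h _ k].
have hpp n := (ppP n).1; have hcomm n := (ppP n).2.
pose D := BH (family_hilbert (ultra_sum R) (fun m => os_hilb (A m))).
have [hl lu ldense univ] := L_lim.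
pose f n (s : S n) : D := uemb io pp s.
have hf n : ucp (f n).
  split; [exact: uemb_lin|exact: uemb_one|exact: uemb_pos].
have [g [[hg gl] _]] := univ D f (cs_closed (c := D)) hf (fun n s => esym (uemb_comp hpp hcomm s)).
have gE : unital_complete_order_embedding g.
  apply: (limit_embedding hl lu ldense hg gl) => M n Y hY.
  exact: uemb_reflect hY.
have [p [hp _ pg]] := hE.2 _ _ (gen_map_cover gE).
pose G := gen_cstar g.
have inG (a : A N) : op_closure (gen_set g) (os_val (upi pp a)).
  have sub := star_hom_preimage (gen_set_star g) (upi_hom hpp N).
  have gen : generates (range (io N)) by case: (hio N) => -[].
  have eT : (fun a : A N => op_closure (gen_set g) (os_val (upi pp a))) = setT.
    apply: gen sub _ => _ [s _ <-].
    rewrite -/(uemb io pp s) -[uemb io pp s]/(f N s) -gl; exact: gen_in.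
  by have : setT a by []; rewrite -eT.
pose q (a : A N) : G := @os_mk R G _ (inG a).
have hq : star_hom q.
  have [hl1 ho1 hm1 hs1] := upi_hom hpp N; split.
  - by move=> c x y; apply: val_inj; rewrite /= hl1.
  - by apply: val_inj; rewrite /= ho1.
  - by move=> x y; apply: val_inj; rewrite /= hm1.
  - by move=> x; apply/esym/os_starE; rewrite /= hs1; exact: (os_starP (upi pp x)).
exists (p \o q); split; first exact: star_hom_comp hp.
move=> s /=; rewrite -pg; congr p; apply: val_inj.
by rewrite /= gl.
Qed.
End CanonicalMaps.

(** * Perturbing the left tensor factors *)

Section GoodForms.
Variable R : realType.
Local Notation C := R[i].

(** What compressions by ucp maps and matrix coefficients of representations
have in common, and all that the perturbation argument uses; [k] is the squared
length of the vectors involved. *)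
Record goodform (V W : opsys R) n (Phi : 'I_n -> 'I_n -> tens V W -> C) (k : R) : Prop := GoodForm {
  gf_lin : forall i j, linear (Phi i j : tens V W -> C^o);
  gf_bnd : forall i j (x : V) (t : W) M N, bnd x M -> bnd t N ->
    normc (Phi i j (tens_pure x t)) <= M * N * k;
  gf_star : forall i j (x : V) (t : W),
    Phi i j (tens_pure (os_star x) (os_star t)) = (Phi j i (tens_pure x t))^*;
  gf_one : \sum_i Phi i i (tens_pure (os_one V) (os_one W)) = k%:C }.

Lemma kq_star k m (A A' : 'I_k -> 'I_k -> C) (B B' : 'I_m -> 'I_m -> C) z w :
  (forall a b, A' a b = (A b a)^*) -> (forall c d, B' c d = (B d c)^*) ->
  kq A' B' z w = (kq A B w z)^*.
Proof.
move=> hA hB; rewrite /kq rmorph_sum exchange_big; apply: eq_bigr => a _.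
rewrite rmorph_sum; apply: eq_bigr => b _.
rewrite rmorph_sum exchange_big; apply: eq_bigr => c _.
rewrite rmorph_sum; apply: eq_bigr => d _.
by rewrite /= !rmorphM /= conjCK hA hB; ring.
Qed.

Lemma kq_one k m (z : 'I_k -> 'I_m -> C) :
  kq (fun a b => (a == b)%:R) (fun c d => (c == d)%:R) z z =
  (sn (@l2dot R ('I_k * 'I_m)%type) (fun x => z x.1 x.2) ^+ 2)%:C.
Proof.
rewrite -(hf_diag (l2dotH R _)) /l2dot -(pair_bigA _ (fun a c => z a c * (z a c)^*)) /=.
apply: eq_bigr => a _; rewrite (bigD1 a)//= [X in _ + X]big1 ?addr0 => [|b]; last first.
  by move=> ba; do 2 (rewrite big1// => ? _); rewrite [a == b]eq_sym (negPf ba) mul0r mulr0 mul0r.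
apply: eq_bigr => c _; rewrite (bigD1 c)//= big1 ?addr0 => [|d]; last first.
  by move=> dc; rewrite [c == d]eq_sym (negPf dc) mulr0 mulr0 mul0r.
by rewrite !eqxx mulr1 mulr1 mulrC.
Qed.

Lemma goodform_ucp (V W : opsys R) n k m (f : V -> 'M[C]_k) (g : W -> 'M[C]_m)
    (z : 'I_n -> 'I_k -> 'I_m -> C) : ucp_mx f -> ucp_mx g ->
  exists c, goodform (fun i j => tens_lift (fun s t => kq (f s) (g t) (z i) (z j) : C^o)) c.
Proof.
move=> hf hg; pose nz i := sn (@l2dot R ('I_k * 'I_m)%type) (fun x => z i x.1 x.2).
have kb i j := kq_bilinear (z i) (z j) (lfam_ucp hf) (lfam_ucp hg).
exists (\sum_i nz i ^+ 2); split.
- by move=> i j; exact: tens_lift_linear.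
- move=> i j x t M N xM tN; rewrite tens_lift_pure//.
  have [M0 _] := xM; have [N0 _] := tN.
  apply: le_trans (kq_mbnd _ _ M0 N0 (ucp_mx_mbnd hf xM) (ucp_mx_mbnd hg tN)) _.
  rewrite ler_wpM2l ?mulr_ge0// -/(nz i) -/(nz j).
  have h l : nz l ^+ 2 <= \sum_i nz i ^+ 2.
    by rewrite (bigD1 l)//= lerDl; apply: sumr_ge0 => ? _; exact: sqr_ge0.
  have := h i; have := h j; have := sqr_ge0 (nz i - nz j); nra.
- move=> i j x t; rewrite !tens_lift_pure//.
  by apply: kq_star => *; exact: ucp_mx_star.
- rewrite rmorph_sum; apply: eq_bigr => i _; rewrite tens_lift_pure//.
  transitivity (kq (fun a b => (a == b)%:R) (fun c d => (c == d)%:R) (z i) (z i)); last exact: kq_one.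
  by case: hf => _ -> _; case: hg => _ -> _; apply: eq_kq => *; rewrite mxE.
Qed.

Lemma goodform_rep (V W D : opsys R) n (p : tens V W -> D) (xi : 'I_n -> os_hilb D) :
  linear p -> p (tens_pure (os_one V) (os_one W)) = os_one D ->
  (forall x t, p (tens_pure (os_star x) (os_star t)) = os_star (p (tens_pure x t))) ->
  (forall (x : V) (t : W) M N, bnd x M -> bnd t N -> bnd (p (tens_pure x t)) (M * N)) ->
  goodform (fun i j u => hdot (os_hilb D) (p u (xi j)) (xi i)) (sqsum xi).
Proof.
move=> lp p1 pS pB; have hs := hdotP (os_hilb D); split.
- by move=> i j a x y; rewrite lp os_valL (hfP hs).
- move=> i j x t M N xM tN; have [MN h] := pB _ _ _ _ xM tN.
  apply: le_trans (hf_CS hs _ _) _; rewrite -/(hn _) -/(hn (xi i)).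
  apply: le_trans (ler_wpM2r (hn_ge0 _) (h _)) _.
  by rewrite -[leLHS]mulrA ler_wpM2l// hn_sqsum.
- by move=> i j x t; rewrite pS (adjoint_sym (os_starP _)) (hfC hs).
- by rewrite rmorph_sum; apply: eq_bigr => i _; rewrite p1 os_val1 hdot_sqr.
Qed.

Section Perturb.
Variables (S L T : opsys R) (l : S -> L).
Hypothesis hl : unital_complete_order_embedding l.
Variables (n : nat) (X : 'M[tens L T]_n) (sg : L -> S) (tb : T -> R) (e : R).
Hypothesis e0 : 0 <= e.
Hypothesis hsg : forall x, x \in lsupp X -> bnd (x - l (sg x)) e.
Hypothesis htb : forall t : T, bnd t (tb t).

(** A bound for the effect on [X] of moving its left tensor factors by at most
1. *)
Definition wt : R := \sum_i \sum_j \sum_(p <- repr (X i j)) tb p.2.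
Definition half : 'M[tens S T]_n :=
  \matrix_(i, j) \sum_(p <- repr (X i j)) tens_pure (sg p.1) p.2.
Definition half_star : 'M[tens S T]_n :=
  \matrix_(i, j) \sum_(p <- repr (X j i)) tens_pure (os_star (sg p.1)) (os_star p.2).
(** [Y + Y^* + 2 e wt], where [Y] is [X] with its left tensor factors moved to
[S]. *)
Definition approximant : 'M[tens S T]_n := \matrix_(i, j)
  (half i j + half_star i j +
   ((2 * (e * wt))%:C * (i == j)%:R) *: tens_pure (os_one S) (os_one T)).

(** [W] is the real part of the form of [Y], whose left factors are within [e]
of those of [X]. *)
Lemma approximantP (Phi : 'I_n -> 'I_n -> tens L T -> C) k : goodform Phi k ->
  exists2 W : R, `|Re (\sum_i \sum_j Phi i j (X i j)) - W| <= e * wt * k &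
   \sum_i \sum_j Phi i j (tens_map l id (approximant i j)) = (2 * W + 2 * (e * wt) * k)%:C.
Proof.
move=> gf; have [li l1 lP] := hl; have [lS _] := embedding_star hl.
have lid : linear (id : T -> T) by [].
have lm : linear (tens_map l (id : T -> T)) by exact: tens_map_linear.
have lF i j := gf_lin gf i j.
pose w i j := Phi i j (tens_map l id (half i j)).
have wE i j : w i j = \sum_(p <- repr (X i j)) Phi i j (tens_pure (l (sg p.1)) p.2).
  rewrite /w mxE (lin_sum lm) (lin_sum (lF i j)); apply: eq_bigr => p _.
  by rewrite tens_map_pure.
pose W := \sum_i \sum_j w i j.
exists (Re W).
  rewrite -ReN -ReD; apply: le_trans (Re_le_normc _) _.
  rewrite /W -sumrB /wt mulr_sumr mulr_suml; apply: le_trans (normc_sum _ _ _) _.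
  apply: ler_sum => i _; rewrite -sumrB mulr_sumr mulr_suml.
  apply: le_trans (normc_sum _ _ _) _; apply: ler_sum => j _.
  rewrite wE {1}[X i j]tens_sumE (lin_sum (lF i j)) -sumrB mulr_sumr mulr_suml.
  apply: le_trans (normc_sum _ _ _) _; rewrite !big_seq; apply: ler_sum => p pX.
  have -> : Phi i j (tens_pure p.1 p.2) - Phi i j (tens_pure (l (sg p.1)) p.2) =
      Phi i j (tens_pure (p.1 - l (sg p.1)) p.2).
    by rewrite -(linB (lF i j)) -(linB ((tens_pure_bilinear L T).1 p.2)).
  apply: gf_bnd gf _ _ _ _ _ _ _ (htb _); apply: hsg.
  by apply/allpairsPdep; exists (i, j), p; split=> //; exact: mem_enum.
have sE i j : Phi i j (tens_map l id (half_star i j)) = (w j i)^*.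
  rewrite mxE (lin_sum lm) (lin_sum (lF i j)) wE rmorph_sum; apply: eq_bigr => p _.
  by rewrite tens_map_pure// lS (gf_star gf).
have -> : \sum_i \sum_j Phi i j (tens_map l id (approximant i j)) =
   W + W^* + (2 * (e * wt))%:C * k%:C.
  have -> : W^* = \sum_i \sum_j (w j i)^*.
    rewrite /W rmorph_sum exchange_big; apply: eq_bigr => i _.
    by rewrite rmorph_sum.
  rewrite -(gf_one gf) mulr_sumr /W -!big_split; apply: eq_bigr => i _ /=.
  have F j : Phi i j (tens_map l id (approximant i j)) = w i j + (w j i)^* +
      (2 * (e * wt))%:C * (i == j)%:R * Phi i j (tens_pure (os_one L) (os_one T)).
    rewrite mxE !(linD lm) (linZ lm) !(linD (lF i j)) (linZ (lF i j)) sE tens_map_pure// l1.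
    by [].
  rewrite (eq_bigr _ (fun j _ => F j)) !big_split /=; congr (_ + _).
  rewrite (bigD1 i)//= big1 ?addr0 ?eqxx ?mulr1// => j.
  by rewrite eq_sym => /negPf ->; rewrite mulr0 mul0r.
by apply: eqCri; rewrite !CE /=; ring.
Qed.
End Perturb.
End GoodForms.

(** * Nuclearity of the limit *)

Section Trivial.
Variable R : realType.
Local Notation C := R[i].

(** In this case [1 = 0], and tensors vanish. *)
Definition trivial_space (S : opsys R) := forall h : os_hilb S, h = 0.

Lemma nontrivial_unit (S : opsys R) : ~ trivial_space S -> exists h : os_hilb S, h != 0.
Proof.
by move=> h; apply: contrapT => nh; apply: h => x; apply/eqP/negPn/negP => x0; apply: nh; exists x.
Qed.

Lemma trivial_embedding (S T : opsys R) (f : S -> T) : linear f ->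
  f (os_one S) = os_one T -> trivial_space S -> trivial_space T.
Proof.
move=> lf f1 tS h.
have e : os_one S = 0 by apply: os_eq => x; exact: tS.
by rewrite -(os_val1 h) -f1 e (lin0 lf).
Qed.

Lemma trivial_eq0 (S : opsys R) : trivial_space S -> forall x : S, x = 0.
Proof. by move=> tS x; apply: os_eq => h; rewrite os_val0; exact: tS. Qed.

Lemma tens_trivial (S T : opsys R) : trivial_space S \/ trivial_space T ->
  forall x : tens S T, x = 0.
Proof.
have bil := tens_pure_bilinear S T.
move=> tST; apply: tens_ind => [//|x y -> ->|x y]; first by rewrite addr0.
case: tST => tr.
  by rewrite (trivial_eq0 tr x) (lin0 (bil.1 y)).
by rewrite (trivial_eq0 tr y) (lin0 (bil.2 x)).
Qed.

Lemma min_pos0 (S T : opsys R) n (X : 'M[tens S T]_n) : (forall i j, X i j = 0) -> min_pos X.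
Proof.
move=> X0; apply/min_posE => k m f g hf hg z.
rewrite /Q big1// => i _; rewrite big1// => j _; rewrite X0.
exact: (lin0 (tens_lift_linear (kq_bilinear _ _ (lfam_ucp hf) (lfam_ucp hg)))).
Qed.

Lemma ess_pos0 (S T : opsys R) n (X : 'M[tens S T]_n) : (forall i j, X i j = 0) -> ess_pos X.
Proof.
move=> X0 A i B j [[[li _ _] _] _] [[[lj _ _] _] _] M q [[lq _ _ _] _ _] xi.
rewrite big1// => a _; rewrite big1// => b _; rewrite !mxE X0.
by rewrite (lin0 (tens_map_linear li lj)) (lin0 lq) os_val0 (hf0 (hdotP _)).
Qed.

(** If one of the systems had no C*-envelope, every matrix would be in [ess_pos]
vacuously; but [- 1 (x) 1] is not in [min_pos]. *)
Lemma envelopes_exist (S T : opsys R) : nuclear (@min_pos R) (@ess_pos R) S ->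
  ~ trivial_space S -> ~ trivial_space T ->
  (exists (A : cstar R) (i : S -> A), is_cstar_envelope i) /\
  (exists (B : cstar R) (j : T -> B), is_cstar_envelope j).
Proof.
move=> nuc /nontrivial_unit/unit_state[f hf] /nontrivial_unit/unit_state[g hg].
pose X : 'M[tens S T]_1 := \matrix_(_, _) (- tens_pure (os_one S) (os_one T)).
have nX : ~ min_pos X.
  move=> /min_posE/(_ _ _ f g hf hg (fun _ _ _ => 1)).
  have bil := kq_bilinear (fun _ _ => 1) (fun _ _ => 1) (lfam_ucp hf) (lfam_ucp hg).
  rewrite /Q !big_ord1 mxE (linN (tens_lift_linear bil)) tens_lift_pure//.
  case: hf => _ -> _; case: hg => _ -> _.
  by rewrite /kq !big_ord1 !mxE !eqxx conjC1 !mulr1 => /ge0C[+ _]; rewrite ReN /=; lra.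
have [A [i [B [j [hi hj]]]]] : exists (A : cstar R) (i : S -> A) (B : cstar R) (j : T -> B),
    is_cstar_envelope i /\ is_cstar_envelope j.
  apply: contrapT => none; apply: nX; apply/nuc => A i B j hi hj.
  by case: none; exists A, i, B, j.
by split; [exists A, i|exists B, j].
Qed.

Lemma tens_star_hom_comp (A A' B M : cstar R) (r : A -> A') (q : tens A' B -> M) :
  star_hom r -> tens_star_hom q -> tens_star_hom (q \o tens_map r id).
Proof.
move=> [lr r1 rM rS] [lq q1 qM qS]; have lid : linear (id : B -> B) by [].
have E a b : tens_map r id (tens_pure a b) = tens_pure (r a) b :> tens A' B.
  exact: tens_map_pure.
split.
- by apply: lin_comp lq; exact: tens_map_linear.
- by rewrite /= E r1.
- by move=> a a' b b'; rewrite /= !E rM qM.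
- by move=> a b; rewrite /= !E rS qS.
Qed.
End Trivial.

Section Main.
Variable R : realType.
Local Notation C := R[i].

(** The spatial representation of the tensor product of the envelopes is
dominated by the maximal one. *)
Lemma ess_pos_min_pos (S T : opsys R) n (X : 'M[tens S T]_n) :
  (exists (A : cstar R) (i : S -> A), is_cstar_envelope i) ->
  (exists (B : cstar R) (j : T -> B), is_cstar_envelope j) ->
  ess_pos X -> min_pos X.
Proof.
move=> [A [i hi]] [B [j hj]] hX.
have [[ei _] _] := hi; have [[ej _] _] := hj.
have := hX A i B j hi hj _ _ (max_mapP A B) => /max_map_pos/(_ _ _ (spat_star_hom A B)).
exact: spat_min.
Qed.

Variables (S : nat -> opsys R) (u : forall n, S n -> S n.+1).
Arguments u : clear implicits.
Hypothesis u_emb : forall n, unital_complete_order_embedding (u n).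
Hypothesis u_increasing : forall n, cstar_e_increasing (u n).
Hypothesis S_nuclear : forall n, nuclear (@min_pos R) (@ess_pos R) (S n).
Variables (L : opsys R) (l : forall n, S n -> L).
Arguments l : clear implicits.
Hypothesis L_lim : is_inductive_limit u l.

(** The approximant [Z] over [S N] is in [min_pos] by injectivity, hence
positive in the maximal tensor product of [A N] and [B] by nuclearity, and its
image in that of [E] and [B] is positive. So the real part of the form of [X] is
at least a negative multiple of [e], for all [e > 0]. *)
Lemma min_pos_Re (T : opsys R) n (X : 'M[tens L T]_n)
    (A : nat -> cstar R) (io : forall n, S n -> A n) (hio : forall n, is_cstar_envelope (io n))
    (E : cstar R) (i : L -> E) (hi : is_cstar_envelope i)
    (B : cstar R) (j : T -> B) (hj : is_cstar_envelope j)
    (M : cstar R) (q : tens E B -> M) (hq : is_max_tensor q) :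
  (forall k m (f : L -> 'M[C]_k) (g : T -> 'M[C]_m), ucp_mx f -> ucp_mx g ->
    forall z, 0 <= Re (Q X (fun s => f s) (fun t => g t) z)) ->
  forall xi, 0 <= Re (oform (fun a b => os_val (q (tens_map i j (X a b)))) xi).
Proof.
move=> hX xi; have [hl lu ldense _] := L_lim.
have [[ei _] _] := hi; have [[ej _] _] := hj; have [hom _ _] := hq.
have [li i1 iP] := ei; have [lj j1 jP] := ej; have [lq q1 qM qS] := hom.
have [iS iB] := embedding_star ei; have [jS jB] := embedding_star ej.
have lid (V : lmodType C) : linear (id : V -> V) by [].
have hb (t : T) : exists N, bnd t N by exact: os_bnd.
pose tb (t : T) := sval (cid (hb t)).
have htb (t : T) : bnd t (tb t) by rewrite /tb; case: cid.
rewrite -oppr_le0; apply: (@ler_small _ _ (2 * (wt X tb * sqsum xi))) => e e0.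
have [N [sg hsg]] := approx_list lu ldense (lsupp X) e0.
have el := hl N.
pose Z := approximant X sg tb e.
have Zmin : min_pos Z.
  apply: (min_pos_pullback el); apply/min_posE => k m f g hf hg z.
  have [c gf] := goodform_ucp z hf hg.
  have [W hW] := approximantP el hsg htb gf.
  have -> : \sum_a \sum_b tens_lift (fun s t => kq (f s) (g t) (z a) (z b) : C^o)
      (tens_map (l N) id (Z a b)) =
      Q (map_mx (tens_map (l N) id) Z) (fun s => f s) (fun t => g t) z.
    apply: eq_bigr => a _; apply: eq_bigr => b _; by rewrite [map_mx _ _ a b]mxE.
  move=> ->; rewrite ler0c; have := hX _ _ _ _ hf hg z.
  by move: hW; rewrite ler_distl /Q => /andP[]; lra.
have /S_nuclear Zess := Zmin.
have [r [hr rE]] := canonical_map u_emb u_increasing L_lim hio hi N.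
have /max_map_pos/(_ _ _ (tens_star_hom_comp hr hom))/(_ xi) :=
  Zess _ _ _ _ (hio N) hj _ _ (max_mapP (A N) B).
have [lr _ _ _] := hr; have [[[lio _ _] _] _] := hio N.
have [ll _ _] := el.
have gf : goodform (fun a b t => hdot _ (q (tens_map i j t) (xi b)) (xi a)) (sqsum xi).
  apply: (goodform_rep (p := fun t => q (tens_map i j t))).
  - exact: (lin_comp (tens_map_linear li lj) lq).
  - by rewrite tens_map_pure// i1 j1.
  - by move=> x t; rewrite !tens_map_pure// iS jS qS.
  - move=> x t M1 N1 xM tN; rewrite tens_map_pure//.
    by apply: (rep_pure_bnd hom); [exact: iB|exact: jB].
have [W hW eW] := approximantP el hsg htb gf.
have -> : \sum_a \sum_b hdot (os_hilb M) ((map_mx (q \o tens_map r id)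
      (map_mx (tens_map (io N) j) Z)) a b (xi b)) (xi a) = (2 * W + 2 * (e * wt X tb) * sqsum xi)%:C.
  rewrite -eW; apply: eq_bigr => a _; apply: eq_bigr => b _.
  rewrite [map_mx (q \o _) _ a b]mxE [map_mx _ Z a b]mxE /=; congr (hdot _ (os_val (q _) _) _).
  rewrite -/Z; move: (Z a b); apply: tens_lin_ext.
  - exact: (lin_comp (tens_map_linear lio lj) (tens_map_linear lr (lid B))).
  - exact: (lin_comp (tens_map_linear ll (lid T)) (tens_map_linear li lj)).
  - by move=> x t; rewrite !tens_map_pure// rE.
rewrite ler0c; move: hW; rewrite ler_distl /oform => /andP[h1 h2] h3.
by nra.
Qed.

(** [min_pos_Re] gives the real part; applied to [i X] and [- i X], it shows
that the imaginary part vanishes. *)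
Lemma min_pos_ess_pos (T : opsys R) n (X : 'M[tens L T]_n)
    (A : nat -> cstar R) (io : forall n, S n -> A n) (hio : forall n, is_cstar_envelope (io n)) :
  min_pos X -> ess_pos X.
Proof.
move=> /min_posE hX E i B j hi hj M q hq xi.
have [[ei _] _] := hi; have [[ej _] _] := hj; have [[lq _ _ _] _ _] := hq.
have [li _ _] := ei; have [lj _ _] := ej; have lij := tens_map_linear li lj.
pose x := oform (fun a b => os_val (q (tens_map i j (X a b)))) xi.
have key (c : C) : (forall k m (f : L -> 'M[C]_k) (g : T -> 'M[C]_m), ucp_mx f -> ucp_mx g ->
    forall z, 0 <= Re (c * Q X (fun s => f s) (fun t => g t) z)) -> 0 <= Re (c * x).
  move=> h; have e1 : oform (fun a b => os_val (q (tens_map i j ((\matrix_(a, b) (c *: X a b)) a b)))) xi = c * x.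
    rewrite /x /oform mulr_sumr; apply: eq_bigr => a _; rewrite mulr_sumr; apply: eq_bigr => b _.
    by rewrite mxE (linZ lij) (linZ lq) os_valZ (hfZ (hdotP _)).
  rewrite -e1; apply: (min_pos_Re hio hi hj hq) => k m f g hf hg z.
  rewrite (_ : Q _ _ _ z = c * Q X (fun s => f s) (fun t => g t) z); first exact: h.
  have bil a b := kq_bilinear (z a) (z b) (lfam_ucp hf) (lfam_ucp hg).
  rewrite /Q mulr_sumr; apply: eq_bigr => a _; rewrite mulr_sumr; apply: eq_bigr => b _.
  by rewrite mxE (linZ (tens_lift_linear (bil a b))).
have -> : \sum_a \sum_b hdot (os_hilb M) (map_mx q (map_mx (tens_map i j) X) a b (xi b)) (xi a) = x.
  by apply: eq_bigr => a _; apply: eq_bigr => b _; rewrite !mxE.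
apply/ge0C; split.
  have := key 1 _; rewrite mul1r; apply => k m f g hf hg z; rewrite mul1r.
  by have /ge0C[] := hX k m f g hf hg z.
have h1 : 0 <= Re ('i%C * x).
  by apply: key => k m f g hf hg z; have /ge0C[_] := hX k m f g hf hg z; rewrite !CE /=; lra.
have h2 : 0 <= Re (- 'i%C * x).
  by apply: key => k m f g hf hg z; have /ge0C[_] := hX k m f g hf hg z; rewrite !CE /=; lra.
by move: h1 h2; rewrite !CE /=; lra.
Qed.

Lemma limit_nuclear : nuclear (@min_pos R) (@ess_pos R) L.
Proof.
move=> T n X; have [hl _ _ _] := L_lim.
(* On a trivial Hilbert space there are no states, so that [envelopes_exist] does
   not apply; but then every tensor is 0. *)
have [tL|nL] := pselect (trivial_space L).
  have X0 i j : X i j = 0 by (apply: tens_trivial; left; exact: tL).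
  split=> _; [exact: ess_pos0 X0|exact: min_pos0 X0].
have [tT|nT] := pselect (trivial_space T).
  have X0 i j : X i j = 0 by (apply: tens_trivial; right; exact: tT).
  split=> _; [exact: ess_pos0 X0|exact: min_pos0 X0].
have nS m : ~ trivial_space (S m).
  by move=> tS; apply: nL; have [ll l1 _] := hl m; exact: trivial_embedding ll l1 tS.
have envS m : exists (A : cstar R) (i : S m -> A), is_cstar_envelope i.
  exact: (envelopes_exist (S_nuclear (n := m)) (nS m) nT).1.
pose A m := sval (cid (envS m)).
have hA m : exists i : S m -> A m, is_cstar_envelope i by rewrite /A; case: cid.
pose io m := sval (cid (hA m)).
have hio m : is_cstar_envelope (io m) by rewrite /io; case: cid.
split; first exact: min_pos_ess_pos hio.
apply: ess_pos_min_pos.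
  exact: (envelopes_exist (S_nuclear (n := 0)) (nS 0%N) nL).2.
exact: (envelopes_exist (S_nuclear (n := 0)) (nS 0%N) nT).2.
Qed.
End Main.

Theorem theorem4p5 (R : realType) (S : nat -> opsys R)
    (u : forall n, S n -> S n.+1)
    (u_emb : forall n, unital_complete_order_embedding (u n))
    (S_unitaries : forall n, enough_unitaries_in_envelope (S n))
    (u_increasing : forall n, cstar_e_increasing (u n))
    (S_nuclear : forall n, nuclear (@min_pos R) (@ess_pos R) (S n))
    (L : opsys R) (l : forall n, S n -> L)
    (L_lim : is_inductive_limit u l) :
  nuclear (@min_pos R) (@ess_pos R) L.
Proof. exact: (limit_nuclear u_emb u_increasing S_nuclear L_lim). Qed.
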